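(* Let $\mathrm{P}\in\mathcal{P}$ and let $(z_t)_{t\in\frac12\mathbb{Z}}$ be a $\mathrm{P}$-sequence such that the subsequence $z_0,z_1,z_2,\ldots$ (integer indices $\ge0$) lies in $\mathbb{R}_-=\{x\in\mathbb{R}:x<0\}$ and $\sum_{k\ge0}1/|z_k|<\infty$ (sum over integers $k \geq 0$). Assume that $f$ is analytic in an open neighborhood of the left half-plane $\Omega=\{z\in\mathbb{C}:\mathrm{Re}\,z\le0\}$ and that $$|f(z)|\le \mathrm{C}\,(1+|z|)^{\mathrm{M}}\quad\text{for all } z\in\Omega$$ for some absolute constants $\mathrm{C}$ and $\mathrm{M}$. Then the pointwise limit $$\mathcal{S}_\infty f(x)=\lim_{n\to\infty}\mathcal{S}_nf(x)$$ exists whenever $\mathrm{Re}\,x<0$, and for such $x$ $$f(x)=\mathcal{S}_\infty f(x)+\mathcal{R}_\infty f(x),$$ with $$\mathcal{R}_\infty f(x)=\frac{1}{2\pi i}\int_{-i\infty}^{i\infty}\frac{f(y)}{y-x}\,\frac{\mathrm{H}(x)}{\mathrm{H}(y)}\,dy=\frac{1}{2\pi i}\int_{-i\infty}^{i\infty}\frac{f(y)}{y-x}\prod_{j=0}^\infty\frac{x-z_j}{y-z_j}\,dy .$$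
   Context: $\mathcal{P}$ denotes the set of polynomials $\mathrm{P}(x,y)=x^2+y^2-2axy-2b(x+y)+c$ with $a,b,c\in\mathbb{C}$. A $\mathrm{P}$-sequence is a sequence of complex numbers $(x_t)$ indexed by $t\in\frac12\mathbb{Z}=\{k/2:k\in\mathbb{Z}\}$ such that $\mathrm{P}(x_t,y)=(y-x_{t+\frac12})(y-x_{t-\frac12})$ (as polynomials in $y$) for all $t\in\frac12\mathbb{Z}$; $x_0$ is called its base point. For $x\in\mathbb{C}$ and any $\mathrm{P}$-sequence $(x_t)$ with base point $x_0=x$, put $\Phi_0(x,y)=1$ and $\Phi_k(x,y)=\prod_{j=0}^{k-1}(y-x_{j-\frac{k-1}{2}})$ for $k\ge1$; this does not depend on the chosen $\mathrm{P}$-sequence. For $f$ analytic in an open set $U$, define $$\partial_kf(x)=\frac{1}{2\pi i}\int_{\gamma}\frac{f(y)}{\Phi_{k+1}(x,y)}\,dy,$$ where $\gamma$ is any cycle in $U$ homologous to zero with respect to $U$ with winding number $1$ around each of the points $x_{j-\frac k2}$, $j=0,\ldots,k$ (which must lie in $U$), $(x_t)$ being a $\mathrm{P}$-sequence with base point $x$. Thus, for a $\mathrm{P}$-sequence $(z_t)$ with $z_0,\ldots,z_k\in U$, $\partial_kf(z_{k/2})=\frac{1}{2\pi i}\int_\gamma f(y)\prod_{j=0}^k(y-z_j)^{-1}\,dy$ with $\gamma$ having winding number $1$ around $z_0,\ldots,z_k$. The Taylor polynomials of $f$ with respect to $(z_t)$ are $\mathcal{S}_nf(x)=\sum_{k=0}^n\partial_kf(z_{k/2})\prod_{j=0}^{k-1}(x-z_j)$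 (empty products equal 1). The function $\mathrm{H}(x)=\prod_{j=0}^\infty(1-x/z_j)$ is entire, with zeros at $x=z_j$, $j=0,1,2,\ldots$. The integral $\int_{-i\infty}^{i\infty}$ is taken along the imaginary axis upwards. *)

(* Defs.v *)
From Stdlib Require Import Reals ZArith List.
From Coquelicot Require Import Coquelicot.
Open Scope C_scope.

(** A family indexed by [t] in [(1/2)Z] is a function [x : Z -> C] of [2 t]:
    [x k] stands for [x_{k/2}], so that the integer-indexed term [x_j] is
    [x (2 * j)]. *)

Definition polyP (a b c x y : C) : C :=
  x * x + y * y - 2 * a * x * y - 2 * b * (x + y) + c.

(** Two polynomials over [C] are equal iff they agree at every point of [C]. *)
Definition P_sequence (P : C -> C -> C) (x : Z -> C) : Prop :=
  forall (k : Z) (y : C),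
    P (x k) y = (y - x (k + 1)%Z) * (y - x (k - 1)%Z).

Fixpoint Cprod (u : nat -> C) (n : nat) : C :=
  match n with
  | O => 1
  | S m => Cprod u m * u m
  end.

(** Total operator, in the style of [Lim]: the limit of the partial products
    when it exists, unspecified otherwise. *)
Definition Cprod_inf (u : nat -> C) : C :=
  iota (T := C_CompleteNormedModule)
    (fun l : C => filterlim (Cprod u) eventually (locally (T := C_UniformSpace) l)).

(** Paths are parametrized by [[0,1]]. *)

Definition path_derive (g : R -> C) (t : R) : C :=
  (Derive (fun s => Re (g s)) t, Derive (fun s => Im (g s)) t).

(** A function is C^1 on a closed interval (with one-sided derivatives at the
    end points) iff it is the restriction of a C^1 function on [R]. *)
Definition C1_on (g : R -> C) (u v : R) : Prop :=
  exists h : R -> C,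
    (forall t : R, (u <= t <= v)%R -> g t = h t) /\
    (forall t : R,
       ex_derive (K := R_AbsRing) (V := C_R_NormedModule) h t /\
       continuous (T := R_UniformSpace) (U := C_UniformSpace) (path_derive h) t).

Definition piecewise_C1 (g : R -> C) : Prop :=
  exists (n : nat) (s : nat -> R),
    s O = 0%R /\ s n = 1%R /\
    (forall i : nat, (i < n)%nat ->
       (s i < s (S i))%R /\ C1_on g (s i) (s (S i))).

Definition closed_path_in (U : C -> Prop) (g : R -> C) : Prop :=
  piecewise_C1 g /\ g 0%R = g 1%R /\
  (forall t : R, (0 <= t <= 1)%R -> U (g t)).

Definition path_integral (g : R -> C) (F : C -> C) : C :=
  RInt (V := C_R_CompleteNormedModule)
    (fun t => F (g t) * path_derive g t) 0 1.

(** Formal integer combinations of paths. *)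
Definition chain : Type := list (Z * (R -> C))%type.

Definition cycle_in (U : C -> Prop) (G : chain) : Prop :=
  List.Forall (fun p => closed_path_in U (snd p)) G.

Definition on_chain (G : chain) (w : C) : Prop :=
  List.Exists (fun p => exists t : R, (0 <= t <= 1)%R /\ snd p t = w) G.

Definition chain_integral (G : chain) (F : C -> C) : C :=
  fold_right
    (fun p acc => RtoC (IZR (fst p)) * path_integral (snd p) F + acc) 0 G.

Definition two_pi_i : C := RtoC (2 * PI) * Ci.

(** Only meaningful when [w] is not on [G]. *)
Definition winding (G : chain) (w : C) : C :=
  / two_pi_i * chain_integral G (fun y => / (y - w)).

Definition homologous_to_zero (U : C -> Prop) (G : chain) : Prop :=
  forall w : C, ~ U w -> winding G w = 0.

(** [Phi x k y] is [prod_{j<k} (y - x_{j-(k-1)/2})], which is [Phi_k(x_0, y)]. *)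
Definition Phi (x : Z -> C) (k : nat) (y : C) : C :=
  Cprod (fun j => y - x (2 * Z.of_nat j - (Z.of_nat k - 1))%Z) k.

Definition is_partial (P : C -> C -> C) (U : C -> Prop) (k : nat)
    (f : C -> C) (x0 v : C) : Prop :=
  exists (x : Z -> C) (G : chain),
    P_sequence P x /\ x 0%Z = x0 /\
    cycle_in U G /\ homologous_to_zero U G /\
    (forall j : nat, (j <= k)%nat ->
       let w := x (2 * Z.of_nat j - Z.of_nat k)%Z in
       U w /\ ~ on_chain G w /\ winding G w = 1) /\
    v = / two_pi_i * chain_integral G (fun y => f y / Phi x (S k) y).

(** The common value of the contour integrals over all admissible P-sequences
    and cycles. *)
Definition partial (P : C -> C -> C) (U : C -> Prop) (k : nat)
    (f : C -> C) (x0 : C) : C :=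
  iota (T := C_CompleteNormedModule) (is_partial P U k f x0).

(** In [partial], [z (Z.of_nat k)] is [z_{k/2}]. *)
Definition taylor (P : C -> C -> C) (U : C -> Prop) (z : Z -> C)
    (f : C -> C) (n : nat) (x : C) : C :=
  sum_n (G := C_AbelianGroup)
    (fun k => partial P U k f (z (Z.of_nat k)) *
              Cprod (fun j => x - z (2 * Z.of_nat j)%Z) k) n.

Definition Hfun (z : Z -> C) (x : C) : C :=
  Cprod_inf (fun j => 1 - x / z (2 * Z.of_nat j)%Z).

(** Integral over the imaginary axis upwards, with [y = i s]. *)
Definition is_imaginary_axis_integral (F : C -> C) (I : C) : Prop :=
  is_RInt_gen (V := C_R_NormedModule)
    (fun s : R => F (Ci * RtoC s) * Ci)
    (Rbar_locally m_infty) (Rbar_locally p_infty) I.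

Definition analytic_in (U : C -> Prop) (f : C -> C) : Prop :=
  forall w : C, U w -> ex_derive (K := C_AbsRing) (V := C_NormedModule) f w.

(* Main.v *)
(** Let [p_j] stand for [z_{2j}] in the encoding of [Defs.v]. By the homology form
    of Cauchy's formula, [partial] at [z_{k/2}] is the divided difference
    [f[p_0, ..., p_k]]: a P-sequence is determined by its base point up to
    reversal, which only permutes the nodes. Hence [S_n f] is Newton's
    interpolation polynomial and [f x - S_n f x] is
    [f[p_0, ..., p_n, x] * prod_{j<=n} (x - p_j)], an integral over the boundary of
    a left half disc. For large [n] the arc contributes [O(1/r)], so the remainder
    is the integral of [f y / (y - x) * prod_{j<=n} (x - p_j) / (y - p_j)] along the
    imaginary axis. There [|1 - y/p_j| >= max(1, |y/p_j|)], which makes the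
    integrand [O(|y|^-2)] uniformly in [n] and its increments in [n] summable. *)

Require Import Defs.
From Stdlib Require Import Reals ZArith List Lra Lia Classical ClassicalEpsilon FunctionalExtensionality.
From Coquelicot Require Import Coquelicot.
Open Scope C_scope.

(** * Complex continuity and differentiability *)

(** Stated with [Cmod], whereas the balls of [C_UniformSpace] are those of the
    product [R * R]. *)
Definition Ccont (f : C -> C) (z : C) : Prop :=
  forall eps : R, 0 < eps -> exists d : R, 0 < d /\
    forall y, Cmod (y - z) < d -> Cmod (f y - f z) < eps.

Definition Cder (f : C -> C) (z l : C) : Prop :=
  forall eps : R, 0 < eps -> exists d : R, 0 < d /\
    forall y, Cmod (y - z) < d ->
      Cmod (f y - f z - l * (y - z)) <= eps * Cmod (y - z).

Lemma Cmod_eps_eq_0 (x : C) : (forall e, 0 < e -> Cmod x <= e) -> x = 0.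
Proof.
  intros H. apply Cmod_eq_0, Rle_antisym; [|apply Cmod_ge_0].
  apply le_epsilon. intros e He. rewrite Rplus_0_l. auto.
Qed.

Lemma Cmod_sub_sym (x y : C) : Cmod (x - y) = Cmod (y - x).
Proof. rewrite <- Cmod_opp. f_equal. ring. Qed.

Lemma Cmod_sub_diag (x : C) : Cmod (x - x) = 0%R.
Proof. replace (x - x) with (RtoC 0) by ring. apply Cmod_0. Qed.

Lemma Cmod_sub_triangle (x y z : C) : Cmod (x - z) <= Cmod (x - y) + Cmod (y - z).
Proof. replace (x - z) with ((x - y) + (y - z)) by ring. apply Cmod_triangle. Qed.

Lemma Cmod_sub_le (x y : C) : Cmod (x - y) <= Cmod x + Cmod y.
Proof. unfold Cminus. eapply Rle_trans. apply Cmod_triangle. rewrite Cmod_opp. lra. Qed.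

Lemma Cmod_le_add (x y : C) : Cmod x <= Cmod y + Cmod (x - y).
Proof. replace x with (y + (x - y)) at 1 by ring. apply Cmod_triangle. Qed.

Lemma Cmod_le_Re_Im (x : C) : Cmod x <= Rabs (Re x) + Rabs (Im x).
Proof.
  replace x with (RtoC (Re x) + Ci * RtoC (Im x)) at 1.
  - eapply Rle_trans. apply Cmod_triangle.
    rewrite Cmod_mult, Cmod_Ci, !Cmod_R. lra.
  - destruct x as [u v]. unfold Re, Im, Ci, RtoC, Cplus, Cmult; simpl. f_equal; ring.
Qed.

Lemma Rabs_Im_le_Cmod (x : C) : Rabs (Im x) <= Cmod x.
Proof. eapply Rle_trans; [|apply Rmax_Cmod]. apply Rmax_r. Qed.

Lemma C_UniformSpace_locally_Cmod (z : C) (P : C -> Prop) :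
  locally (T := C_UniformSpace) z P <->
  exists d : R, 0 < d /\ forall y, Cmod (y - z) < d -> P y.
Proof.
  split.
  - intros [d Hd]. exists d. split; [apply cond_pos|]. intros y Hy. apply Hd.
    apply C_NormedModule_mixin_compat1. exact Hy.
  - intros [d [Hd H]].
    assert (Hs : 0 < sqrt 2) by (apply sqrt_lt_R0; lra).
    exists (mkposreal (d / sqrt 2) (Rdiv_lt_0_compat _ _ Hd Hs)). intros y Hy. apply H.
    apply C_NormedModule_mixin_compat2 in Hy. simpl in Hy.
    replace (sqrt 2 * (d / sqrt 2))%R with d in Hy by (field; lra). exact Hy.
Qed.

Lemma Ccont_iff_continuous (f : C -> C) (z : C) :
  Ccont f z <-> continuous (T := C_UniformSpace) (U := C_UniformSpace) f z.
Proof.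
  split.
  - intros H P HP. apply C_UniformSpace_locally_Cmod in HP. destruct HP as [e [He HP]].
    destruct (H e He) as [d [Hd H1]].
    unfold filtermap. apply C_UniformSpace_locally_Cmod. exists d. split; [exact Hd|].
    intros y Hy. apply HP. auto.
  - intros H e He.
    assert (HP : locally (T := C_UniformSpace) (f z) (fun y => Cmod (y - f z) < e)).
    { apply C_UniformSpace_locally_Cmod. exists e. auto. }
    apply H in HP. unfold filtermap in HP.
    apply C_UniformSpace_locally_Cmod in HP. exact HP.
Qed.

Lemma Cder_iff_is_derive (f : C -> C) (z l : C) :
  Cder f z l <-> is_derive (K := C_AbsRing) (V := C_NormedModule) f z l.
Proof.
  split.
  - intros H. split.
    + apply is_linear_scal_l.
    + intros x Hx.
      assert (E : z = x) by exact (is_filter_lim_locally_unique (V := AbsRing_NormedModule C_AbsRing) z x Hx). subst x.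
      intros eps. destruct (H eps (cond_pos eps)) as [d [Hd H1]].
      exists (mkposreal d Hd). intros y Hy.
      specialize (H1 y Hy).
      rewrite (Cmult_comm l) in H1. exact H1.
  - intros [_ H] eps Heps.
    destruct (H z (fun P HP => HP) (mkposreal eps Heps)) as [d Hd].
    exists d. split; [apply cond_pos|]. intros y Hy.
    specialize (Hd y Hy). rewrite (Cmult_comm l). exact Hd.
Qed.

Lemma Cder_C_derive (f : C -> C) (z l : C) : Cder f z l -> C_derive f z = l.
Proof. intros H. apply is_C_derive_unique. apply Cder_iff_is_derive. exact H. Qed.

Definition Cdiffable (f : C -> C) (z : C) : Prop := exists l, Cder f z l.

Lemma Cdiffable_C_derive (f : C -> C) (z : C) : Cdiffable f z -> Cder f z (C_derive f z).
Proof. intros [l H]. rewrite (Cder_C_derive _ _ _ H). exact H. Qed.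

Lemma Cder_Ccont (f : C -> C) (z l : C) : Cder f z l -> Ccont f z.
Proof.
  intros H e He. destruct (H 1%R Rlt_0_1) as [d [Hd H1]].
  assert (Hk : 0 < 1 + Cmod l + 1) by (pose proof (Cmod_ge_0 l); lra).
  exists (Rmin d (e / (1 + Cmod l + 1))). split.
  { apply Rmin_glb_lt; [exact Hd|]. apply Rdiv_lt_0_compat; assumption. }
  intros y Hy.
  assert (Hy1 : Cmod (y - z) < d) by (apply (Rmin_Rgt_l _ _ _ Hy)).
  assert (Hy2 : Cmod (y - z) < e / (1 + Cmod l + 1)) by (apply (Rmin_Rgt_l _ _ _ Hy)).
  specialize (H1 y Hy1).
  pose proof (Cmod_le_add (f y - f z) (l * (y - z))) as H2. rewrite Cmod_mult in H2.
  apply (Rmult_lt_compat_r _ _ _ Hk) in Hy2.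
  unfold Rdiv in Hy2. rewrite Rmult_assoc, Rinv_l, Rmult_1_r in Hy2 by lra.
  pose proof (Cmod_ge_0 (y - z)). lra.
Qed.

Lemma Ccont_ext_loc (f g : C -> C) (z : C) (r : R) :
  0 < r -> (forall y, Cmod (y - z) < r -> f y = g y) -> Ccont f z -> Ccont g z.
Proof.
  intros Hr E H e He. destruct (H e He) as [d [Hd H1]].
  exists (Rmin d r). split; [apply Rmin_glb_lt; assumption|].
  intros y Hy. rewrite <- !E.
  - apply H1. apply (Rmin_Rgt_l _ _ _ Hy).
  - rewrite Cmod_sub_diag. exact Hr.
  - apply (Rmin_Rgt_l _ _ _ Hy).
Qed.

Lemma Cder_ext_loc (f g : C -> C) (z l : C) (r : R) :
  0 < r -> (forall y, Cmod (y - z) < r -> f y = g y) -> Cder f z l -> Cder g z l.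
Proof.
  intros Hr E H e He. destruct (H e He) as [d [Hd H1]].
  exists (Rmin d r). split; [apply Rmin_glb_lt; assumption|].
  intros y Hy. rewrite <- !E.
  - apply H1. apply (Rmin_Rgt_l _ _ _ Hy).
  - rewrite Cmod_sub_diag. exact Hr.
  - apply (Rmin_Rgt_l _ _ _ Hy).
Qed.

Lemma Cder_eq (f : C -> C) (z l l' : C) : Cder f z l -> l = l' -> Cder f z l'.
Proof. intros H <-. exact H. Qed.

Lemma Cder_const (c z : C) : Cder (fun _ => c) z 0.
Proof.
  intros e He. exists 1%R. split; [lra|]. intros y _.
  replace (c - c - 0 * (y - z)) with (RtoC 0) by ring. rewrite Cmod_0.
  apply Rmult_le_pos; [lra|apply Cmod_ge_0].
Qed.

Lemma Cder_id (z : C) : Cder (fun y => y) z 1.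
Proof.
  intros e He. exists 1%R. split; [lra|]. intros y _.
  replace (y - z - 1 * (y - z)) with (RtoC 0) by ring. rewrite Cmod_0.
  apply Rmult_le_pos; [lra|apply Cmod_ge_0].
Qed.

Lemma Cder_plus (f g : C -> C) (z l m : C) :
  Cder f z l -> Cder g z m -> Cder (fun y => f y + g y) z (l + m).
Proof.
  intros Hf Hg. apply Cder_iff_is_derive.
  apply (is_derive_plus (K := C_AbsRing) (V := C_NormedModule)); apply Cder_iff_is_derive; assumption.
Qed.

Lemma Cder_mult (f g : C -> C) (z l m : C) :
  Cder f z l -> Cder g z m -> Cder (fun y => f y * g y) z (l * g z + f z * m).
Proof.
  intros Hf Hg. apply Cder_iff_is_derive.
  apply Cder_iff_is_derive in Hf. apply Cder_iff_is_derive in Hg.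
  assert (H := is_derive_mult (K := C_AbsRing) f g z l m
    (conj (is_linear_scal_l _) (proj2 Hf)) (conj (is_linear_scal_l _) (proj2 Hg)) Cmult_comm).
  exact (conj (is_linear_scal_l _) (proj2 H)).
Qed.

Lemma Ccont_const (c z : C) : Ccont (fun _ => c) z.
Proof. eapply Cder_Ccont, Cder_const. Qed.

Lemma Ccont_id (z : C) : Ccont (fun y => y) z.
Proof. eapply Cder_Ccont, Cder_id. Qed.

Lemma Ccont_plus (f g : C -> C) (z : C) :
  Ccont f z -> Ccont g z -> Ccont (fun y => f y + g y) z.
Proof.
  intros Hf Hg e He.
  destruct (Hf (e / 2)%R ltac:(lra)) as [d1 [Hd1 H1]].
  destruct (Hg (e / 2)%R ltac:(lra)) as [d2 [Hd2 H2]].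
  exists (Rmin d1 d2). split; [apply Rmin_glb_lt; assumption|]. intros y Hy.
  specialize (H1 y ltac:(apply (Rmin_Rgt_l _ _ _ Hy))).
  specialize (H2 y ltac:(apply (Rmin_Rgt_l _ _ _ Hy))).
  replace (f y + g y - (f z + g z)) with ((f y - f z) + (g y - g z)) by ring.
  eapply Rle_lt_trans. apply Cmod_triangle. lra.
Qed.

Lemma Ccont_mult (f g : C -> C) (z : C) :
  Ccont f z -> Ccont g z -> Ccont (fun y => f y * g y) z.
Proof.
  intros Hf Hg e He.
  pose (A := (Cmod (f z) + Cmod (g z) + 1)%R).
  assert (HA : 1 <= A) by (unfold A; pose proof (Cmod_ge_0 (f z)); pose proof (Cmod_ge_0 (g z)); lra).
  pose (e' := Rmin 1 (e / (2 * A))).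
  assert (He' : 0 < e').
  { apply Rmin_glb_lt; [lra|]. apply Rdiv_lt_0_compat; lra. }
  assert (HeA : e' * A <= e / 2).
  { apply Rle_trans with (e / (2 * A) * A)%R.
    apply Rmult_le_compat_r; [lra|apply Rmin_r]. right; field; lra. }
  assert (He1 : e' <= 1) by apply Rmin_l.
  destruct (Hf e' He') as [d1 [Hd1 H1]].
  destruct (Hg e' He') as [d2 [Hd2 H2]].
  exists (Rmin d1 d2). split; [apply Rmin_glb_lt; assumption|]. intros y Hy.
  specialize (H1 y ltac:(apply (Rmin_Rgt_l _ _ _ Hy))).
  specialize (H2 y ltac:(apply (Rmin_Rgt_l _ _ _ Hy))).
  replace (f y * g y - (f z * g z)) with
    ((f y - f z) * (g y - g z) + ((f y - f z) * g z + f z * (g y - g z))) by ring.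
  eapply Rle_lt_trans. apply Cmod_triangle.
  eapply Rle_lt_trans. apply Rplus_le_compat_l, Cmod_triangle.
  rewrite !Cmod_mult.
  pose proof (Cmod_ge_0 (f z)). pose proof (Cmod_ge_0 (g z)).
  pose proof (Cmod_ge_0 (f y - f z)). pose proof (Cmod_ge_0 (g y - g z)).
  assert (Cmod (f y - f z) * Cmod (g y - g z) <= e' * 1) by (apply Rmult_le_compat; lra).
  assert (Cmod (f y - f z) * Cmod (g z) <= e' * Cmod (g z)) by (apply Rmult_le_compat_r; lra).
  assert (Cmod (f z) * Cmod (g y - g z) <= Cmod (f z) * e') by (apply Rmult_le_compat_l; lra).
  unfold A in HeA. lra.
Qed.

Lemma Cinv_neq_0 (z : C) : z <> 0 -> / z <> 0.
Proof. intros H E. apply C1_nz. rewrite <- (Cinv_r z H), E. ring. Qed.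

Lemma Cder_inv (z : C) : z <> 0 -> Cder (fun y => / y) z (- / (z * z)).
Proof.
  intros Hz e He.
  assert (Hm : 0 < Cmod z) by (apply Cmod_gt_0; exact Hz).
  pose (m := Cmod z).
  assert (Hm3 : 0 < m * m * m) by (unfold m; repeat apply Rmult_lt_0_compat; assumption).
  exists (Rmin (m / 2) (e * (m * m * m) / 2)). split.
  { apply Rmin_glb_lt; [unfold m; lra|].
    apply Rdiv_lt_0_compat; [apply Rmult_lt_0_compat; assumption|lra]. }
  intros y Hy.
  assert (Hy1 : Cmod (y - z) < m / 2) by (apply (Rmin_Rgt_l _ _ _ Hy)).
  assert (Hy2 : Cmod (y - z) < e * (m * m * m) / 2) by (apply (Rmin_Rgt_l _ _ _ Hy)).
  assert (Hym : m / 2 < Cmod y).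
  { pose proof (Cmod_le_add z y) as H. rewrite Cmod_sub_sym in H. fold m in H. lra. }
  assert (Hy0 : y <> 0) by (apply Cmod_gt_0; unfold m in *; lra).
  replace (/ y - / z - - / (z * z) * (y - z)) with ((y - z) * (y - z) / (y * (z * z)))
    by (field; auto).
  rewrite Cmod_div, !Cmod_mult by (repeat apply Cmult_neq_0; assumption).
  fold m.
  assert (Hd : m * m * m / 2 < Cmod y * (m * m)).
  { replace (m * m * m / 2)%R with (m / 2 * (m * m))%R by field.
    apply Rmult_lt_compat_r; [|exact Hym]. apply Rmult_lt_0_compat; exact Hm. }
  apply Rmult_le_reg_r with (Cmod y * (m * m))%R; [lra|].
  unfold Rdiv. rewrite (Rmult_assoc _ (/ _)), Rinv_l, Rmult_1_r by lra.
  pose proof (Cmod_ge_0 (y - z)) as H0.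
  rewrite (Rmult_comm e), Rmult_assoc. apply Rmult_le_compat_l; [exact H0|].
  apply Rle_trans with (e * (m * m * m / 2))%R; [lra|].
  apply Rmult_le_compat_l; lra.
Qed.

Lemma Cder_inv_sub (p z : C) : z - p <> 0 -> Cder (fun y => / (y - p)) z (- / ((z - p) * (z - p))).
Proof.
  intros Hz e He. destruct (Cder_inv (z - p) Hz e He) as [d [Hd H]]. exists d. split; [exact Hd|].
  intros y Hy. replace (y - z) with (y - p - (z - p)) in * by ring. apply H. exact Hy.
Qed.

Lemma Ccont_comp (f g : C -> C) (z : C) :
  Ccont f z -> Ccont g (f z) -> Ccont (fun y => g (f y)) z.
Proof.
  intros Hf Hg e He. destruct (Hg e He) as [d [Hd H]]. destruct (Hf d Hd) as [d' [Hd' H']].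
  exists d'. split; auto.
Qed.

Lemma Ccont_minus (f g : C -> C) (z : C) :
  Ccont f z -> Ccont g z -> Ccont (fun y => f y - g y) z.
Proof.
  intros Hf Hg. apply Ccont_plus; [exact Hf|].
  apply Ccont_ext_loc with (fun y => - (1) * g y) 1%R; [lra|intros; ring|].
  apply Ccont_mult; [apply Ccont_const|exact Hg].
Qed.

Lemma Ccont_inv (f : C -> C) (z : C) : Ccont f z -> f z <> 0 -> Ccont (fun y => / f y) z.
Proof.
  intros Hf H. apply (Ccont_comp f (fun y => / y)); [exact Hf|].
  eapply Cder_Ccont, Cder_inv, H.
Qed.

Lemma Ccont_div (f g : C -> C) (z : C) :
  Ccont f z -> Ccont g z -> g z <> 0 -> Ccont (fun y => f y / g y) z.
Proof. intros Hf Hg H. apply Ccont_mult; [exact Hf|]. apply Ccont_inv; assumption. Qed.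

Lemma Cdiffable_Ccont (f : C -> C) (z : C) : Cdiffable f z -> Ccont f z.
Proof. intros [l H]. exact (Cder_Ccont _ _ _ H). Qed.

Lemma Cdiffable_div_linear (f : C -> C) (p z : C) :
  Cdiffable f z -> z <> p -> Cdiffable (fun y => (f y - f p) / (y - p)) z.
Proof.
  intros [l Hf] H.
  assert (Hz : z - p <> 0) by (intros E; apply H; apply Ceq_minus; exact E).
  eexists. apply Cder_mult.
  - apply (Cder_plus f (fun _ => - f p)); [exact Hf|apply Cder_const].
  - apply Cder_inv_sub. exact Hz.
Qed.

Lemma Cder_sub_const (p z : C) : Cder (fun y => y - p) z 1.
Proof.
  eapply Cder_eq; [apply (Cder_plus (fun y => y) (fun _ => - p)); [apply Cder_id|apply Cder_const]|ring].
Qed.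

Lemma Cder_scal (c : C) (f : C -> C) (z l : C) : Cder f z l -> Cder (fun y => c * f y) z (c * l).
Proof.
  intros H. eapply Cder_eq; [apply (Cder_mult (fun _ => c) f); [apply Cder_const|exact H]|ring].
Qed.

(** * Path integral functionals *)

Notation CRInt := (RInt (V := C_R_CompleteNormedModule)).
Notation is_CRInt := (is_RInt (V := C_R_NormedModule)).
Notation ex_CRInt := (ex_RInt (V := C_R_NormedModule)).
Notation RCcont := (continuous (T := R_UniformSpace) (U := C_UniformSpace)).
Notation RCderive := (is_derive (K := R_AbsRing) (V := C_R_NormedModule)).

Lemma RCcont_pair (u v : R -> R) (t : R) :
  continuous u t -> continuous v t -> RCcont (fun s => (u s, v s)) t.
Proof.
  intros Hu Hv.
  apply (continuous_comp_2 (U := R_UniformSpace) (V := R_UniformSpace) (W := R_UniformSpace)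
    (X := C_UniformSpace) u v (fun a b => (a, b))); [exact Hu|exact Hv|].
  apply continuous_ext with (fun x => x); [intros [a b]; reflexivity|apply continuous_id].
Qed.

Lemma RCcont_fst (h : R -> C) (t : R) : RCcont h t -> continuous (fun s => fst (h s)) t.
Proof.
  intros H. apply (continuous_comp (V := C_UniformSpace) h (@fst R R)); [exact H|].
  apply continuous_fst.
Qed.

Lemma RCcont_snd (h : R -> C) (t : R) : RCcont h t -> continuous (fun s => snd (h s)) t.
Proof.
  intros H. apply (continuous_comp (V := C_UniformSpace) h (@snd R R)); [exact H|].
  apply continuous_snd.
Qed.

Lemma RCcont_mult (h k : R -> C) (t : R) :
  RCcont h t -> RCcont k t -> RCcont (fun s => h s * k s) t.
Proof.
  intros Hh Hk.
  pose proof (RCcont_fst _ _ Hh). pose proof (RCcont_snd _ _ Hh).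
  pose proof (RCcont_fst _ _ Hk). pose proof (RCcont_snd _ _ Hk).
  unfold Cmult. apply RCcont_pair.
  - apply (continuous_minus (V := R_NormedModule));
      apply (continuous_mult (K := R_AbsRing)); assumption.
  - apply (continuous_plus (V := R_NormedModule));
      apply (continuous_mult (K := R_AbsRing)); assumption.
Qed.

Lemma RCcont_comp (F : C -> C) (h : R -> C) (t : R) :
  RCcont h t -> Ccont F (h t) -> RCcont (fun s => F (h s)) t.
Proof.
  intros Hh HF. apply (continuous_comp (V := C_UniformSpace) h F); [exact Hh|].
  apply Ccont_iff_continuous. exact HF.
Qed.

Lemma RCcont_Cmod (h : R -> C) (t : R) : RCcont h t -> continuous (fun s => Cmod (h s)) t.
Proof.
  intros H. apply continuous_ext with (fun s => norm (V := C_R_NormedModule) (h s)).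
  - intros s. symmetry. apply Cmod_norm.
  - apply (continuous_comp (V := C_UniformSpace) h (norm (V := C_R_NormedModule))); [exact H|].
    apply (filterlim_norm (V := C_R_NormedModule)).
Qed.

Lemma RCcont_eps (h : R -> C) (t : R) :
  RCcont h t -> forall e, 0 < e -> exists d, 0 < d /\
    forall s, Rabs (s - t) < d -> Cmod (h s - h t) < e.
Proof.
  intros H e He.
  assert (HP : locally (T := C_UniformSpace) (h t) (fun y => Cmod (y - h t) < e)).
  { apply C_UniformSpace_locally_Cmod. exists e. auto. }
  apply H in HP. destruct HP as [d Hd]. exists d. split; [apply cond_pos|].
  intros s Hs. apply Hd. exact Hs.
Qed.

Lemma RCderive_eps (h : R -> C) (t : R) (l : C) :
  RCderive h t l <->
  forall e, 0 < e -> exists d, 0 < d /\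
    forall s : R, Rabs (s - t) < d -> Cmod (h s - h t - RtoC (s - t) * l) <= e * Rabs (s - t).
Proof.
  assert (E : forall s : R, norm (V := C_R_NormedModule)
     (minus (minus (h s) (h t)) (scal (minus s t) l)) = Cmod (h s - h t - RtoC (s - t) * l)).
  { intros s. rewrite Cmod_norm. f_equal.
    unfold Cminus, Cplus, Copp, Cmult, RtoC, minus, plus, opp, scal; simpl.
    unfold prod_plus, prod_scal, plus, opp, scal; simpl. unfold mult; simpl.
    destruct (h s), (h t), l. apply injective_projections; simpl; ring. }
  split.
  - intros [_ H] e He. destruct (H t (fun P HP => HP) (mkposreal e He)) as [d Hd].
    exists d. split; [apply cond_pos|]. intros s Hs. specialize (Hd s Hs).
    rewrite <- E. exact Hd.
  - intros H. split; [apply is_linear_scal_l|].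
    intros x Hx.
    assert (Ex : t = x) by exact (is_filter_lim_locally_unique (V := R_NormedModule) t x Hx). subst x.
    intros e. destruct (H e (cond_pos e)) as [d [Hd H1]].
    exists (mkposreal d Hd). intros s Hs.
    eapply Rle_trans; [right; exact (E s)|]. apply H1. exact Hs.
Qed.

Lemma RCderive_RCcont (h : R -> C) (t : R) (l : C) : RCderive h t l -> RCcont h t.
Proof.
  intros H. apply (ex_derive_continuous (K := R_AbsRing) (V := C_R_NormedModule)).
  exists l. exact H.
Qed.

Lemma RCderive_comp (P : C -> C) (h : R -> C) (t : R) (l m : C) :
  RCderive h t l -> Cder P (h t) m -> RCderive (fun s => P (h s)) t (m * l).
Proof.
  intros Hh HP. pose proof (RCcont_eps _ _ (RCderive_RCcont _ _ _ Hh)) as Hc.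
  rewrite RCderive_eps in Hh |- *. intros e He.
  pose (A := (Cmod l + 1)%R).
  assert (HA : 1 <= A) by (unfold A; pose proof (Cmod_ge_0 l); lra).
  assert (He1 : 0 < e / (2 * A)) by (apply Rdiv_lt_0_compat; lra).
  destruct (HP _ He1) as [d1 [Hd1 H1]].
  pose (B := (Cmod m + 1)%R).
  assert (HB : 1 <= B) by (unfold B; pose proof (Cmod_ge_0 m); lra).
  assert (He2 : 0 < Rmin 1 (e / (2 * B))).
  { apply Rmin_glb_lt; [lra|]. apply Rdiv_lt_0_compat; lra. }
  destruct (Hh _ He2) as [d2 [Hd2 H2]].
  destruct (Hc d1 Hd1) as [d3 [Hd3 H3]].
  exists (Rmin d2 d3). split; [apply Rmin_glb_lt; assumption|]. intros s Hy.
  specialize (H2 s ltac:(apply (Rmin_Rgt_l _ _ _ Hy))).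
  specialize (H3 s ltac:(apply (Rmin_Rgt_l _ _ _ Hy))).
  specialize (H1 _ H3).
  replace (P (h s) - P (h t) - RtoC (s - t) * (m * l)) with
    ((P (h s) - P (h t) - m * (h s - h t)) + m * (h s - h t - RtoC (s - t) * l)) by ring.
  eapply Rle_trans. apply Cmod_triangle. rewrite Cmod_mult.
  pose proof (Rabs_pos (s - t)) as H0. pose proof (Cmod_ge_0 m) as Hm0.
  assert (E1 : Cmod (h s - h t) <= A * Rabs (s - t)).
  { pose proof (Cmod_le_add (h s - h t) (RtoC (s - t) * l)) as H4.
    rewrite Cmod_mult, Cmod_R in H4.
    assert (Rmin 1 (e / (2 * B)) * Rabs (s - t) <= 1 * Rabs (s - t))
      by (apply Rmult_le_compat_r; [exact H0|apply Rmin_l]).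
    unfold A. lra. }
  assert (E2 : e / (2 * A) * Cmod (h s - h t) <= e / 2 * Rabs (s - t)).
  { apply Rle_trans with (e / (2 * A) * (A * Rabs (s - t)))%R.
    apply Rmult_le_compat_l; lra. right. field. lra. }
  assert (E3 : Cmod m * Cmod (h s - h t - RtoC (s - t) * l) <= e / 2 * Rabs (s - t)).
  { apply Rle_trans with (B * (e / (2 * B) * Rabs (s - t)))%R.
    - apply Rmult_le_compat; [exact Hm0|apply Cmod_ge_0|unfold B; lra|].
      eapply Rle_trans; [exact H2|]. apply Rmult_le_compat_r; [exact H0|apply Rmin_r].
    - right. field. lra. }
  lra.
Qed.

Lemma RCderive_path_derive (h : R -> C) (t : R) (l : C) : RCderive h t l -> path_derive h t = l.
Proof.
  intros H. unfold path_derive, Re, Im. destruct l as [l1 l2]. f_equal.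
  - apply is_derive_unique.
    apply (filterdiff_comp (K := R_AbsRing) (V := C_R_NormedModule) h (@fst R R) _ (@fst R R)) in H.
    + exact H.
    + apply filterdiff_linear. apply is_linear_fst.
  - apply is_derive_unique.
    apply (filterdiff_comp (K := R_AbsRing) (V := C_R_NormedModule) h (@snd R R) _ (@snd R R)) in H.
    + exact H.
    + apply filterdiff_linear. apply is_linear_snd.
Qed.

Lemma is_CRInt_Cmult (c : C) (f : R -> C) (a b : R) (l : C) :
  is_CRInt f a b l -> is_CRInt (fun t => c * f t) a b (c * l).
Proof.
  intros H.
  pose proof (is_RInt_fct_extend_fst (U := R_NormedModule) (V := R_NormedModule) _ _ _ _ H) as H1.
  pose proof (is_RInt_fct_extend_snd (U := R_NormedModule) (V := R_NormedModule) _ _ _ _ H) as H2.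
  apply (is_RInt_fct_extend_pair (U := R_NormedModule) (V := R_NormedModule)); simpl.
  - apply (is_RInt_minus (V := R_NormedModule)); apply (is_RInt_scal (V := R_NormedModule)); assumption.
  - apply (is_RInt_plus (V := R_NormedModule)); apply (is_RInt_scal (V := R_NormedModule)); assumption.
Qed.

Lemma CRInt_correct (f : R -> C) (a b : R) : ex_CRInt f a b -> is_CRInt f a b (CRInt f a b).
Proof. apply (RInt_correct (V := C_R_CompleteNormedModule)). Qed.

Lemma CRInt_unique (f : R -> C) (a b : R) (l : C) : is_CRInt f a b l -> CRInt f a b = l.
Proof. apply (is_RInt_unique (V := C_R_CompleteNormedModule)). Qed.

Lemma CRInt_lin (a b : C) (f g : R -> C) (u v : R) :
  ex_CRInt f u v -> ex_CRInt g u v ->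
  CRInt (fun t => a * f t + b * g t) u v = a * CRInt f u v + b * CRInt g u v.
Proof.
  intros Hf Hg. apply CRInt_unique.
  apply (is_RInt_plus (V := C_R_NormedModule)); apply is_CRInt_Cmult; apply CRInt_correct; assumption.
Qed.

Lemma CRInt_Chasles (f : R -> C) (a b c : R) :
  ex_CRInt f a b -> ex_CRInt f b c -> CRInt f a c = CRInt f a b + CRInt f b c.
Proof. intros H1 H2. symmetry. apply (RInt_Chasles (V := C_R_CompleteNormedModule)); assumption. Qed.

Lemma ex_CRInt_cont (f : R -> C) (a b : R) :
  a <= b -> (forall t, a <= t <= b -> RCcont f t) -> ex_CRInt f a b.
Proof.
  intros Hab H. apply (ex_RInt_continuous (V := C_R_CompleteNormedModule)).
  rewrite Rmin_left, Rmax_right by exact Hab. exact H.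
Qed.

Lemma CRInt_bound (f : R -> C) (a b M : R) :
  a <= b -> ex_CRInt f a b -> (forall t, a <= t <= b -> Cmod (f t) <= M) ->
  Cmod (CRInt f a b) <= (b - a) * M.
Proof.
  intros Hab Hf HM. rewrite Cmod_norm.
  apply (norm_RInt_le_const (V := C_R_NormedModule) f a b); [exact Hab| |apply CRInt_correct; exact Hf].
  intros t Ht. rewrite <- Cmod_norm. auto.
Qed.

Lemma RCcont_bounded (h : R -> C) (u v : R) : u <= v -> (forall t, u <= t <= v -> RCcont h t) ->
  exists m, 0 <= m /\ forall t, u <= t <= v -> Cmod (h t) <= m.
Proof.
  intros Huv Hc.
  destruct (continuity_ab_maj (fun t => Cmod (h t)) u v Huv) as [t0 [H0 _]].
  - intros t Ht. apply continuity_pt_filterlim. apply (RCcont_Cmod h). auto.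
  - exists (Cmod (h t0)). split; [apply Cmod_ge_0|]. exact H0.
Qed.

(** [T] is a compact trace, [L] a path integral along it, [len] a bound for its
    length, and [D P] the sum of the increments of [P] between end points. *)
Record path_functional (T : C -> Prop) (L : (C -> C) -> C) (len : R) (D : (C -> C) -> C) : Prop := {
  pf_len : 0 <= len;
  pf_lin : forall a b F G, (forall y, T y -> Ccont F y) -> (forall y, T y -> Ccont G y) ->
    L (fun y => a * F y + b * G y) = a * L F + b * L G;
  pf_bound : forall F M, 0 <= M -> (forall y, T y -> Ccont F y) ->
    (forall y, T y -> Cmod (F y) <= M) -> Cmod (L F) <= len * M;
  pf_compact : forall F, (forall y, T y -> Ccont F y) ->
    exists M, 0 <= M /\ forall y, T y -> Cmod (F y) <= M;
  pf_exact : forall P F, (forall y, T y -> Ccont F y) -> (forall y, T y -> Cder P y (F y)) -> L F = D P }.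

Arguments pf_len {T L len D}.
Arguments pf_lin {T L len D}.
Arguments pf_bound {T L len D}.
Arguments pf_compact {T L len D}.
Arguments pf_exact {T L len D}.

Lemma path_functional_arc (h dh : R -> C) (u v m : R) :
  u <= v -> (forall t, u <= t <= v -> RCderive h t (dh t)) ->
  (forall t, u <= t <= v -> RCcont dh t) -> (forall t, u <= t <= v -> Cmod (dh t) <= m) ->
  path_functional (fun y => exists t, u <= t <= v /\ h t = y)
    (fun F => CRInt (fun t => F (h t) * dh t) u v) ((v - u) * m)
    (fun P => P (h v) - P (h u)).
Proof.
  intros Huv Hd Hc Hm.
  assert (Hm0 : 0 <= m).
  { eapply Rle_trans; [apply Cmod_ge_0|apply (Hm u); lra]. }
  assert (Hcont : forall F, (forall y, (exists t, u <= t <= v /\ h t = y) -> Ccont F y) ->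
    forall t, u <= t <= v -> RCcont (fun s => F (h s)) t).
  { intros F HF t Ht. apply RCcont_comp.
    - eapply RCderive_RCcont. apply Hd. exact Ht.
    - apply HF. exists t. auto. }
  assert (Hcont' : forall F, (forall y, (exists t, u <= t <= v /\ h t = y) -> Ccont F y) ->
    forall t, u <= t <= v -> RCcont (fun s => F (h s) * dh s) t).
  { intros F HF t Ht. apply RCcont_mult; auto. }
  constructor.
  - apply Rmult_le_pos; lra.
  - intros a b F G HF HG. rewrite <- CRInt_lin.
    + f_equal. apply functional_extensionality. intros t. ring.
    + apply ex_CRInt_cont; auto.
    + apply ex_CRInt_cont; auto.
  - intros F M HM HF H. rewrite Rmult_assoc. apply CRInt_bound; [exact Huv|apply ex_CRInt_cont; auto|].
    intros t Ht. rewrite Cmod_mult, Rmult_comm.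
    apply Rmult_le_compat; auto using Cmod_ge_0. apply H. exists t. auto.
  - intros F HF.
    destruct (RCcont_bounded (fun t => F (h t)) u v Huv (Hcont F HF)) as [M [HM H]].
    exists M. split; [exact HM|]. intros y [t [Ht <-]]. auto.
  - intros P F HF HP. apply CRInt_unique.
    apply (is_RInt_derive (V := C_R_CompleteNormedModule) (fun t => P (h t)) (fun t => F (h t) * dh t)).
    + rewrite Rmin_left, Rmax_right by exact Huv. intros t Ht.
      apply RCderive_comp; [auto|]. apply HP. exists t. auto.
    + rewrite Rmin_left, Rmax_right by exact Huv. auto.
Qed.

Lemma path_functional_zero :
  path_functional (fun _ => False) (fun _ => 0) 0 (fun _ => 0).
Proof.
  constructor; intros.
  - lra.
  - ring.
  - rewrite Cmod_0. lra.
  - exists 0%R. split; [lra|tauto].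
  - reflexivity.
Qed.

Lemma path_functional_lincomb (c1 c2 : C) T1 L1 len1 D1 T2 L2 len2 D2 :
  path_functional T1 L1 len1 D1 -> path_functional T2 L2 len2 D2 ->
  path_functional (fun y => T1 y \/ T2 y) (fun F => c1 * L1 F + c2 * L2 F)
    (Cmod c1 * len1 + Cmod c2 * len2) (fun P => c1 * D1 P + c2 * D2 P).
Proof.
  intros H1 H2. pose proof (pf_len H1). pose proof (pf_len H2).
  pose proof (Cmod_ge_0 c1). pose proof (Cmod_ge_0 c2).
  constructor.
  - apply Rplus_le_le_0_compat; apply Rmult_le_pos; assumption.
  - intros a b F G HF HG. rewrite (pf_lin H1), (pf_lin H2) by auto. ring.
  - intros F M HM HF HB. eapply Rle_trans. apply Cmod_triangle. rewrite !Cmod_mult.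
    rewrite Rmult_plus_distr_r, !Rmult_assoc. apply Rplus_le_compat.
    + apply Rmult_le_compat_l; [assumption|]. apply (pf_bound H1); auto.
    + apply Rmult_le_compat_l; [assumption|]. apply (pf_bound H2); auto.
  - intros F HF. destruct (pf_compact H1 F) as [M1 [P1 B1]]; [auto|].
    destruct (pf_compact H2 F) as [M2 [P2 B2]]; [auto|].
    exists (M1 + M2)%R. split; [lra|]. intros y [Hy|Hy]; [specialize (B1 y Hy)|specialize (B2 y Hy)]; lra.
  - intros P F HF HP. rewrite (pf_exact H1 P), (pf_exact H2 P) by auto. reflexivity.
Qed.

Lemma path_functional_ext T L len D T' L' len' D' :
  path_functional T L len D -> (forall y, T y <-> T' y) ->
  (forall F, (forall y, T y -> Ccont F y) -> L F = L' F) -> len = len' -> (forall P, D P = D' P) ->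
  path_functional T' L' len' D'.
Proof.
  intros H HT HL Hlen HD.
  assert (HC : forall F, (forall y, T' y -> Ccont F y) -> (forall y, T y -> Ccont F y)).
  { intros F HF y Hy. apply HF, HT, Hy. }
  subst len'. constructor.
  - apply (pf_len H).
  - intros a b F G HF HG. rewrite <- (HL F), <- (HL G), <- (HL (fun y => a * F y + b * G y)); auto.
    + apply (pf_lin H); auto.
    + intros y Hy. apply Ccont_plus; apply Ccont_mult; try apply Ccont_const.
      * exact (HC F HF y Hy).
      * exact (HC G HG y Hy).
  - intros F M HM HF HB. rewrite <- HL by auto. apply (pf_bound H); auto.
    intros y Hy. apply HB, HT, Hy.
  - intros F HF. destruct (pf_compact H F) as [M [HM HB]]; [auto|].
    exists M. split; [exact HM|]. intros y Hy. apply HB, HT, Hy.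
  - intros P F HF HP. rewrite <- HL, <- HD by auto. apply (pf_exact H); [auto|].
    intros y Hy. apply HP, HT, Hy.
Qed.

(** * Goursat's theorem on rectangles *)

Definition in_rect (a b c d : R) (y : C) : Prop := a <= Re y <= b /\ c <= Im y <= d.

Definition horizontal_integral (F : C -> C) (a b c : R) : C := CRInt (fun t => F (t, c)) a b.
Definition vertical_integral (F : C -> C) (a c d : R) : C := CRInt (fun t => F (a, t)) c d.

Definition rect_integral (F : C -> C) (a b c d : R) : C :=
  horizontal_integral F a b c + Ci * vertical_integral F b c d - horizontal_integral F a b d - Ci * vertical_integral F a c d.

Lemma RCderive_horizontal (c t : R) : RCderive (fun s : R => (s, c)) t (RtoC 1).
Proof.
  apply RCderive_eps. intros e He. exists 1%R. split; [lra|]. intros s _. cbv beta.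
  replace ((s, c) - (t, c) - RtoC (s - t) * 1) with (RtoC 0).
  - rewrite Cmod_0. apply Rmult_le_pos; [lra|apply Rabs_pos].
  - apply injective_projections; simpl; ring.
Qed.

Lemma RCderive_vertical (a t : R) : RCderive (fun s : R => (a, s)) t Ci.
Proof.
  apply RCderive_eps. intros e He. exists 1%R. split; [lra|]. intros s _. cbv beta.
  replace ((a, s) - (a, t) - RtoC (s - t) * Ci) with (RtoC 0).
  - rewrite Cmod_0. apply Rmult_le_pos; [lra|apply Rabs_pos].
  - apply injective_projections; simpl; ring.
Qed.

Lemma RCcont_const (c : C) (t : R) : RCcont (fun _ => c) t.
Proof. exact (continuous_const (U := R_UniformSpace) (V := C_UniformSpace) c t). Qed.

Lemma path_functional_horizontal (a b c : R) : a <= b ->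
  path_functional (fun y => exists t, a <= t <= b /\ (t, c) = y) (fun F => horizontal_integral F a b c) (b - a)
    (fun P => P (b, c) - P (a, c)).
Proof.
  intros Hab.
  eapply path_functional_ext.
  - apply (path_functional_arc (fun t => (t, c)) (fun _ => RtoC 1) a b 1); [exact Hab|..].
    + intros; apply RCderive_horizontal.
    + intros; apply RCcont_const.
    + intros. rewrite Cmod_1. lra.
  - intros; reflexivity.
  - intros F _. unfold horizontal_integral. f_equal. apply functional_extensionality. intros t. ring.
  - ring.
  - reflexivity.
Qed.

Lemma path_functional_vertical (a c d : R) : c <= d ->
  path_functional (fun y => exists t, c <= t <= d /\ (a, t) = y) (fun F => Ci * vertical_integral F a c d) (d - c)
    (fun P => P (a, d) - P (a, c)).
Proof.
  intros Hcd.
  eapply path_functional_ext.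
  - apply (path_functional_arc (fun t => (a, t)) (fun _ => Ci) c d 1); [exact Hcd|..].
    + intros; apply RCderive_vertical.
    + intros; apply RCcont_const.
    + intros. rewrite Cmod_Ci. lra.
  - intros; reflexivity.
  - intros F HF. simpl. unfold vertical_integral. apply CRInt_unique.
    replace (fun t : R => F (a, t) * Ci) with (fun t : R => Ci * F (a, t))
      by (apply functional_extensionality; intros; ring).
    apply is_CRInt_Cmult, CRInt_correct, ex_CRInt_cont; [exact Hcd|].
    intros t Ht. apply RCcont_comp; [eapply RCderive_RCcont, RCderive_vertical|].
    apply HF. exists t. auto.
  - ring.
  - reflexivity.
Qed.

Lemma path_functional_rect (a b c d : R) : a <= b -> c <= d ->
  exists T, (forall y, T y -> in_rect a b c d y) /\
  path_functional T (fun F => rect_integral F a b c d) (2 * (b - a) + 2 * (d - c)) (fun _ => 0).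
Proof.
  intros Hab Hcd. eexists. split; cycle 1.
  - eapply path_functional_ext.
    + exact (path_functional_lincomb 1 1 _ _ _ _ _ _ _ _
        (path_functional_lincomb 1 1 _ _ _ _ _ _ _ _
          (path_functional_horizontal a b c Hab) (path_functional_vertical b c d Hcd))
        (path_functional_lincomb (-(1)) (-(1)) _ _ _ _ _ _ _ _
          (path_functional_horizontal a b d Hab) (path_functional_vertical a c d Hcd))).
    + intros y. reflexivity.
    + intros F _. simpl. unfold rect_integral. ring.
    + rewrite !Cmod_m1, !Cmod_1. ring.
    + intros P. simpl. ring.
  - unfold in_rect. simpl.
    intros y [[[t [Ht E]]|[t [Ht E]]]|[[t [Ht E]]|[t [Ht E]]]]; subst y; simpl; lra.
Qed.

Definition Ccont_rect (F : C -> C) (a b c d : R) : Prop := forall y, in_rect a b c d y -> Ccont F y.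

Lemma ex_horizontal_integral F a b c d e : Ccont_rect F a b c d -> c <= e <= d ->
  forall u v, a <= u -> u <= v -> v <= b -> ex_CRInt (fun t => F (t, e)) u v.
Proof.
  intros H He u v H1 H2 H3. apply ex_CRInt_cont; [exact H2|]. intros t Ht.
  apply RCcont_comp; [eapply RCderive_RCcont, RCderive_horizontal|]. apply H. split; simpl; lra.
Qed.

Lemma ex_vertical_integral F a b c d e : Ccont_rect F a b c d -> a <= e <= b ->
  forall u v, c <= u -> u <= v -> v <= d -> ex_CRInt (fun t => F (e, t)) u v.
Proof.
  intros H He u v H1 H2 H3. apply ex_CRInt_cont; [exact H2|]. intros t Ht.
  apply RCcont_comp; [eapply RCderive_RCcont, RCderive_vertical|]. apply H. split; simpl; lra.
Qed.

Lemma rect_integral_split_h F a m b c d : Ccont_rect F a b c d -> a <= m <= b -> c <= d ->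
  rect_integral F a b c d = rect_integral F a m c d + rect_integral F m b c d.
Proof.
  intros H Hm Hcd. unfold rect_integral, horizontal_integral.
  rewrite (CRInt_Chasles (fun t => F (t, c)) a m b), (CRInt_Chasles (fun t => F (t, d)) a m b).
  - ring.
  - apply (ex_horizontal_integral F a b c d); auto; lra.
  - apply (ex_horizontal_integral F a b c d); auto; lra.
  - apply (ex_horizontal_integral F a b c d); auto; lra.
  - apply (ex_horizontal_integral F a b c d); auto; lra.
Qed.

Lemma rect_integral_split_v F a b c m d : Ccont_rect F a b c d -> c <= m <= d -> a <= b ->
  rect_integral F a b c d = rect_integral F a b c m + rect_integral F a b m d.
Proof.
  intros H Hm Hcd. unfold rect_integral, vertical_integral.
  rewrite (CRInt_Chasles (fun t => F (a, t)) c m d), (CRInt_Chasles (fun t => F (b, t)) c m d).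
  - ring.
  - apply (ex_vertical_integral F a b c d); auto; lra.
  - apply (ex_vertical_integral F a b c d); auto; lra.
  - apply (ex_vertical_integral F a b c d); auto; lra.
  - apply (ex_vertical_integral F a b c d); auto; lra.
Qed.

Lemma rect_integral_degenerate_h F a c d : rect_integral F a a c d = 0.
Proof.
  unfold rect_integral, horizontal_integral. rewrite !(RInt_point (V := C_R_CompleteNormedModule)).
  change (@zero C_R_CompleteNormedModule) with (RtoC 0). ring.
Qed.

Lemma rect_integral_degenerate_v F a b c : rect_integral F a b c c = 0.
Proof.
  unfold rect_integral, vertical_integral. rewrite !(RInt_point (V := C_R_CompleteNormedModule)).
  change (@zero C_R_CompleteNormedModule) with (RtoC 0). ring.
Qed.

Lemma nested_intervals (x w : nat -> R) :
  (forall n, 0 <= w n) -> (forall n, x n <= x (S n)) ->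
  (forall n, x (S n) + w (S n) <= x n + w n) -> exists u, forall n, x n <= u <= x n + w n.
Proof.
  intros Hw Hx Hr.
  assert (Mx : forall n k, x n <= x (n + k)%nat).
  { intros n k. induction k; [rewrite Nat.add_0_r; lra|].
    rewrite Nat.add_succ_r. specialize (Hx (n + k)%nat). lra. }
  assert (Mr : forall n k, x (n + k)%nat + w (n + k)%nat <= x n + w n).
  { intros n k. induction k; [rewrite Nat.add_0_r; lra|].
    rewrite Nat.add_succ_r. specialize (Hr (n + k)%nat). lra. }
  assert (Hub : forall m, is_upper_bound (fun r => exists n, r = x n) (x m + w m)).
  { intros m r [n En]. subst r. destruct (Nat.le_ge_cases n m) as [H|H].
    - specialize (Mx n (m - n)%nat). replace (n + (m - n))%nat with m in Mx by lia.
      specialize (Hw m). lra.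
    - specialize (Mr m (n - m)%nat). replace (m + (n - m))%nat with n in Mr by lia.
      specialize (Hw n). lra. }
  destruct (completeness (fun r => exists n, r = x n)) as [u [Hu1 Hu2]].
  - exists (x 0%nat + w 0%nat)%R. apply Hub.
  - exists (x 0%nat). exists 0%nat. reflexivity.
  - exists u. intros n. split; [apply Hu1; exists n; reflexivity|apply Hu2, Hub].
Qed.

Lemma quadrisection (A B x0 y0 : R) (Q : nat -> R -> R -> Prop) : 0 <= A -> 0 <= B ->
  let ins n x y := x0 <= x /\ x + A / 2 ^ n <= x0 + A /\ y0 <= y /\ y + B / 2 ^ n <= y0 + B in
  (forall n x y, ins n x y ->
     Q (S n) x y -> Q (S n) (x + A / 2 ^ S n)%R y ->
     Q (S n) x (y + B / 2 ^ S n)%R -> Q (S n) (x + A / 2 ^ S n)%R (y + B / 2 ^ S n)%R -> Q n x y) ->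
  (forall u v, x0 <= u <= x0 + A -> y0 <= v <= y0 + B -> exists e, 0 < e /\
     forall n x y, ins n x y -> x <= u <= x + A / 2 ^ n -> y <= v <= y + B / 2 ^ n ->
       A / 2 ^ n + B / 2 ^ n < e -> Q n x y) ->
  Q 0%nat x0 y0.
Proof.
  intros HA HB ins Hsplit Hloc. apply NNPP. intros HQ.
  assert (half : forall X n, (X / 2 ^ n = 2 * (X / 2 ^ S n))%R).
  { intros X n. simpl. field. apply pow_nonzero. lra. }
  assert (pos : forall X n, 0 <= X -> 0 <= X / 2 ^ n).
  { intros X n HX. apply Rmult_le_pos; [exact HX|]. left. apply Rinv_0_lt_compat, pow_lt. lra. }
  assert (step : forall n (p : R * R), exists q : R * R,
    ins n (fst p) (snd p) -> ~ Q n (fst p) (snd p) ->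
    ins (S n) (fst q) (snd q) /\ ~ Q (S n) (fst q) (snd q) /\
    fst p <= fst q /\ fst q + A / 2 ^ S n <= fst p + A / 2 ^ n /\
    snd p <= snd q /\ snd q + B / 2 ^ S n <= snd p + B / 2 ^ n).
  { intros n [x y]; simpl fst; simpl snd.
    destruct (classic (ins n x y /\ ~ Q n x y)) as [[Hi Hn]|Hn]; [|exists (x, y); tauto].
    assert (Hex : exists q : R * R, (fst q = x \/ fst q = x + A / 2 ^ S n)%R /\
       (snd q = y \/ snd q = y + B / 2 ^ S n)%R /\ ~ Q (S n) (fst q) (snd q)).
    { apply NNPP. intros Hno. apply Hn. apply Hsplit; [exact Hi|..]; apply NNPP; intros Hq; apply Hno.
      - exists (x, y). simpl. auto.
      - exists (x + A / 2 ^ S n, y)%R. simpl. auto.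
      - exists (x, y + B / 2 ^ S n)%R. simpl. auto.
      - exists (x + A / 2 ^ S n, y + B / 2 ^ S n)%R. simpl. auto. }
    destruct Hex as [q [H1 [H2 H3]]]. exists q. intros _ _.
    pose proof (half A n). pose proof (half B n).
    pose proof (pos A (S n) HA). pose proof (pos B (S n) HB).
    unfold ins in Hi |- *. destruct H1 as [H1|H1], H2 as [H2|H2]; rewrite H1, H2 in H3 |- *;
      (split; [|split; [exact H3|]]); lra. }
  pose (next := fun n p => proj1_sig (constructive_indefinite_description _ (step n p))).
  pose (s := fix s n := match n with O => (x0, y0) | S m => next m (s m) end).
  assert (inv : forall n, ins n (fst (s n)) (snd (s n)) /\ ~ Q n (fst (s n)) (snd (s n))).
  { induction n as [|n [IH1 IH2]].
    - simpl. split; [|exact HQ]. unfold ins. simpl. lra.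
    - simpl. unfold next. destruct (constructive_indefinite_description _ _) as [q Hq]. simpl.
      destruct (Hq IH1 IH2) as [H1 [H2 _]]. split; assumption. }
  assert (nest : forall n, fst (s n) <= fst (s (S n)) /\
    fst (s (S n)) + A / 2 ^ S n <= fst (s n) + A / 2 ^ n /\
    snd (s n) <= snd (s (S n)) /\ snd (s (S n)) + B / 2 ^ S n <= snd (s n) + B / 2 ^ n).
  { intros n. destruct (inv n) as [IH1 IH2].
    change (s (S n)) with (next n (s n)). unfold next.
    destruct (constructive_indefinite_description _ _) as [q Hq]. simpl proj1_sig.
    destruct (Hq IH1 IH2) as [_ [_ H]]. exact H. }
  destruct (nested_intervals (fun n => fst (s n)) (fun n => A / 2 ^ n)%R) as [u Hu];
    [intros; apply pos; exact HA|intros; apply nest|intros; apply nest|].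
  destruct (nested_intervals (fun n => snd (s n)) (fun n => B / 2 ^ n)%R) as [v Hv];
    [intros; apply pos; exact HB|intros; apply nest|intros; apply nest|].
  destruct (Hloc u v) as [e [He H]].
  { specialize (Hu 0%nat). simpl in Hu. lra. }
  { specialize (Hv 0%nat). simpl in Hv. lra. }
  assert (Hn : exists n, A / 2 ^ n + B / 2 ^ n < e).
  { destruct (Pow_x_infinity 2 ltac:(rewrite Rabs_right; lra) ((A + B) / e + 1)%R) as [N HN].
    exists N. specialize (HN N (le_n N)).
    assert (P : 0 < 2 ^ N) by (apply pow_lt; lra).
    rewrite Rabs_right in HN by lra.
    replace (A / 2 ^ N + B / 2 ^ N)%R with ((A + B) / 2 ^ N)%R by (field; lra).
    apply Rmult_lt_reg_r with (2 ^ N)%R; [exact P|].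
    unfold Rdiv at 1. rewrite Rmult_assoc, Rinv_l, Rmult_1_r by lra.
    apply Rlt_le_trans with (e * ((A + B) / e + 1))%R.
    - replace (e * ((A + B) / e + 1))%R with (A + B + e)%R by (field; lra). lra.
    - apply Rmult_le_compat_l; lra. }
  destruct Hn as [n Hn]. destruct (inv n) as [I1 I2]. apply I2.
  apply H; auto.
Qed.

Lemma Ccont_rect_sub F a b c d a' b' c' d' : Ccont_rect F a b c d ->
  a <= a' -> b' <= b -> c <= c' -> d' <= d -> Ccont_rect F a' b' c' d'.
Proof. intros H H1 H2 H3 H4 y [Hy1 Hy2]. apply H. split; lra. Qed.

Lemma Re_minus (x y : C) : Re (x - y) = (Re x - Re y)%R.
Proof. destruct x, y. simpl. ring. Qed.

Lemma Im_minus (x y : C) : Im (x - y) = (Im x - Im y)%R.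
Proof. destruct x, y. simpl. ring. Qed.

Lemma goursat_rect (F : C -> C) (a b c d : R) : a <= b -> c <= d ->
  (forall y, in_rect a b c d y -> Cdiffable F y) -> rect_integral F a b c d = 0.
Proof.
  intros Hab Hcd HF.
  assert (HC : Ccont_rect F a b c d) by (intros y Hy; apply Cdiffable_Ccont, HF, Hy).
  pose (A := (b - a)%R). pose (B := (d - c)%R).
  assert (HA : 0 <= A) by (unfold A; lra). assert (HB : 0 <= B) by (unfold B; lra).
  assert (pos : forall X n, 0 <= X -> 0 <= X / 2 ^ n).
  { intros X n HX. apply Rmult_le_pos; [exact HX|]. left. apply Rinv_0_lt_compat, pow_lt. lra. }
  assert (Main : forall e, 0 < e -> Cmod (rect_integral F a b c d) <= e).
  { intros e He.
    pose (Q := fun n x y => Cmod (rect_integral F x (x + A / 2 ^ n) y (y + B / 2 ^ n)) <= e / 4 ^ n).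
    assert (Q0 : Q 0%nat a c).
    { apply (quadrisection A B a c Q HA HB).
      - intros n x y Hi. unfold Q.
        set (p := (A / 2 ^ S n)%R). set (q := (B / 2 ^ S n)%R).
        assert (Ep : (A / 2 ^ n = p + p)%R) by (unfold p; simpl; field; apply pow_nonzero; lra).
        assert (Eq : (B / 2 ^ n = q + q)%R) by (unfold q; simpl; field; apply pow_nonzero; lra).
        assert (Hp : 0 <= p) by (apply pos; exact HA).
        assert (Hq : 0 <= q) by (apply pos; exact HB).
        assert (E4 : (e / 4 ^ n = 4 * (e / 4 ^ S n))%R) by (simpl; field; apply pow_nonzero; lra).
        rewrite Ep, Eq in Hi |- *. rewrite E4. unfold A, B in Hi.
        intros H1 H2 H3 H4.
        replace (x + p + p)%R with (x + (p + p))%R in * by ring.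
        replace (y + q + q)%R with (y + (q + q))%R in * by ring.
        rewrite (rect_integral_split_h F x (x + p) (x + (p + p)))
          by (try (eapply Ccont_rect_sub; [exact HC|..]); lra).
        rewrite (rect_integral_split_v F x (x + p) y (y + q) (y + (q + q)))
          by (try (eapply Ccont_rect_sub; [exact HC|..]); lra).
        rewrite (rect_integral_split_v F (x + p) (x + (p + p)) y (y + q) (y + (q + q)))
          by (try (eapply Ccont_rect_sub; [exact HC|..]); lra).
        eapply Rle_trans; [apply Cmod_triangle|].
        pose proof (Cmod_triangle (rect_integral F x (x + p) y (y + q)) (rect_integral F x (x + p) (y + q) (y + (q + q)))).
        pose proof (Cmod_triangle (rect_integral F (x + p) (x + (p + p)) y (y + q)) (rect_integral F (x + p) (x + (p + p)) (y + q) (y + (q + q)))).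
        lra.
      - intros u v Hu Hv.
        destruct (HF (u, v)) as [l Hl]; [unfold A in Hu; unfold B in Hv; split; simpl; lra|].
        pose (K := (2 * (A + B) * (A + B) + 1)%R).
        assert (HK : 0 < K).
        { unfold K. assert (0 <= (A + B) * (A + B)) by (apply Rmult_le_pos; lra). lra. }
        destruct (Hl (e / K)%R (Rdiv_lt_0_compat _ _ He HK)) as [r [Hr H]].
        exists r. split; [exact Hr|]. intros n x y Hi Hx Hy Hn. unfold Q.
        unfold A, B in Hi. fold A in Hi. fold B in Hi.
        set (p := (A / 2 ^ n)%R) in *. set (q := (B / 2 ^ n)%R) in *.
        assert (Hp : 0 <= p) by (apply pos; exact HA).
        assert (Hq : 0 <= q) by (apply pos; exact HB).
        destruct (path_functional_rect x (x + p) y (y + q)) as [T [HT PF]]; [lra|lra|].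
        assert (HTC : forall z, T z -> Ccont F z).
        { intros z Hz. apply (Ccont_rect_sub F a b c d x (x + p) y (y + q) HC); auto;
          unfold A, B in Hi; lra. }
        pose (G := fun z => F (u, v) + l * (z - (u, v))).
        assert (HG : forall z, Cder G z l).
        { intros z. unfold G.
          eapply Cder_eq.
          - apply (Cder_plus (fun _ => F (u, v))); [apply Cder_const|].
            apply Cder_scal, Cder_sub_const.
          - ring. }
        assert (EG : rect_integral G x (x + p) y (y + q) = 0).
        { apply (pf_exact PF (fun z => (F (u, v) * z + l * ((z - (u, v)) * (z - (u, v)) / 2)))).
          - intros z _. eapply Cder_Ccont, HG.
          - intros z _. unfold G.
            eapply Cder_eq.
            + apply (Cder_plus (fun z => F (u,v) * z)); [apply Cder_scal, Cder_id|].
              apply Cder_scal.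
              apply (Cder_mult (fun z => (z - (u,v)) * (z - (u,v))) (fun _ => / 2)); [|apply Cder_const].
              apply Cder_mult; apply Cder_sub_const.
            + cbv beta; field. }
        assert (E : rect_integral F x (x + p) y (y + q) =
          rect_integral (fun z => 1 * F z + - (1) * G z) x (x + p) y (y + q)).
        { rewrite (pf_lin PF 1 (- (1)) F G); auto.
          - rewrite EG. ring.
          - intros z _. eapply Cder_Ccont, HG. }
        rewrite E.
        eapply Rle_trans.
        + apply (pf_bound PF _ (e / K * (p + q))%R).
          * apply Rmult_le_pos; [|lra]. left. apply Rdiv_lt_0_compat; assumption.
          * intros z Hz. apply Ccont_plus; apply Ccont_mult; auto using Ccont_const.
            eapply Cder_Ccont, HG.
          * intros z Hz.
            assert (Hz' : Cmod (z - (u, v)) <= p + q).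
            { eapply Rle_trans; [apply Cmod_le_Re_Im|]. rewrite Re_minus, Im_minus.
              apply HT in Hz. destruct Hz as [Hz1 Hz2]. simpl (Re (u, v)). simpl (Im (u, v)).
              apply Rplus_le_compat; apply Rabs_le; lra. }
            replace (1 * F z + - (1) * G z) with (F z - F (u, v) - l * (z - (u, v))) by (unfold G; ring).
            eapply Rle_trans; [apply H; lra|].
            apply Rmult_le_compat_l; [|exact Hz']. left. apply Rdiv_lt_0_compat; assumption.
        + assert (E4 : (4 ^ n = 2 ^ n * 2 ^ n)%R) by (rewrite <- Rpow_mult_distr; f_equal; ring).
          assert (P2 : 0 < 2 ^ n) by (apply pow_lt; lra).
          apply Rle_trans with (e / 4 ^ n * ((K - 1) / K))%R.
          * right. rewrite E4. unfold K, p, q. field. split; apply Rgt_not_eq; assumption.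
          * rewrite <- (Rmult_1_r (e / 4 ^ n)) at 2. apply Rmult_le_compat_l.
            -- left. apply Rdiv_lt_0_compat; [exact He|apply pow_lt; lra].
            -- apply Rmult_le_reg_r with K; [exact HK|]. unfold Rdiv. rewrite Rmult_assoc, Rinv_l; lra. }
    unfold Q in Q0. simpl in Q0. unfold Rdiv in Q0. rewrite Rinv_1, !Rmult_1_r in Q0.
    unfold A, B in Q0.
    replace (a + (b - a))%R with b in Q0 by ring. replace (c + (d - c))%R with d in Q0 by ring.
    exact Q0. }
  apply Cmod_eps_eq_0. intros e He. apply Main. exact He.
Qed.

(** * Cauchy-type integrals and the index *)

Ltac ccont := repeat first
  [ assumption | apply Ccont_const | apply Ccont_id | apply Ccont_minus | apply Ccont_plus
  | apply Ccont_div | apply Ccont_inv | apply Ccont_mult ].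

Lemma Csub_neq_0 (x y : C) : x <> y -> x - y <> 0.
Proof. intros H E. apply H. apply Ceq_minus. exact E. Qed.

Lemma pf_ext {T L len D F G} : path_functional T L len D ->
  (forall y, T y -> Ccont F y) -> (forall y, T y -> Ccont G y) ->
  (forall y, T y -> F y = G y) -> L F = L G.
Proof.
  intros PF HF HG E. apply Ceq_minus. apply Cmod_eq_0. apply Rle_antisym; [|apply Cmod_ge_0].
  replace (L F - L G) with (1 * L F + - (1) * L G) by ring.
  rewrite <- (pf_lin PF) by assumption.
  eapply Rle_trans; [apply (pf_bound PF _ 0%R)|].
  - lra.
  - intros y Hy. specialize (HF y Hy). specialize (HG y Hy). ccont.
  - intros y Hy. rewrite (E y Hy). replace (1 * G y + - (1) * G y) with (RtoC 0) by ring.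
    rewrite Cmod_0. lra.
  - lra.
Qed.

Lemma pf_scal {T L len D c F} : path_functional T L len D ->
  (forall y, T y -> Ccont F y) -> L (fun y => c * F y) = c * L F.
Proof.
  intros PF HF. replace (c * L F) with (c * L F + 0 * L F) by ring.
  rewrite <- (pf_lin PF) by assumption. f_equal.
  apply functional_extensionality. intros y. ring.
Qed.

Lemma pf_minus {T L len D F G} : path_functional T L len D ->
  (forall y, T y -> Ccont F y) -> (forall y, T y -> Ccont G y) -> L (fun y => F y - G y) = L F - L G.
Proof.
  intros PF HF HG. replace (L F - L G) with (1 * L F + - (1) * L G) by ring.
  rewrite <- (pf_lin PF) by assumption. f_equal.
  apply functional_extensionality. intros y. ring.
Qed.

Lemma pf_dist T L len D w : path_functional T L len D -> ~ T w ->
  exists d, 0 < d /\ forall y, T y -> d <= Cmod (y - w).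
Proof.
  intros PF Hw.
  assert (Hne : forall y, T y -> y - w <> 0).
  { intros y Hy. apply Csub_neq_0. intros E. subst. tauto. }
  destruct (pf_compact PF (fun y => / (y - w))) as [M [HM HB]].
  - intros y Hy. specialize (Hne y Hy). ccont.
  - exists (/ (M + 1))%R. split; [apply Rinv_0_lt_compat; lra|].
    intros y Hy. specialize (HB y Hy). specialize (Hne y Hy). rewrite Cmod_inv in HB by exact Hne.
    apply Cmod_gt_0 in Hne.
    rewrite <- (Rinv_inv (Cmod (y - w))). apply Rinv_le_contravar; [|lra].
    apply Rinv_0_lt_compat. exact Hne.
Qed.

Lemma Cmod_div_le (x y : C) (m d : R) : Cmod x <= m -> 0 < d -> d <= Cmod y -> Cmod (x / y) <= m / d.
Proof.
  intros Hx Hd Hy. rewrite Cmod_div by (apply Cmod_gt_0; lra).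
  unfold Rdiv. apply Rmult_le_compat.
  - apply Cmod_ge_0.
  - left. apply Rinv_0_lt_compat. lra.
  - exact Hx.
  - apply Rinv_le_contravar; assumption.
Qed.

Lemma Cder_cauchy_type T L len D (psi : C -> C) w : path_functional T L len D ->
  (forall y, T y -> Ccont psi y) -> ~ T w ->
  Cder (fun z => L (fun y => psi y / (y - z))) w (L (fun y => psi y / ((y - w) * (y - w)))).
Proof.
  intros PF Hpsi Hw e He.
  destruct (pf_dist _ _ _ _ w PF Hw) as [d [Hd HT]].
  destruct (pf_compact PF psi Hpsi) as [M [HM HB]].
  pose proof (pf_len PF) as Hl.
  pose (K := (len * (M * (2 / (d * d * d))))%R).
  assert (Hd3 : 0 < d * d * d) by (repeat apply Rmult_lt_0_compat; exact Hd).
  assert (H2d : 0 < 2 / (d * d * d)) by (apply Rdiv_lt_0_compat; lra).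
  assert (HK : 0 <= K) by (unfold K; repeat apply Rmult_le_pos; lra).
  exists (Rmin (d / 2) (e / (K + 1))). split.
  { apply Rmin_glb_lt; [lra|]. apply Rdiv_lt_0_compat; lra. }
  intros z Hz.
  assert (Hz1 : Cmod (z - w) < d / 2) by (apply (Rmin_Rgt_l _ _ _ Hz)).
  assert (Hz2 : Cmod (z - w) < e / (K + 1)) by (apply (Rmin_Rgt_l _ _ _ Hz)).
  assert (HTz : forall y, T y -> d / 2 <= Cmod (y - z)).
  { intros y Hy. specialize (HT y Hy). pose proof (Cmod_sub_triangle y z w). lra. }
  assert (Nw : forall y, T y -> y - w <> 0) by (intros y Hy; apply Cmod_gt_0; specialize (HT y Hy); lra).
  assert (Nz : forall y, T y -> y - z <> 0) by (intros y Hy; apply Cmod_gt_0; specialize (HTz y Hy); lra).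
  assert (Cz : forall y, T y -> Ccont (fun y => psi y / (y - z)) y).
  { intros y Hy. specialize (Nz y Hy). specialize (Hpsi y Hy). ccont. }
  assert (Cw : forall y, T y -> Ccont (fun y => psi y / (y - w)) y).
  { intros y Hy. specialize (Nw y Hy). specialize (Hpsi y Hy). ccont. }
  assert (Cww : forall y, T y -> Ccont (fun y => psi y / ((y - w) * (y - w))) y).
  { intros y Hy. specialize (Nw y Hy). specialize (Hpsi y Hy). ccont. apply Cmult_neq_0; assumption. }
  rewrite (Cmult_comm _ (z - w)).
  rewrite <- (pf_scal PF Cww).
  rewrite <- (pf_minus PF Cz Cw).
  rewrite <- (pf_minus PF); cycle 1.
  { intros y Hy. apply Ccont_minus; auto. }
  { intros y Hy. apply Ccont_mult; [apply Ccont_const|auto]. }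
  assert (H0 : 0 <= Cmod (z - w)) by apply Cmod_ge_0.
  eapply Rle_trans.
  - apply (pf_bound PF _ (M * (2 / (d * d * d)) * (Cmod (z - w) * Cmod (z - w)))%R).
    + apply Rmult_le_pos; apply Rmult_le_pos; lra.
    + intros y Hy. apply Ccont_minus; [apply Ccont_minus; auto|]. apply Ccont_mult; [apply Ccont_const|auto].
    + intros y Hy. specialize (Nz y Hy). specialize (Nw y Hy).
      replace (psi y / (y - z) - psi y / (y - w) - (z - w) * (psi y / ((y - w) * (y - w)))) with
        (psi y * ((z - w) * (z - w)) / ((y - z) * ((y - w) * (y - w)))) by (field; auto).
      eapply Rle_trans.
      * apply (Cmod_div_le _ _ (M * (Cmod (z - w) * Cmod (z - w))) (d / 2 * (d * d))).
        -- rewrite !Cmod_mult. apply Rmult_le_compat_r; [apply Rmult_le_pos; exact H0|auto].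
        -- repeat apply Rmult_lt_0_compat; lra.
        -- rewrite !Cmod_mult. specialize (HT y Hy). specialize (HTz y Hy).
           apply Rmult_le_compat; try lra. apply Rmult_le_pos; lra.
           apply Rmult_le_compat; lra.
      * right. field. lra.
  - replace (len * (M * (2 / (d * d * d)) * (Cmod (z - w) * Cmod (z - w))))%R with
      (K * Cmod (z - w) * Cmod (z - w))%R by (unfold K; ring).
    apply Rmult_le_compat_r; [exact H0|].
    apply Rle_trans with (K * (e / (K + 1)))%R; [apply Rmult_le_compat_l; lra|].
    apply Rle_trans with ((K + 1) * (e / (K + 1)))%R; [|right; field; lra].
    apply Rmult_le_compat_r; [|lra]. left. apply Rdiv_lt_0_compat; lra.
Qed.

Definition closed_functional T L len : Prop := path_functional T L len (fun _ => 0).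

Definition index (L : (C -> C) -> C) (w : C) : C := L (fun y => / (y - w)).

Lemma Cder_index T L len w : closed_functional T L len -> ~ T w -> Cder (index L) w 0.
Proof.
  intros PF Hw.
  assert (Nw : forall y, T y -> y - w <> 0).
  { intros y Hy. apply Csub_neq_0. intros E. subst. tauto. }
  eapply Cder_eq.
  - apply (Cder_ext_loc (fun z => L (fun y => 1 / (y - z))) _ w _ 1%R); [lra| |].
    + intros y _. unfold index. f_equal. apply functional_extensionality. intros u.
      unfold Cdiv. apply Cmult_1_l.
    + apply (Cder_cauchy_type T L len _ (fun _ => 1) w PF); [|exact Hw]. intros; apply Ccont_const.
  - apply (pf_exact PF (fun y => - (1) * / (y - w))).
    + intros y Hy. specialize (Nw y Hy). ccont. apply Cmult_neq_0; assumption.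
    + intros y Hy. specialize (Nw y Hy). eapply Cder_eq.
      * apply Cder_scal, Cder_inv_sub. exact Nw.
      * cbv beta. field. exact Nw.
Qed.

Lemma index_segment T L len w w' : closed_functional T L len ->
  (forall t : R, 0 <= t <= 1 -> ~ T (w + RtoC t * (w' - w))) -> index L w = index L w'.
Proof.
  intros PF H.
  assert (Hl : forall t, RCderive (fun s => w + RtoC s * (w' - w)) t (w' - w)).
  { intros t. apply RCderive_eps. intros e He. exists 1%R. split; [lra|]. intros s _.
    replace (w + RtoC s * (w' - w) - (w + RtoC t * (w' - w)) - RtoC (s - t) * (w' - w)) with (RtoC 0)
      by (rewrite RtoC_minus; ring).
    rewrite Cmod_0. apply Rmult_le_pos; [lra|apply Rabs_pos]. }
  pose proof (eq_is_derive (V := C_R_NormedModule) (fun t => index L (w + RtoC t * (w' - w))) 0 1) as E.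
  simpl in E.
  replace (w + 0 * (w' - w)) with w in E by ring.
  replace (w + 1 * (w' - w)) with w' in E by ring.
  apply E; [|lra].
  intros t Ht.
  assert (D := RCderive_comp (index L) (fun s => w + RtoC s * (w' - w)) t (w' - w) 0 (Hl t)
    (Cder_index T L len _ PF (H t Ht))).
  rewrite Cmult_0_l in D. exact D.
Qed.

Lemma index_le T L len w d : closed_functional T L len -> 0 < d ->
  (forall y, T y -> d <= Cmod (y - w)) -> Cmod (index L w) <= len / d.
Proof.
  intros PF Hd H. apply (pf_bound PF).
  - left. apply Rinv_0_lt_compat. exact Hd.
  - intros y Hy. apply Ccont_inv; [ccont|]. apply Cmod_gt_0. specialize (H y Hy). lra.
  - intros y Hy. specialize (H y Hy). rewrite Cmod_inv by (apply Cmod_gt_0; lra).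
    apply Rinv_le_contravar; assumption.
Qed.

Lemma index_ray T L len w (u : C) : closed_functional T L len -> u <> 0 ->
  (forall t, 0 <= t -> ~ T (w + RtoC t * u)) -> index L w = 0.
Proof.
  intros PF Hu H.
  apply Cmod_gt_0 in Hu.
  destruct (pf_compact PF (fun y => y)) as [M [HM HB]]; [intros; apply Ccont_id|].
  pose proof (pf_len PF) as Hl.
  apply Cmod_eps_eq_0. intros e He.
  pose (N := ((len + 1) / e + M + Cmod w)%R).
  assert (Hle : 0 < (len + 1) / e) by (apply Rdiv_lt_0_compat; lra).
  assert (HN : 0 <= N) by (unfold N; pose proof (Cmod_ge_0 w); lra).
  pose (t := (N / Cmod u)%R).
  assert (Ht : 0 <= t) by (apply Rdiv_le_0_compat; [exact HN|exact Hu]).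
  rewrite (index_segment T L len w (w + RtoC t * u) PF).
  - eapply Rle_trans.
    + apply (index_le T L len _ ((len + 1) / e) PF); [exact Hle|].
      intros y Hy. specialize (HB y Hy).
      assert (E1 : Cmod (RtoC t * u) = N).
      { rewrite Cmod_mult, Cmod_R, Rabs_right by lra. unfold t. field. lra. }
      pose proof (Cmod_sub_triangle (w + RtoC t * u) y w) as H1.
      pose proof (Cmod_sub_le y w) as H2.
      replace (w + RtoC t * u - w) with (RtoC t * u) in H1 by ring.
      rewrite (Cmod_sub_sym _ y) in H1.
      unfold N in E1. lra.
    + apply Rle_trans with (len * e / (len + 1))%R; [right; field; lra|].
      apply Rmult_le_reg_r with (len + 1)%R; [lra|]. unfold Rdiv. rewrite Rmult_assoc, Rinv_l by lra. nra.
  - intros s Hs.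
    replace (w + RtoC s * (w + RtoC t * u - w)) with (w + RtoC (s * t) * u) by (rewrite RtoC_mult; ring).
    apply H. apply Rmult_le_pos; lra.
Qed.

(** * Primitives and circles *)

Ltac cring := match goal with |- @eq _ ?a ?b => change (@eq C a b) end; ring.

(** Only a square of side [O(h)] around [p] contributes, hence [O(h)] in total. *)
Lemma goursat_rect_except (F : C -> C) (p : C) (a b c d : R) : a <= b -> c <= d ->
  Ccont_rect F a b c d -> (forall y, in_rect a b c d y -> y <> p -> Cdiffable F y) ->
  rect_integral F a b c d = 0.
Proof.
  intros Hab Hcd HC HF.
  assert (G : forall a' b' c' d', a <= a' -> a' <= b' -> b' <= b -> c <= c' -> c' <= d' -> d' <= d ->
    ~ in_rect a' b' c' d' p -> rect_integral F a' b' c' d' = 0).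
  { intros a' b' c' d' H1 H2 H3 H4 H5 H6 Hp. apply goursat_rect; [lra|lra|].
    intros y Hy. apply HF.
    - destruct Hy. split; lra.
    - intros E. subst. tauto. }
  destruct (classic (in_rect a b c d p)) as [Hp|Hp]; [|apply G; auto; lra].
  apply Cmod_eps_eq_0. intros e He.
  destruct (HC p Hp 1%R Rlt_0_1) as [r [Hr HB]].
  pose (B := (Cmod (F p) + 1)%R).
  assert (HB1 : 1 <= B) by (unfold B; pose proof (Cmod_ge_0 (F p)); lra).
  pose (h := Rmin (r / 5) (e / (8 * B))).
  assert (Hh : 0 < h).
  { apply Rmin_glb_lt; [lra|]. apply Rdiv_lt_0_compat; lra. }
  assert (Hh1 : h <= r / 5) by apply Rmin_l.
  assert (Hh2 : 8 * h * B <= e).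
  { apply Rle_trans with (8 * (e / (8 * B)) * B)%R; [|right; field; lra].
    apply Rmult_le_compat_r; [lra|]. apply Rmult_le_compat_l; [lra|apply Rmin_r]. }
  destruct p as [p1 p2]. destruct Hp as [Hp1 Hp2]. simpl in Hp1, Hp2.
  assert (Sh : forall u v q, u <= q <= v -> exists u' v', u <= u' <= q /\ q <= v' <= v /\
     v' - u' <= 2 * h /\ (u' = u \/ u' < q) /\ (v' = v \/ q < v')).
  { intros u v q Hq.
    exists (Rmax u (q - h)), (Rmin v (q + h)).
    unfold Rmax, Rmin. destruct (Rle_dec u (q - h)), (Rle_dec v (q + h)); repeat split; try lra; auto;
    right; lra. }
  destruct (Sh a b p1 Hp1) as [a' [b' [Ha [Hb [Hw [Ca Cb]]]]]].
  destruct (Sh c d p2 Hp2) as [c' [d' [Hc [Hd [Hk [Cc' Cd]]]]]].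
  rewrite (rect_integral_split_h F a a' b) by (auto; lra).
  rewrite (rect_integral_split_h F a' b' b) by (try (eapply Ccont_rect_sub; [exact HC|..]); lra).
  rewrite (rect_integral_split_v F a' b' c c' d) by (try (eapply Ccont_rect_sub; [exact HC|..]); lra).
  rewrite (rect_integral_split_v F a' b' c' d' d) by (try (eapply Ccont_rect_sub; [exact HC|..]); lra).
  assert (Z1 : rect_integral F a a' c d = 0).
  { destruct Ca as [E|E]; [subst; apply rect_integral_degenerate_h|].
    apply G; try lra. intros [H1 H2]. simpl in H1. lra. }
  assert (Z2 : rect_integral F b' b c d = 0).
  { destruct Cb as [E|E]; [subst; apply rect_integral_degenerate_h|].
    apply G; try lra. intros [H1 H2]. simpl in H1. lra. }
  assert (Z3 : rect_integral F a' b' c c' = 0).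
  { destruct Cc' as [E|E]; [subst; apply rect_integral_degenerate_v|].
    apply G; try lra. intros [H1 H2]. simpl in H2. lra. }
  assert (Z4 : rect_integral F a' b' d' d = 0).
  { destruct Cd as [E|E]; [subst; apply rect_integral_degenerate_v|].
    apply G; try lra. intros [H1 H2]. simpl in H2. lra. }
  rewrite Z1, Z2, Z3, Z4.
  replace (0 + (0 + (rect_integral F a' b' c' d' + 0) + 0)) with (rect_integral F a' b' c' d') by ring.
  destruct (path_functional_rect a' b' c' d') as [T [HT PF]]; [lra|lra|].
  eapply Rle_trans; [apply (pf_bound PF _ B)|].
  - lra.
  - intros y Hy. apply HC. apply HT in Hy. destruct Hy. split; lra.
  - intros y Hy. apply HT in Hy. destruct Hy as [Hy1 Hy2].
    assert (Hyp : Cmod (y - (p1, p2)) < r).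
    { eapply Rle_lt_trans; [apply Cmod_le_Re_Im|]. rewrite Re_minus, Im_minus.
      simpl (Re (p1, p2)). simpl (Im (p1, p2)).
      assert (Rabs (Re y - p1) <= 2 * h) by (apply Rabs_le; lra).
      assert (Rabs (Im y - p2) <= 2 * h) by (apply Rabs_le; lra).
      lra. }
    specialize (HB y Hyp). pose proof (Cmod_le_add (F y) (F (p1, p2))). unfold B. lra.
  - apply Rle_trans with (8 * h * B)%R; [|exact Hh2].
    apply Rmult_le_compat_r; lra.
Qed.

Lemma CRInt_const (k : C) (u v : R) : CRInt (fun _ => k) u v = RtoC (v - u) * k.
Proof.
  etransitivity; [apply (RInt_const (V := C_R_CompleteNormedModule))|].
  destruct k. apply injective_projections; simpl; unfold scal; simpl; unfold mult; simpl; ring.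
Qed.

Lemma CRInt_near_const (g : R -> C) (k : C) (u v m : R) :
  (forall t, Rmin u v <= t <= Rmax u v -> RCcont g t) ->
  (forall t, Rmin u v <= t <= Rmax u v -> Cmod (g t - k) <= m) ->
  Cmod (CRInt g u v - RtoC (v - u) * k) <= m * Rabs (v - u).
Proof.
  assert (W : forall u v, u <= v -> (forall t, u <= t <= v -> RCcont g t) ->
    (forall t, u <= t <= v -> Cmod (g t - k) <= m) ->
    Cmod (CRInt g u v - RtoC (v - u) * k) <= m * (v - u)).
  { clear u v. intros u v Huv Hc Hm.
    assert (E : CRInt (fun t => 1 * g t + - (1) * k) u v = CRInt g u v - RtoC (v - u) * k).
    { rewrite CRInt_lin.
      - rewrite CRInt_const. cring.
      - apply ex_CRInt_cont; assumption.
      - apply ex_CRInt_cont; [assumption|]. intros; apply RCcont_const. }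
    rewrite <- E, Rmult_comm. apply CRInt_bound; [exact Huv| |].
    - apply ex_CRInt_cont; [assumption|]. intros t Ht.
      apply (continuous_plus (U := R_UniformSpace) (V := C_R_NormedModule)).
      + apply RCcont_mult; [apply RCcont_const|auto].
      + apply RCcont_mult; apply RCcont_const.
    - intros t Ht. replace (1 * g t + - (1) * k) with (g t - k) by ring. auto. }
  intros Hc Hm. destruct (Rle_or_lt u v) as [H|H].
  - rewrite Rmin_left, Rmax_right in Hc, Hm by lra. rewrite Rabs_right by lra. auto.
  - rewrite Rmin_right, Rmax_left in Hc, Hm by lra. rewrite Rabs_left by lra.
    assert (E : CRInt g u v = - CRInt g v u).
    { symmetry. apply (opp_RInt_swap (V := C_R_CompleteNormedModule)). apply ex_CRInt_cont; [lra|auto]. }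
    rewrite E, <- Cmod_opp.
    replace (- (- CRInt g v u - RtoC (v - u) * k)) with (CRInt g v u - RtoC (u - v) * k)
      by (rewrite !RtoC_minus; ring).
    replace (- (v - u))%R with (u - v)%R by ring. apply W; auto; lra.
Qed.

Lemma rect_primitive (F : C -> C) (a b c d : R) : Ccont_rect F a b c d ->
  (forall x x' y y', a <= x -> x <= x' -> x' <= b -> c <= y -> y <= y' -> y' <= d ->
     rect_integral F x x' y y' = 0) ->
  forall z, a < Re z < b -> c < Im z < d ->
    Cder (fun z => horizontal_integral F a (Re z) c + Ci * vertical_integral F (Re z) c (Im z)) z (F z).
Proof.
  intros HC HR [x y] Hx Hy e He. simpl in Hx, Hy.
  destruct (HC (x, y)) with (eps := (e / 2)%R) as [r [Hr H]]; [split; simpl; lra|lra|].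
  pose (q := Rmin (r / 2) (Rmin (Rmin (x - a) (b - x)) (Rmin (y - c) (d - y)))).
  assert (Hq : 0 < q) by (unfold q; repeat apply Rmin_glb_lt; lra).
  assert (Q1 : q <= r / 2) by apply Rmin_l.
  assert (Q2 : q <= Rmin (Rmin (x - a) (b - x)) (Rmin (y - c) (d - y))) by apply Rmin_r.
  assert (Q3 := Rle_trans _ _ _ Q2 (Rmin_l _ _)). assert (Q4 := Rle_trans _ _ _ Q2 (Rmin_r _ _)).
  pose proof (Rmin_l (x - a) (b - x)). pose proof (Rmin_r (x - a) (b - x)).
  pose proof (Rmin_l (y - c) (d - y)). pose proof (Rmin_r (y - c) (d - y)).
  exists q. split; [exact Hq|]. intros [x' y'] Hz.
  simpl (Re (_, _)). simpl (Im (_, _)).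
  assert (Ax : Rabs (x' - x) <= Cmod ((x', y') - (x, y))).
  { pose proof (re_le_Cmod ((x', y') - (x, y))) as A. rewrite Re_minus in A. exact A. }
  assert (Ay : Rabs (y' - y) <= Cmod ((x', y') - (x, y))).
  { pose proof (Rabs_Im_le_Cmod ((x', y') - (x, y))) as A. rewrite Im_minus in A. exact A. }
  assert (Bx : a <= x' <= b) by (pose proof (Rabs_def2 (x' - x) q ltac:(lra)); lra).
  assert (By : c <= y' <= d) by (pose proof (Rabs_def2 (y' - y) q ltac:(lra)); lra).
  assert (bet : forall u v t, Rmin u v <= t <= Rmax u v -> Rabs (t - u) <= Rabs (v - u)).
  { intros u v t. unfold Rmin, Rmax. destruct (Rle_dec u v); intros Ht.
    - rewrite !Rabs_right by lra. lra.
    - rewrite !Rabs_left1 by lra. lra. }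
  assert (inr : forall u v t lo hi, lo <= u <= hi -> lo <= v <= hi -> Rmin u v <= t <= Rmax u v -> lo <= t <= hi).
  { intros u v t lo hi. unfold Rmin, Rmax. destruct (Rle_dec u v); lra. }
  assert (ContV : forall t, Rmin y y' <= t <= Rmax y y' -> RCcont (fun t => F (x', t)) t).
  { intros t Ht. apply RCcont_comp; [eapply RCderive_RCcont, RCderive_vertical|]. apply HC.
    split; simpl; [lra|]. apply (inr y y'); lra. }
  assert (ContH : forall t, Rmin x x' <= t <= Rmax x x' -> RCcont (fun t => F (t, y)) t).
  { intros t Ht. apply RCcont_comp; [eapply RCderive_RCcont, RCderive_horizontal|]. apply HC.
    split; simpl; [|lra]. apply (inr x x'); lra. }
  assert (EV : vertical_integral F x' c y' = vertical_integral F x' c y + CRInt (fun t => F (x', t)) y y').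
  { apply CRInt_Chasles.
    - apply (ex_vertical_integral F a b c d); auto; lra.
    - apply (ex_RInt_continuous (V := C_R_CompleteNormedModule)). exact ContV. }
  assert (EH : horizontal_integral F a x' y = horizontal_integral F a x y + CRInt (fun t => F (t, y)) x x').
  { apply CRInt_Chasles.
    - apply (ex_horizontal_integral F a b c d); auto; lra.
    - apply (ex_RInt_continuous (V := C_R_CompleteNormedModule)). exact ContH. }
  assert (R1 : horizontal_integral F a x' c + Ci * vertical_integral F x' c y = horizontal_integral F a x' y + Ci * vertical_integral F a c y).
  { apply Ceq_minus. rewrite <- (HR a x' c y) by lra. unfold rect_integral. ring. }
  assert (R2 : horizontal_integral F a x c + Ci * vertical_integral F x c y = horizontal_integral F a x y + Ci * vertical_integral F a c y).
  { apply Ceq_minus. rewrite <- (HR a x c y) by lra. unfold rect_integral. ring. }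
  assert (E : horizontal_integral F a x' c + Ci * vertical_integral F x' c y' - (horizontal_integral F a x c + Ci * vertical_integral F x c y)
     - F (x, y) * ((x', y') - (x, y)) =
     (CRInt (fun t => F (t, y)) x x' - RtoC (x' - x) * F (x, y)) +
     Ci * (CRInt (fun t => F (x', t)) y y' - RtoC (y' - y) * F (x, y))).
  { replace ((x', y') - (x, y)) with (RtoC (x' - x) + Ci * RtoC (y' - y))
      by (apply injective_projections; simpl; ring).
    rewrite R2, EV.
    replace (horizontal_integral F a x' c + Ci * (vertical_integral F x' c y + CRInt (fun t => F (x', t)) y y')) with
      (horizontal_integral F a x' c + Ci * vertical_integral F x' c y + Ci * CRInt (fun t => F (x', t)) y y') by ring.
    rewrite R1, EH. ring. }
  rewrite E. eapply Rle_trans; [apply Cmod_triangle|]. rewrite Cmod_mult, Cmod_Ci, Rmult_1_l.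
  assert (B1 : Cmod (CRInt (fun t => F (t, y)) x x' - RtoC (x' - x) * F (x, y)) <= e / 2 * Rabs (x' - x)).
  { apply CRInt_near_const; [exact ContH|]. intros t Ht. left. apply H.
    eapply Rle_lt_trans; [apply Cmod_le_Re_Im|]. rewrite Re_minus, Im_minus.
    simpl (Re (_, _)). simpl (Im (_, _)).
    pose proof (bet _ _ _ Ht). rewrite (Rminus_diag y), Rabs_R0. lra. }
  assert (B2 : Cmod (CRInt (fun t => F (x', t)) y y' - RtoC (y' - y) * F (x, y)) <= e / 2 * Rabs (y' - y)).
  { apply CRInt_near_const; [exact ContV|]. intros t Ht. left. apply H.
    eapply Rle_lt_trans; [apply Cmod_le_Re_Im|]. rewrite Re_minus, Im_minus.
    simpl (Re (_, _)). simpl (Im (_, _)).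
    pose proof (bet _ _ _ Ht). lra. }
  assert (e / 2 * Rabs (x' - x) <= e / 2 * Cmod ((x', y') - (x, y))) by (apply Rmult_le_compat_l; lra).
  assert (e / 2 * Rabs (y' - y) <= e / 2 * Cmod ((x', y') - (x, y))) by (apply Rmult_le_compat_l; lra).
  lra.
Qed.

Lemma RCderive_pair (u v : R -> R) (t a b : R) :
  is_derive u t a -> is_derive v t b -> RCderive (fun s : R => (u s, v s)) t (a, b).
Proof.
  intros Hu Hv.
  apply (filterdiff_comp'_2 (K := R_AbsRing) (T := R_NormedModule) (U := R_NormedModule) (V := R_NormedModule)
    (W := C_R_NormedModule) u v (fun p q : R => (p, q)) t
    (fun s => scal s a) (fun s => scal s b) (fun p q : R => (p, q)) Hu Hv).
  apply (filterdiff_ext (K := R_AbsRing) (U := C_R_NormedModule) (V := C_R_NormedModule) (fun x => x)).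
  - intros [p q]. reflexivity.
  - apply (filterdiff_ext_lin (K := R_AbsRing) (U := C_R_NormedModule) (V := C_R_NormedModule) _ (fun x => x)).
    + apply filterdiff_id.
    + intros [p q]. reflexivity.
Qed.

Definition circle_point (c : C) (r t : R) : C :=
  c + RtoC r * (cos (2 * PI * t), sin (2 * PI * t)).

Definition circle_speed (r t : R) : C :=
  RtoC (2 * PI * r) * (Ci * (cos (2 * PI * t), sin (2 * PI * t))).

Lemma RCderive_circle_point (c : C) (r t : R) : RCderive (circle_point c r) t (circle_speed r t).
Proof.
  assert (Dc : is_derive (fun s => (Re c + r * cos (2 * PI * s))%R) t (- (2 * PI * r) * sin (2 * PI * t))%R).
  { auto_derive; [exact I|ring]. }
  assert (Ds : is_derive (fun s => (Im c + r * sin (2 * PI * s))%R) t ((2 * PI * r) * cos (2 * PI * t))%R).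
  { auto_derive; [exact I|ring]. }
  apply is_derive_ext with (fun s => ((Re c + r * cos (2 * PI * s))%R, (Im c + r * sin (2 * PI * s))%R)).
  - intros s. destruct c. apply injective_projections; simpl; ring.
  - replace (circle_speed r t) with ((- (2 * PI * r) * sin (2 * PI * t))%R, ((2 * PI * r) * cos (2 * PI * t))%R)
      by (apply injective_projections; simpl; ring).
    apply RCderive_pair; assumption.
Qed.

(** * Cauchy's formula on circles *)

Lemma Cmod_cos_sin (t : R) : Cmod (cos t, sin t) = 1%R.
Proof.
  unfold Cmod; simpl. replace (cos t * (cos t * 1) + sin t * (sin t * 1))%R with 1%R; [apply sqrt_1|].
  pose proof (sin2_cos2 t) as H. unfold Rsqr in H. lra.
Qed.

Definition circle_arc_integral (c : C) (r u v : R) (F : C -> C) : C :=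
  CRInt (fun t => F (circle_point c r t) * circle_speed r t) u v.

Definition circle_arc_trace (c : C) (r u v : R) (y : C) : Prop :=
  exists t, u <= t <= v /\ circle_point c r t = y.

Lemma Cmod_circle_speed (r t : R) : 0 <= r -> Cmod (circle_speed r t) = (2 * PI * r)%R.
Proof.
  intros Hr. unfold circle_speed. rewrite !Cmod_mult, Cmod_Ci, Cmod_cos_sin, Cmod_R.
  pose proof PI_RGT_0. rewrite Rabs_right; [ring|]. apply Rle_ge. apply Rmult_le_pos; lra.
Qed.

Lemma circle_arc_trace_dist (c : C) (r u v : R) (y : C) : 0 <= r ->
  circle_arc_trace c r u v y -> Cmod (y - c) = r.
Proof.
  intros Hr [t [_ E]]. subst y. unfold circle_point.
  replace (c + RtoC r * (cos (2 * PI * t), sin (2 * PI * t)) - c) with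
    (RtoC r * (cos (2 * PI * t), sin (2 * PI * t))) by ring.
  rewrite Cmod_mult, Cmod_cos_sin, Cmod_R, Rabs_right by lra. ring.
Qed.

Lemma RCcont_circle_speed (r t : R) : RCcont (circle_speed r) t.
Proof.
  unfold circle_speed. apply RCcont_mult; [apply RCcont_const|].
  apply RCcont_mult; [apply RCcont_const|]. apply RCcont_pair.
  - apply (ex_derive_continuous (K := R_AbsRing) (V := R_NormedModule)).
    auto_derive. exact I.
  - apply (ex_derive_continuous (K := R_AbsRing) (V := R_NormedModule)).
    auto_derive. exact I.
Qed.

Lemma path_functional_circle_arc (c : C) (r u v : R) : 0 <= r -> u <= v ->
  path_functional (circle_arc_trace c r u v) (circle_arc_integral c r u v)
    ((v - u) * (2 * PI * r)) (fun P => P (circle_point c r v) - P (circle_point c r u)).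
Proof.
  intros Hr Huv. apply path_functional_arc; [exact Huv|..].
  - intros; apply RCderive_circle_point.
  - intros; apply RCcont_circle_speed.
  - intros. rewrite Cmod_circle_speed by exact Hr. lra.
Qed.

Lemma circle_point_period (c : C) (r t : R) : circle_point c r (t + 1) = circle_point c r t.
Proof.
  unfold circle_point. replace (2 * PI * (t + 1))%R with (2 * PI * t + 2 * PI)%R by ring.
  rewrite cos_plus, sin_plus, cos_2PI, sin_2PI. do 2 f_equal. f_equal; ring.
Qed.

Lemma closed_functional_circle (c : C) (r u : R) : 0 <= r ->
  closed_functional (circle_arc_trace c r u (u + 1)) (circle_arc_integral c r u (u + 1)) (2 * PI * r).
Proof.
  intros Hr. eapply path_functional_ext.
  - apply (path_functional_circle_arc c r u (u + 1)); [exact Hr|lra].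
  - reflexivity.
  - reflexivity.
  - ring.
  - intros P. cbv beta. rewrite circle_point_period. ring.
Qed.

Lemma index_circle_center (c : C) (r u : R) : 0 < r ->
  index (circle_arc_integral c r u (u + 1)) c = two_pi_i.
Proof.
  intros Hr. unfold index, circle_arc_integral.
  replace (fun t => / (circle_point c r t - c) * circle_speed r t) with (fun _ : R => two_pi_i).
  - rewrite CRInt_const. replace (u + 1 - u)%R with 1%R by ring. cring.
  - apply functional_extensionality. intros t. unfold circle_point, circle_speed, two_pi_i.
    set (e := ((cos (2 * PI * t), sin (2 * PI * t)) : C)).
    assert (He : e <> 0).
    { intros E. pose proof (Cmod_cos_sin (2 * PI * t)) as H. fold e in H. rewrite E, Cmod_0 in H. lra. }
    assert (Hr' : RtoC r <> 0) by (intros E; apply RtoC_inj in E; lra).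
    rewrite (RtoC_mult (2 * PI) r). field.
    replace (c + RtoC r * e - c) with (RtoC r * e) by ring. apply Cmult_neq_0; assumption.
Qed.

Lemma index_circle (c : C) (r u : R) (w : C) : 0 < r -> Cmod (w - c) < r ->
  index (circle_arc_integral c r u (u + 1)) w = two_pi_i.
Proof.
  intros Hr Hw. rewrite <- (index_circle_center c r u Hr).
  apply (index_segment _ _ _ _ _ (closed_functional_circle c r u ltac:(lra))).
  intros t Ht HT. apply circle_arc_trace_dist in HT; [|lra].
  replace (w + RtoC t * (c - w) - c) with (RtoC (1 - t) * (w - c)) in HT by (rewrite RtoC_minus; ring).
  rewrite Cmod_mult, Cmod_R, Rabs_right in HT by lra.
  pose proof (Cmod_ge_0 (w - c)). nra.
Qed.

Definition dq (f : C -> C) (p y : C) : C :=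
  if Ceq_dec y p then C_derive f p else (f y - f p) / (y - p).

Lemma dq_eq f p : dq f p p = C_derive f p.
Proof. unfold dq. destruct (Ceq_dec p p); [reflexivity|tauto]. Qed.

Lemma dq_neq f p y : y <> p -> dq f p y = (f y - f p) / (y - p).
Proof. intros H. unfold dq. destruct (Ceq_dec y p); [tauto|reflexivity]. Qed.

Lemma dq_spec f p y : f y = f p + (y - p) * dq f p y.
Proof.
  unfold dq. destruct (Ceq_dec y p) as [->|H]; [ring|].
  field. apply Csub_neq_0. exact H.
Qed.

Lemma dq_sym f p q : dq f p q = dq f q p.
Proof.
  destruct (Ceq_dec q p) as [->|H]; [reflexivity|].
  rewrite !dq_neq by auto. field. split; apply Csub_neq_0; auto.
Qed.

Lemma Cdiffable_dq_neq f p y : Cdiffable f y -> y <> p -> Cdiffable (dq f p) y.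
Proof.
  intros Hf H. destruct (Cdiffable_div_linear f p y Hf H) as [l Hl]. exists l.
  apply (Cder_ext_loc (fun y => (f y - f p) / (y - p))) with (r := Cmod (y - p)); [|intros u Hu|exact Hl].
  - apply Cmod_gt_0, Csub_neq_0, H.
  - symmetry. apply dq_neq. intros E. subst u. rewrite Cmod_sub_sym in Hu. lra.
Qed.

Lemma Ccont_dq_eq f p : Cdiffable f p -> Ccont (dq f p) p.
Proof.
  intros Hf e He. apply Cdiffable_C_derive in Hf.
  destruct (Hf (e / 2)%R ltac:(lra)) as [d [Hd H]]. exists d. split; [exact Hd|].
  intros y Hy. rewrite dq_eq. destruct (Ceq_dec y p) as [->|Hyp].
  - rewrite dq_eq. replace (C_derive f p - C_derive f p) with (RtoC 0) by ring. rewrite Cmod_0. exact He.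
  - rewrite dq_neq by exact Hyp. specialize (H y Hy).
    assert (N : y - p <> 0) by (apply Csub_neq_0; exact Hyp).
    replace ((f y - f p) / (y - p) - C_derive f p) with ((f y - f p - C_derive f p * (y - p)) / (y - p))
      by (field; exact N).
    rewrite Cmod_div by exact N. apply Cmod_gt_0 in N.
    apply Rle_lt_trans with (e / 2)%R; [|lra].
    apply Rmult_le_reg_r with (Cmod (y - p)); [exact N|].
    unfold Rdiv at 1. rewrite Rmult_assoc, Rinv_l, Rmult_1_r by lra. exact H.
Qed.

Lemma Ccont_dq f p y : Cdiffable f y -> Ccont (dq f p) y.
Proof.
  intros Hf. destruct (Ceq_dec y p) as [->|H]; [apply Ccont_dq_eq; exact Hf|].
  apply Cdiffable_Ccont, Cdiffable_dq_neq; assumption.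
Qed.

Notation circle_integral c r := (circle_arc_integral c r 0 (0 + 1)).

Lemma cauchy_circle (F : C -> C) (c : C) (r : R) (w : C) : 0 < r ->
  (forall y, Cmod (y - c) < 2 * r -> Cdiffable F y) -> Cmod (w - c) < r ->
  circle_integral c r (fun y => F y / (y - w)) = two_pi_i * F w.
Proof.
  intros Hr HF Hw.
  pose proof (closed_functional_circle c r 0 ltac:(lra)) as PF.
  set (T := circle_arc_trace c r 0 (0 + 1)) in *.
  assert (HT : forall y, T y -> Cmod (y - c) = r) by (intros y; apply circle_arc_trace_dist; lra).
  pose (s := (6 / 5 * r)%R).
  assert (Hs : forall y, in_rect (Re c - s) (Re c + s) (Im c - s) (Im c + s) y -> Cmod (y - c) < 2 * r).
  { intros y [H1 H2]. eapply Rle_lt_trans; [apply Cmod_2Rmax|].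
    change (fst (y - c)) with (Re (y - c)). change (snd (y - c)) with (Im (y - c)).
    rewrite Re_minus, Im_minus.
    assert (Rmax (Rabs (Re y - Re c)) (Rabs (Im y - Im c)) <= s).
    { apply Rmax_lub; apply Rabs_le; lra. }
    assert (S : sqrt 2 <= 3 / 2).
    { rewrite <- (sqrt_Rsqr (3 / 2)) by lra. apply sqrt_le_1; unfold Rsqr; lra. }
    apply Rle_lt_trans with (3 / 2 * s)%R; [|unfold s; lra].
    apply Rmult_le_compat; [apply sqrt_pos| |exact S|assumption].
    eapply Rle_trans; [apply Rabs_pos|apply Rmax_l]. }
  assert (HTs : forall y, T y -> Re c - s < Re y < Re c + s /\ Im c - s < Im y < Im c + s).
  { intros y Hy. apply HT in Hy.
    pose proof (re_le_Cmod (y - c)) as H1. pose proof (Rabs_Im_le_Cmod (y - c)) as H2.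
    rewrite Re_minus in H1. rewrite Im_minus in H2.
    pose proof (Rabs_def2 (Re y - Re c) s ltac:(unfold s; lra)).
    pose proof (Rabs_def2 (Im y - Im c) s ltac:(unfold s; lra)). lra. }
  assert (Z : circle_integral c r (dq F w) = 0).
  { eapply (pf_exact PF).
    - intros y Hy. apply Ccont_dq, HF. rewrite HT by exact Hy. lra.
    - intros y Hy. destruct (HTs y Hy) as [H1 H2].
      apply (rect_primitive (dq F w) (Re c - s) (Re c + s) (Im c - s) (Im c + s)); [..|exact H1|exact H2].
      + intros u Hu. apply Ccont_dq, HF, Hs, Hu.
      + intros x x' v v' h1 h2 h3 h4 h5 h6. apply (goursat_rect_except _ w); auto.
        * intros u [Hu1 Hu2]. apply Ccont_dq, HF, Hs. split; lra.
        * intros u [Hu1 Hu2] Hn. apply Cdiffable_dq_neq; [|exact Hn]. apply HF, Hs. split; lra. }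
  assert (N : forall y, T y -> y - w <> 0).
  { intros y Hy. apply Csub_neq_0. intros E. subst. rewrite HT in Hw by exact Hy. lra. }
  rewrite <- (index_circle c r 0 w Hr Hw). unfold index.
  rewrite Cmult_comm, <- (pf_scal PF).
  - apply Ceq_minus. rewrite <- (pf_minus PF).
    + rewrite <- Z. apply (pf_ext PF).
      * intros y Hy. specialize (N y Hy). ccont. apply Cdiffable_Ccont, HF. rewrite HT by exact Hy. lra.
      * intros y Hy. apply Ccont_dq, HF. rewrite HT by exact Hy. lra.
      * intros y Hy. rewrite dq_neq by (intros E; apply (N y Hy); rewrite E; ring). field. auto.
    + intros y Hy. specialize (N y Hy). ccont. apply Cdiffable_Ccont, HF. rewrite HT by exact Hy. lra.
    + intros y Hy. specialize (N y Hy). ccont.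
  - intros y Hy. specialize (N y Hy). ccont.
Qed.

(** * Difference quotients and integrals depending on a point *)

Lemma two_pi_i_neq_0 : two_pi_i <> 0.
Proof.
  apply Cmult_neq_0; [|apply Ci_nz]. intros E. apply RtoC_inj in E. pose proof PI_RGT_0. lra.
Qed.

Lemma Cmod_two_pi_i : Cmod two_pi_i = (2 * PI)%R.
Proof.
  unfold two_pi_i. rewrite Cmod_mult, Cmod_Ci, Cmod_R, Rabs_right; pose proof PI_RGT_0; lra.
Qed.

Lemma circle_integral_le (c : C) (r M : R) (F : C -> C) : 0 <= r -> 0 <= M ->
  (forall y, Cmod (y - c) = r -> Ccont F y) -> (forall y, Cmod (y - c) = r -> Cmod (F y) <= M) ->
  Cmod (circle_integral c r F) <= 2 * PI * r * M.
Proof.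
  intros Hr HM HF HB.
  apply (pf_bound (closed_functional_circle c r 0 Hr)); [exact HM|..].
  - intros y Hy. apply HF. apply circle_arc_trace_dist in Hy; assumption.
  - intros y Hy. apply HB. apply circle_arc_trace_dist in Hy; assumption.
Qed.

Lemma dq_cauchy_circle (f : C -> C) (p : C) (r : R) (z : C) : 0 < r ->
  (forall y, Cmod (y - p) < 2 * r -> Cdiffable f y) -> Cmod (z - p) < r ->
  dq f p z = / two_pi_i * circle_integral p r (fun y => f y / (y - p) / (y - z)).
Proof.
  intros Hr Hf Hz.
  pose proof (closed_functional_circle p r 0 ltac:(lra)) as PF.
  set (T := circle_arc_trace p r 0 (0 + 1)) in *.
  assert (HT : forall y, T y -> Cmod (y - p) = r) by (intros y; apply circle_arc_trace_dist; lra).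
  assert (N : forall w, Cmod (w - p) < r -> forall y, T y -> y - w <> 0).
  { intros w Hw y Hy. apply Csub_neq_0. intros E. subst. rewrite HT in Hw by exact Hy. lra. }
  assert (Hp : Cmod (p - p) < r) by (rewrite Cmod_sub_diag; exact Hr).
  assert (Cf : forall y, T y -> Ccont f y).
  { intros y Hy. apply Cdiffable_Ccont, Hf. rewrite HT by exact Hy. lra. }
  pose proof two_pi_i_neq_0 as H2.
  destruct (Ceq_dec z p) as [->|Hzp].
  - rewrite dq_eq. apply Cder_C_derive.
    apply (Cder_ext_loc (fun z => / two_pi_i * circle_integral p r (fun y => f y / (y - z)))) with (r := r).
    + exact Hr.
    + intros y Hy. rewrite cauchy_circle by assumption. field. exact H2.
    + apply Cder_scal. eapply Cder_eq.
      * apply (Cder_cauchy_type _ _ _ _ f p PF Cf). intros HTp. apply (N p Hp p HTp). ring.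
      * apply (pf_ext PF).
        -- intros y Hy. specialize (N p Hp y Hy). specialize (Cf y Hy). ccont. apply Cmult_neq_0; assumption.
        -- intros y Hy. specialize (N p Hp y Hy). specialize (Cf y Hy). ccont.
        -- intros y Hy. specialize (N p Hp y Hy). field. exact N.
  - rewrite dq_neq by exact Hzp.
    assert (Nzp : z - p <> 0) by (apply Csub_neq_0; exact Hzp).
    assert (E : f z - f p = / two_pi_i * (circle_integral p r (fun y => f y / (y - z)) -
       circle_integral p r (fun y => f y / (y - p)))).
    { rewrite !cauchy_circle by assumption. field. exact H2. }
    rewrite E, <- (pf_minus PF).
    + assert (E2 : circle_integral p r (fun y => f y / (y - z) - f y / (y - p)) =
        (z - p) * circle_integral p r (fun y => f y / (y - p) / (y - z))).
      { rewrite <- (pf_scal PF).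
        - apply (pf_ext PF).
          + intros y Hy. pose proof (N p Hp y Hy). pose proof (N z Hz y Hy). specialize (Cf y Hy). ccont.
          + intros y Hy. pose proof (N p Hp y Hy). pose proof (N z Hz y Hy). specialize (Cf y Hy). ccont.
          + intros y Hy. pose proof (N p Hp y Hy). pose proof (N z Hz y Hy). field. auto.
        - intros y Hy. pose proof (N p Hp y Hy). pose proof (N z Hz y Hy). specialize (Cf y Hy). ccont. }
      rewrite E2. field. auto.
    + intros y Hy. pose proof (N z Hz y Hy). specialize (Cf y Hy). ccont.
    + intros y Hy. pose proof (N p Hp y Hy). specialize (Cf y Hy). ccont.
Qed.

Definition holomorphic_near (f : C -> C) (p : C) : Prop :=
  exists r, 0 < r /\ forall y, Cmod (y - p) < r -> Cdiffable f y.

Lemma Cdiffable_dq (f : C -> C) (p z : C) : holomorphic_near f z -> Cdiffable (dq f p) z.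
Proof.
  intros [r [Hr Hf]].
  assert (Hz0 : Cmod (z - z) < r) by (rewrite Cmod_sub_diag; exact Hr).
  destruct (Ceq_dec z p) as [->|Hzp]; [|apply Cdiffable_dq_neq; auto].
  pose proof (closed_functional_circle p (r / 2) 0 ltac:(lra)) as PF.
  assert (N : ~ circle_arc_trace p (r / 2) 0 (0 + 1) p).
  { intros H. apply circle_arc_trace_dist in H; [|lra].
    rewrite Cmod_sub_diag in H. lra. }
  eexists.
  apply (Cder_ext_loc (fun z => / two_pi_i * circle_integral p (r / 2) (fun y => f y / (y - p) / (y - z)))) with (r := (r / 2)%R).
  - lra.
  - intros y Hy. symmetry. apply dq_cauchy_circle; [lra| |exact Hy].
    intros u Hu. apply Hf. lra.
  - apply Cder_scal. apply (Cder_cauchy_type _ _ _ _ (fun y => f y / (y - p)) p PF); [|exact N].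
    intros y Hy. assert (y - p <> 0) by (apply Csub_neq_0; intros E; subst; tauto). ccont.
    apply Cdiffable_Ccont, Hf. apply circle_arc_trace_dist in Hy; lra.
Qed.

Lemma dq_lipschitz (f : C -> C) (p : C) (r B : R) : 0 < r -> 0 <= B ->
  (forall y, Cmod (y - p) < 2 * r -> Cdiffable f y) ->
  (forall y, Cmod (y - p) < 2 * r -> Cmod (f y) <= B) ->
  forall z z', Cmod (z - p) < r / 2 -> Cmod (z' - p) < r / 2 ->
  Cmod (dq f p z - dq f p z') <= 4 * B / (r * r) * Cmod (z - z').
Proof.
  intros Hr HB Hf Hb z z' Hz Hz'.
  pose proof (closed_functional_circle p r 0 ltac:(lra)) as PF.
  set (T := circle_arc_trace p r 0 (0 + 1)) in *.
  assert (HT : forall y, T y -> Cmod (y - p) = r) by (intros y; apply circle_arc_trace_dist; lra).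
  assert (Dw : forall w, Cmod (w - p) < r / 2 -> forall y, Cmod (y - p) = r -> r / 2 <= Cmod (y - w)).
  { intros w Hw y Hy. pose proof (Cmod_sub_triangle y w p). lra. }
  assert (N : forall w, Cmod (w - p) < r / 2 -> forall y, Cmod (y - p) = r -> y - w <> 0).
  { intros w Hw y Hy. apply Cmod_gt_0. specialize (Dw w Hw y Hy). lra. }
  assert (Hp : Cmod (p - p) < r / 2) by (rewrite Cmod_sub_diag; lra).
  assert (Cf : forall y, Cmod (y - p) = r -> Ccont f y).
  { intros y Hy. apply Cdiffable_Ccont, Hf. lra. }
  pose proof two_pi_i_neq_0 as H2. pose proof PI_RGT_0.
  rewrite (dq_cauchy_circle f p r z), (dq_cauchy_circle f p r z') by (auto; lra).
  replace (/ two_pi_i * circle_integral p r (fun y => f y / (y - p) / (y - z)) -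
    / two_pi_i * circle_integral p r (fun y => f y / (y - p) / (y - z'))) with
    ((circle_integral p r (fun y => f y / (y - p) / (y - z)) -
      circle_integral p r (fun y => f y / (y - p) / (y - z'))) / two_pi_i) by (field; exact H2).
  rewrite <- (pf_minus PF).
  - assert (Cmod (circle_integral p r (fun y => f y / (y - p) / (y - z) - f y / (y - p) / (y - z')))
      <= 2 * PI * r * (B * Cmod (z - z') / (r * (r / 2) * (r / 2)))).
    { assert (0 < r * (r / 2) * (r / 2)) by (repeat apply Rmult_lt_0_compat; lra).
      apply circle_integral_le; [lra| | |].
      - apply Rmult_le_pos; [apply Rmult_le_pos; [exact HB|apply Cmod_ge_0]|].
        left. apply Rinv_0_lt_compat. assumption.
      - intros y Hy. pose proof (N p Hp y Hy). pose proof (N z Hz y Hy). pose proof (N z' Hz' y Hy).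
        specialize (Cf y Hy). ccont.
      - intros y Hy. pose proof (N p Hp y Hy). pose proof (N z Hz y Hy). pose proof (N z' Hz' y Hy).
        replace (f y / (y - p) / (y - z) - f y / (y - p) / (y - z')) with
          (f y * (z - z') / ((y - p) * (y - z) * (y - z'))) by (field; auto).
        apply Cmod_div_le.
        + rewrite Cmod_mult. apply Rmult_le_compat_r; [apply Cmod_ge_0|]. apply Hb. lra.
        + assumption.
        + rewrite !Cmod_mult. pose proof (Dw z Hz y Hy). pose proof (Dw z' Hz' y Hy).
          repeat apply Rmult_le_compat; try lra. apply Rmult_le_pos; lra. }
    rewrite Cmod_div, Cmod_two_pi_i by exact H2.
    apply Rmult_le_reg_r with (2 * PI)%R; [lra|].
    unfold Rdiv at 1. rewrite Rmult_assoc, Rinv_l, Rmult_1_r by lra.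
    eapply Rle_trans; [eassumption|]. right. field. lra.
  - intros y Hy. apply HT in Hy. pose proof (N p Hp y Hy). pose proof (N z Hz y Hy). specialize (Cf y Hy). ccont.
  - intros y Hy. apply HT in Hy. pose proof (N p Hp y Hy). pose proof (N z' Hz' y Hy). specialize (Cf y Hy). ccont.
Qed.

Lemma Cdiffable_of_lipschitz_quotient (h : C -> C) (p : C) (r K : R) : 0 < r -> 0 <= K ->
  (forall z z', z <> p -> z' <> p -> Cmod (z - p) < r -> Cmod (z' - p) < r ->
     Cmod ((h z - h p) / (z - p) - (h z' - h p) / (z' - p)) <= K * Cmod (z - z')) ->
  Cdiffable h p.
Proof.
  intros Hr HK H.
  pose (q := fun z => (h z - h p) / (z - p)).
  pose (u := fun n : nat => p + RtoC (r / (INR n + 2))).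
  assert (Hn : forall n, 0 < r / (INR n + 2)).
  { intros n. apply Rdiv_lt_0_compat; [exact Hr|]. pose proof (pos_INR n). lra. }
  assert (Hu : forall n, Cmod (u n - p) = (r / (INR n + 2))%R).
  { intros n. unfold u. replace (p + RtoC (r / (INR n + 2)) - p) with (RtoC (r / (INR n + 2))) by ring.
    rewrite Cmod_R, Rabs_right; [reflexivity|]. left. apply Hn. }
  assert (Hur : forall n, Cmod (u n - p) < r).
  { intros n. rewrite Hu. pose proof (pos_INR n).
    apply Rmult_lt_reg_r with (INR n + 2)%R; [lra|]. unfold Rdiv. rewrite Rmult_assoc, Rinv_l by lra. nra. }
  assert (Hup : forall n, u n <> p).
  { intros n E. pose proof (Hu n) as E1. rewrite E in E1. rewrite Cmod_sub_diag in E1. specialize (Hn n). lra. }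
  assert (Hsmall : forall e, 0 < e -> exists N, forall n, (N <= n)%nat -> Cmod (u n - p) < e).
  { intros e He. destruct (nfloor_ex (r / e)) as [N [_ HN]].
    { left. apply Rdiv_lt_0_compat; assumption. }
    exists N. intros n Hle. rewrite Hu. apply le_INR in Hle. pose proof (pos_INR n).
    apply Rmult_lt_reg_r with (INR n + 2)%R; [lra|]. unfold Rdiv. rewrite Rmult_assoc, Rinv_l, Rmult_1_r by lra.
    apply Rle_lt_trans with (e * (r / e))%R; [right; field; lra|]. apply Rmult_lt_compat_l; lra. }
  destruct (proj1 (filterlim_locally_cauchy (U := C_CompleteNormedModule) (F := eventually) (fun n => q (u n)))) as [l Hl].
  - intros eps. destruct (Hsmall (eps / (4 * (K + 1)))%R) as [N HN].
    { apply Rdiv_lt_0_compat; [apply cond_pos|lra]. }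
    exists (fun n => (N <= n)%nat). split; [exists N; auto|].
    intros n m Hnn Hm. apply C_NormedModule_mixin_compat1.
    change (minus (q (u m)) (q (u n))) with (q (u m) - q (u n)).
    eapply Rle_lt_trans; [apply H; auto|].
    pose proof (Cmod_sub_triangle (u m) p (u n)) as H1. rewrite (Cmod_sub_sym p) in H1.
    pose proof (HN n Hnn). pose proof (HN m Hm).
    apply Rle_lt_trans with (K * (2 * (eps / (4 * (K + 1)))))%R.
    { apply Rmult_le_compat_l; lra. }
    pose proof (cond_pos eps).
    replace (K * (2 * (eps / (4 * (K + 1)))))%R with (eps * (K / (2 * (K + 1))))%R by (field; lra).
    rewrite <- (Rmult_1_r eps) at 2. apply Rmult_lt_compat_l; [assumption|].
    apply Rmult_lt_reg_r with (2 * (K + 1))%R; [lra|]. unfold Rdiv. rewrite Rmult_assoc, Rinv_l by lra. lra.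
  - exists l.
    assert (Hq : forall z, z <> p -> Cmod (z - p) < r -> Cmod (q z - l) <= K * Cmod (z - p)).
    { intros z Hz Hzr. apply le_epsilon. intros e He.
      assert (HP : eventually (fun n => Cmod (q (u n) - l) < e / 2)).
      { apply (Hl (fun y => Cmod (y - l) < e / 2)). apply C_UniformSpace_locally_Cmod.
        exists (e / 2)%R. split; [lra|auto]. }
      destruct HP as [N1 HN1].
      destruct (Hsmall (e / (2 * (K + 1)))%R) as [N2 HN2]; [apply Rdiv_lt_0_compat; lra|].
      pose (n := Nat.max N1 N2).
      specialize (HN1 n (Nat.le_max_l _ _)). specialize (HN2 n (Nat.le_max_r _ _)).
      pose proof (Cmod_sub_triangle (q z) (q (u n)) l) as H1.
      pose proof (H z (u n) Hz (Hup n) Hzr (Hur n)) as H3. fold (q z) in H3. fold (q (u n)) in H3.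
      pose proof (Cmod_sub_triangle z p (u n)) as H4. rewrite (Cmod_sub_sym p) in H4.
      assert (H5 : K * Cmod (z - u n) <= K * Cmod (z - p) + K * (e / (2 * (K + 1)))).
      { rewrite <- Rmult_plus_distr_l. apply Rmult_le_compat_l; lra. }
      assert (H6 : K * (e / (2 * (K + 1))) <= e / 2).
      { apply Rle_trans with ((K + 1) * (e / (2 * (K + 1))))%R; [|right; field; lra].
        apply Rmult_le_compat_r; [|lra]. left. apply Rdiv_lt_0_compat; lra. }
      lra. }
    intros e He. exists (Rmin r (e / (K + 1))). split.
    { apply Rmin_glb_lt; [exact Hr|]. apply Rdiv_lt_0_compat; lra. }
    intros z Hz.
    assert (Hz1 : Cmod (z - p) < r) by (apply (Rmin_Rgt_l _ _ _ Hz)).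
    assert (Hz2 : Cmod (z - p) < e / (K + 1)) by (apply (Rmin_Rgt_l _ _ _ Hz)).
    destruct (Ceq_dec z p) as [->|Hzp].
    { replace (h p - h p - l * (p - p)) with (RtoC 0) by ring.
      rewrite Cmod_0. apply Rmult_le_pos; [lra|apply Cmod_ge_0]. }
    replace (h z - h p - l * (z - p)) with ((q z - l) * (z - p))
      by (unfold q; field; apply Csub_neq_0; exact Hzp).
    rewrite Cmod_mult. apply Rmult_le_compat_r; [apply Cmod_ge_0|].
    eapply Rle_trans; [apply Hq; assumption|].
    apply Rle_trans with ((K + 1) * (e / (K + 1)))%R; [|right; field; lra].
    apply Rmult_le_compat; try lra. apply Cmod_ge_0.
Qed.

Lemma Cdiffable_path_functional T L len D (Phi : C -> C -> C) (p : C) (r B : R) :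
  path_functional T L len D -> 0 < r -> 0 <= B ->
  (forall z, Cmod (z - p) < 2 * r -> forall y, T y -> Ccont (Phi z) y) ->
  (forall z, Cmod (z - p) < 2 * r -> forall y, T y -> Cdiffable (fun z => Phi z y) z) ->
  (forall z, Cmod (z - p) < 2 * r -> forall y, T y -> Cmod (Phi z y) <= B) ->
  Cdiffable (fun z => L (Phi z)) p.
Proof.
  intros PF Hr HB HC HD Hb.
  assert (Hp : Cmod (p - p) < 2 * r) by (rewrite Cmod_sub_diag; lra).
  pose proof (pf_len PF) as Hl.
  assert (HK : 0 <= 4 * B / (r * r)).
  { apply Rmult_le_pos; [lra|]. left. apply Rinv_0_lt_compat. apply Rmult_lt_0_compat; exact Hr. }
  apply (Cdiffable_of_lipschitz_quotient _ p (r / 2) (len * (4 * B / (r * r)))); [lra| |].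
  - apply Rmult_le_pos; assumption.
  - intros z z' Hz Hz' Hzr Hzr'.
    assert (E : forall w, w <> p -> Cmod (w - p) < r / 2 ->
      (L (Phi w) - L (Phi p)) / (w - p) = L (fun y => / (w - p) * (Phi w y - Phi p y))).
    { intros w Hw Hwr. unfold Cdiv. rewrite Cmult_comm, <- (pf_minus PF).
      - rewrite <- (pf_scal PF); [reflexivity|].
        intros y Hy. apply Ccont_minus; apply HC; auto; lra.
      - apply HC; lra.
      - apply HC; auto. }
    assert (Cq : forall w, w <> p -> Cmod (w - p) < r / 2 -> forall y, T y ->
      Ccont (fun y => / (w - p) * (Phi w y - Phi p y)) y).
    { intros w Hw Hwr y Hy. apply Ccont_mult; [apply Ccont_const|]. apply Ccont_minus; apply HC; auto; lra. }
    rewrite (E z), (E z') by assumption.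
    rewrite <- (pf_minus PF) by auto.
    rewrite Rmult_assoc. apply (pf_bound PF).
    + apply Rmult_le_pos; [exact HK|apply Cmod_ge_0].
    + intros y Hy. apply Ccont_minus; auto.
    + intros y Hy.
      pose proof (dq_lipschitz (fun z => Phi z y) p r B Hr HB (fun z Hz => HD z Hz y Hy)
        (fun z Hz => Hb z Hz y Hy) z z' Hzr Hzr') as H.
      rewrite !dq_neq in H by assumption.
      unfold Cdiv in H. rewrite !(Cmult_comm _ (/ _)) in H. exact H.
Qed.

(** * The homology form of Cauchy's formula *)

Lemma open_ball_Cmod (U : C -> Prop) (z : C) : open (T := C_UniformSpace) U -> U z ->
  exists r, 0 < r /\ forall y, Cmod (y - z) < r -> U y.
Proof. intros HU Hz. apply C_UniformSpace_locally_Cmod. exact (HU z Hz). Qed.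

(** When [w] is close to [p], Cauchy's formula on the circle of radius [6 r] keeps
    the difference quotients away from the diagonal. *)
Lemma dq_bound (f : C -> C) (p : C) (r M : R) (w z : C) : 0 < r -> 0 <= M ->
  (forall y, Cmod (y - p) < 12 * r -> Cdiffable f y) ->
  holomorphic_near f w ->
  (forall y, Cmod (y - p) < 12 * r -> Cmod (f y) <= M) -> Cmod (f w) <= M ->
  Cmod (z - p) < 2 * r -> Cmod (dq f w z) <= 2 * M / r.
Proof.
  intros Hr HM Hf Hw HB HBw Hz.
  assert (far : forall y, Cmod (y - p) < 12 * r -> 2 * r <= Cmod (y - w) ->
    Cmod (dq f w y) <= 2 * M / (2 * r)).
  { intros y Hy Hyw. rewrite dq_neq.
    - apply Cmod_div_le; [|lra|exact Hyw]. pose proof (Cmod_sub_le (f y) (f w)). specialize (HB y Hy). lra.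
    - intros E. subst. rewrite Cmod_sub_diag in Hyw. lra. }
  assert (Hle : 2 * M / (2 * r) <= 2 * M / r).
  { apply Rmult_le_compat_l; [lra|]. apply Rinv_le_contravar; lra. }
  assert (H0 : 0 <= 2 * M / (2 * r)).
  { apply Rdiv_le_0_compat; [lra|lra]. }
  destruct (Rle_or_lt (4 * r) (Cmod (w - p))) as [Hfar|Hnear].
  - eapply Rle_trans; [apply far; [lra|]|exact Hle].
    pose proof (Cmod_sub_triangle w z p). rewrite (Cmod_sub_sym w z) in H. lra.
  - pose proof two_pi_i_neq_0 as H2. pose proof PI_RGT_0.
    assert (HD : forall y, Cmod (y - p) < 2 * (6 * r) -> Cdiffable (dq f w) y).
    { intros y Hy. destruct (Ceq_dec y w) as [->|Hyw]; [apply Cdiffable_dq; exact Hw|].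
      apply Cdiffable_dq_neq; [apply Hf; lra|exact Hyw]. }
    assert (E : dq f w z = circle_integral p (6 * r) (fun y => dq f w y / (y - z)) / two_pi_i).
    { rewrite cauchy_circle by (try assumption; lra). field. exact H2. }
    rewrite E, Cmod_div, Cmod_two_pi_i by exact H2.
    assert (D : forall y, Cmod (y - p) = (6 * r)%R -> 4 * r <= Cmod (y - z)).
    { intros y Hy. pose proof (Cmod_sub_triangle y z p). lra. }
    assert (Cmod (circle_integral p (6 * r) (fun y => dq f w y / (y - z))) <=
      2 * PI * (6 * r) * (2 * M / (2 * r) / (4 * r))).
    { apply circle_integral_le; [lra| | |].
      - apply Rdiv_le_0_compat; [exact H0|lra].
      - intros y Hy. specialize (D y Hy). assert (y - z <> 0) by (apply Cmod_gt_0; lra).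
        ccont. apply Cdiffable_Ccont, HD. lra.
      - intros y Hy. specialize (D y Hy). apply Cmod_div_le; [|lra|lra].
        apply far; [lra|]. pose proof (Cmod_sub_triangle y w p). lra. }
    apply Rmult_le_reg_r with (2 * PI)%R; [lra|].
    unfold Rdiv at 1. rewrite Rmult_assoc, Rinv_l, Rmult_1_r by lra.
    eapply Rle_trans; [eassumption|].
    replace (2 * PI * (6 * r) * (2 * M / (2 * r) / (4 * r)))%R with (2 * PI * (3 / 4 * (2 * M / r)))%R by (field; lra).
    assert (0 <= 2 * M / r) by lra. nra.
Qed.

(** Dixon's argument: [h z = L (dq f z)] extends by [L (f y / (y - z))], the two
    agreeing where the index vanishes, to an entire function tending to [0] at
    infinity. *)
Lemma cauchy_formula_homology T L len (U : C -> Prop) (f : C -> C) :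
  closed_functional T L len -> open (T := C_UniformSpace) U -> (forall y, T y -> U y) ->
  (forall y, U y -> Cdiffable f y) -> (forall w, ~ U w -> index L w = 0) ->
  forall w, U w -> ~ T w -> L (fun y => f y / (y - w)) = index L w * f w.
Proof.
  intros PF HU HTU Hf Hind.
  pose proof (pf_len PF) as Hl.
  assert (Hhol : forall y, U y -> holomorphic_near f y).
  { intros y Hy. destruct (open_ball_Cmod U y HU Hy) as [r [Hr H]]. exists r. auto. }
  assert (HfT : forall y, T y -> Ccont f y) by (intros y Hy; apply Cdiffable_Ccont, Hf, HTU, Hy).
  destruct (pf_compact PF f HfT) as [BT [HBT0 HBT]].
  destruct (pf_compact PF (fun y => y)) as [M [HM0 HM]]; [intros; apply Ccont_id|].
  pose (h := fun z => if excluded_middle_informative (U z) then L (dq f z)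
                      else L (fun y => f y / (y - z))).
  assert (hU : forall z, U z -> h z = L (dq f z)).
  { intros z Hz. unfold h. destruct (excluded_middle_informative (U z)); tauto. }
  assert (hU' : forall z, U z -> ~ T z -> h z = L (fun y => f y / (y - z)) - index L z * f z).
  { intros z Hz HTz. rewrite hU by exact Hz. unfold index.
    assert (N : forall y, T y -> y - z <> 0) by (intros y Hy; apply Csub_neq_0; intros E; subst; tauto).
    rewrite (Cmult_comm _ (f z)), <- (pf_scal PF).
    - rewrite <- (pf_minus PF).
      + apply (pf_ext PF).
        * intros y Hy. apply Ccont_dq, Hf, HTU, Hy.
        * intros y Hy. specialize (N y Hy). specialize (HfT y Hy). ccont.
        * intros y Hy. specialize (N y Hy). rewrite dq_neq by (intros E; apply N; rewrite E; ring).
          field. exact N.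
      + intros y Hy. specialize (N y Hy). specialize (HfT y Hy). ccont.
      + intros y Hy. specialize (N y Hy). ccont.
    - intros y Hy. specialize (N y Hy). ccont. }
  assert (h0 : forall z, ~ T z -> index L z = 0 -> h z = L (fun y => f y / (y - z))).
  { intros z HTz Hz. destruct (classic (U z)) as [H|H].
    - rewrite hU' by assumption. rewrite Hz. ring.
    - unfold h. destruct (excluded_middle_informative (U z)); tauto. }
  assert (hD : forall z, Cdiffable h z).
  { intros p. destruct (classic (U p)) as [Hp|Hp].
    - destruct (open_ball_Cmod U p HU Hp) as [r1 [Hr1 H1]].
      destruct (Cdiffable_Ccont f p (Hf p Hp) 1%R Rlt_0_1) as [r2 [Hr2 H2]].
      pose (r := (Rmin r1 r2 / 12)%R).
      assert (Hr : 0 < r) by (unfold r; pose proof (Rmin_glb_lt _ _ _ Hr1 Hr2); lra).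
      assert (Hr1' : 12 * r <= r1) by (unfold r; pose proof (Rmin_l r1 r2); lra).
      assert (Hr2' : 12 * r <= r2) by (unfold r; pose proof (Rmin_r r1 r2); lra).
      pose (B := (Cmod (f p) + 1 + BT)%R).
      assert (HB : 0 <= B) by (unfold B; pose proof (Cmod_ge_0 (f p)); lra).
      assert (HBd : forall y, Cmod (y - p) < 12 * r -> Cmod (f y) <= B).
      { intros y Hy. specialize (H2 y ltac:(lra)). pose proof (Cmod_le_add (f y) (f p)). unfold B. lra. }
      destruct (Cdiffable_path_functional T L len _ (fun z => dq f z) p r (2 * B / r) PF Hr) as [l Hd].
      + apply Rdiv_le_0_compat; [lra|exact Hr].
      + intros z Hz y Hy. apply Ccont_dq, Hf, HTU, Hy.
      + intros z Hz y Hy. replace (fun z => dq f z y) with (dq f y)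
          by (apply functional_extensionality; intros; apply dq_sym).
        apply Cdiffable_dq, Hhol, H1. lra.
      + intros z Hz y Hy. rewrite dq_sym. apply (dq_bound f p r B y z); auto.
        * intros u Hu. apply Hf, H1. lra.
        * specialize (HBT y Hy). unfold B. pose proof (Cmod_ge_0 (f p)). lra.
      + exists l. apply (Cder_ext_loc (fun z => L (dq f z))) with (r := r1); [exact Hr1| |exact Hd].
        intros y Hy. symmetry. apply hU, H1. exact Hy.
    - assert (HTp : ~ T p) by auto.
      destruct (pf_dist _ _ _ _ p PF HTp) as [d [Hd HdT]].
      eexists. apply (Cder_ext_loc (fun z => L (fun y => f y / (y - z)))) with (r := d); [exact Hd| |].
      + assert (off : forall z, Cmod (z - p) < d -> ~ T z).
        { intros z Hz Ht. specialize (HdT z Ht). lra. }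
        intros z Hz. symmetry. apply h0; [auto|]. rewrite <- (Hind p Hp). symmetry.
        apply (index_segment _ _ _ _ _ PF). intros t Ht. apply off.
        replace (p + RtoC t * (z - p) - p) with (RtoC t * (z - p)) by ring.
        rewrite Cmod_mult, Cmod_R, Rabs_right by lra. pose proof (Cmod_ge_0 (z - p)). nra.
      + apply (Cder_cauchy_type _ _ _ _ f p PF HfT HTp). }
  assert (hbig : forall z, M < Cmod z -> Cmod (h z) <= len * (BT / (Cmod z - M))).
  { intros z Hz.
    assert (far : forall t, 0 <= t -> ~ T (z + RtoC t * z)).
    { intros t Ht HT. specialize (HM _ HT).
      replace (z + RtoC t * z) with (RtoC (1 + t) * z) in HM by (rewrite RtoC_plus; ring).
      rewrite Cmod_mult, Cmod_R, Rabs_right in HM by lra. nra. }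
    assert (HTz : ~ T z).
    { intros HT. specialize (HM _ HT). lra. }
    rewrite h0; [|exact HTz|].
    - assert (D : forall y, T y -> Cmod z - M <= Cmod (y - z)).
      { intros y Hy. specialize (HM y Hy). pose proof (Cmod_le_add z y). rewrite (Cmod_sub_sym z) in H. lra. }
      apply (pf_bound PF).
      + apply Rdiv_le_0_compat; [exact HBT0|lra].
      + intros y Hy. assert (y - z <> 0) by (apply Csub_neq_0; intros E; subst; tauto).
        specialize (HfT y Hy). ccont.
      + intros y Hy. apply Cmod_div_le; [auto|lra|auto].
    - apply (index_ray _ _ _ z z PF); [|exact far]. apply Cmod_gt_0. lra. }
  assert (hz : forall z, h z = 0).
  { intros z. apply Cmod_eps_eq_0. intros e He.
    pose (N := (len * BT / e + 1)%R).
    assert (Hlb : 0 <= len * BT) by (apply Rmult_le_pos; assumption).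
    assert (HN : 1 <= N).
    { unfold N. assert (0 <= len * BT / e); [|lra]. apply Rdiv_le_0_compat; [exact Hlb|exact He]. }
    pose (r := (Cmod z + M + N)%R).
    assert (Hr : 0 < r) by (unfold r; pose proof (Cmod_ge_0 z); lra).
    pose proof two_pi_i_neq_0 as H2. pose proof PI_RGT_0.
    assert (E : h z = circle_integral z r (fun y => h y / (y - z)) / two_pi_i).
    { rewrite cauchy_circle; [field; exact H2|exact Hr|auto|].
      rewrite Cmod_sub_diag. exact Hr. }
    assert (big : forall y, Cmod (y - z) = r -> M + N <= Cmod y).
    { intros y Hy. pose proof (Cmod_le_add (y - z) y) as H1.
      replace (y - z - y) with (- z) in H1 by ring. rewrite Cmod_opp in H1. unfold r in Hy. lra. }
    assert (small : forall y, Cmod (y - z) = r -> Cmod (h y) <= e).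
    { intros y Hy. specialize (big y Hy). eapply Rle_trans; [apply hbig; lra|].
      apply Rle_trans with (len * (BT / N))%R.
      - apply Rmult_le_compat_l; [exact Hl|]. apply Rmult_le_compat_l; [exact HBT0|].
        apply Rinv_le_contravar; lra.
      - apply Rmult_le_reg_r with N; [lra|].
        replace (len * (BT / N) * N)%R with (len * BT)%R by (field; lra).
        unfold N. replace (e * (len * BT / e + 1))%R with (len * BT + e)%R by (field; lra). lra. }
    rewrite E, Cmod_div, Cmod_two_pi_i by exact H2.
    assert (Cmod (circle_integral z r (fun y => h y / (y - z))) <= 2 * PI * r * (e / r)).
    { apply circle_integral_le; [lra| | |].
      - left. apply Rdiv_lt_0_compat; assumption.
      - intros y Hy. assert (y - z <> 0) by (apply Cmod_gt_0; lra). ccont.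
        apply Cdiffable_Ccont, hD.
      - intros y Hy. apply Cmod_div_le; [auto|exact Hr|lra]. }
    apply Rmult_le_reg_r with (2 * PI)%R; [lra|].
    unfold Rdiv at 1. rewrite Rmult_assoc, Rinv_l, Rmult_1_r by lra.
    eapply Rle_trans; [eassumption|]. right. field. lra. }
  intros w Hw HTw. apply Ceq_minus. rewrite <- hU' by assumption. apply hz.
Qed.

(** * Divided differences *)

Fixpoint lprod (l : list C) (y : C) : C :=
  match l with nil => 1 | p :: l' => (y - p) * lprod l' y end.

(** [dd f (z_0 :: ... :: z_k) x] is the divided difference [f[z_0, ..., z_k, x]]. *)
Fixpoint dd (f : C -> C) (l : list C) : C -> C :=
  match l with nil => f | p :: l' => dd (dq f p) l' end.

Lemma lprod_app l l' y : lprod (l ++ l') y = lprod l y * lprod l' y.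
Proof. induction l as [|p l IH]; simpl; [ring|rewrite IH; ring]. Qed.

Lemma lprod_neq_0 l y : (forall p, In p l -> y <> p) -> lprod l y <> 0.
Proof.
  induction l as [|p l IH]; simpl; intros H.
  - apply C1_nz.
  - apply Cmult_neq_0; [apply Csub_neq_0; auto|apply IH; auto].
Qed.

Lemma Cdiffable_lprod l y : Cdiffable (lprod l) y.
Proof.
  induction l as [|p l [m IH]]; simpl.
  - exists 0. apply Cder_const.
  - eexists. apply Cder_mult; [apply Cder_sub_const|exact IH].
Qed.

Lemma Cder_inv_pow (p y : C) (k : nat) : y - p <> 0 ->
  Cder (fun y => (/ (y - p)) ^ k) y (- RtoC (INR k) * (/ (y - p)) ^ S k).
Proof.
  intros Hy. induction k as [|k IH].
  - simpl. eapply Cder_eq; [apply Cder_const|]. ring.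
  - eapply Cder_eq.
    + apply (Cder_mult (fun y => / (y - p)) (fun y => (/ (y - p)) ^ k)); [|exact IH].
      apply Cder_inv_sub. exact Hy.
    + rewrite S_INR, RtoC_plus. simpl. field. exact Hy.
Qed.

Lemma Ccont_inv_lprod l y : (forall p, In p l -> y <> p) -> Ccont (fun y => / lprod l y) y.
Proof.
  intros H. apply Ccont_inv; [apply Cdiffable_Ccont, Cdiffable_lprod|apply lprod_neq_0; exact H].
Qed.

(** Two distinct points are separated by partial fractions; if all points agree,
    the integrand has a primitive. *)
Lemma integral_inv_lprod T L len : closed_functional T L len ->
  forall n l, length l = S n -> (forall p, In p l -> ~ T p /\ index L p = two_pi_i) ->
  L (fun y => / lprod l y) = match n with O => two_pi_i | S _ => 0 end.
Proof.
  intros PF. induction n as [|m IH]; intros l Hlen Hl.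
  - destruct l as [|p [|q l]]; try discriminate.
    destruct (Hl p (or_introl eq_refl)) as [_ Hp]. rewrite <- Hp. unfold index. f_equal.
    apply functional_extensionality. intros y. simpl. rewrite Cmult_1_r. reflexivity.
  - destruct l as [|p l]; [discriminate|]. injection Hlen as Hlen.
    assert (off : forall y, T y -> forall q, In q (p :: l) -> y <> q).
    { intros y Hy q Hq E. subst. destruct (Hl q Hq). tauto. }
    destruct (classic (exists q, In q l /\ q <> p)) as [[q [Hq Hqp]]|Hno].
    + destruct (in_split q l Hq) as [l1 [l2 El]]. subst l.
      assert (Hpq : p - q <> 0) by (apply Csub_neq_0; auto).
      assert (Hlen' : length (l1 ++ l2) = m) by (rewrite length_app in *; simpl in Hlen; lia).
      assert (I1 := IH (p :: l1 ++ l2) (f_equal S Hlen')).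
      assert (I2 := IH (q :: l1 ++ l2) (f_equal S Hlen')).
      assert (sub : forall q0, In q0 (l1 ++ l2) -> In q0 (p :: l1 ++ q :: l2)).
      { intros q0 H. apply in_app_or in H. right. apply in_or_app. simpl. tauto. }
      assert (sub1 : forall q0, In q0 (p :: l1 ++ l2) -> In q0 (p :: l1 ++ q :: l2)).
      { intros q0 [H|H]; [left; exact H|apply sub, H]. }
      assert (sub2 : forall q0, In q0 (q :: l1 ++ l2) -> In q0 (p :: l1 ++ q :: l2)).
      { intros q0 [H|H]; [subst; right; exact Hq|apply sub, H]. }
      assert (C1 : forall y, T y -> Ccont (fun y => / lprod (p :: l1 ++ l2) y) y).
      { intros y Hy. apply Ccont_inv_lprod. intros q0 Hq0. apply (off y Hy). auto. }
      assert (C2 : forall y, T y -> Ccont (fun y => / lprod (q :: l1 ++ l2) y) y).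
      { intros y Hy. apply Ccont_inv_lprod. intros q0 Hq0. apply (off y Hy). auto. }
      transitivity (/ (p - q) * (L (fun y => / lprod (p :: l1 ++ l2) y) - L (fun y => / lprod (q :: l1 ++ l2) y))).
      * rewrite <- (pf_minus PF C1 C2), <- (pf_scal PF).
        -- apply (pf_ext PF).
           ++ intros y Hy. apply Ccont_inv_lprod. apply off, Hy.
           ++ intros y Hy. apply Ccont_mult; [apply Ccont_const|]. apply Ccont_minus; auto.
           ++ intros y Hy. specialize (off y Hy).
              assert (N1 : y - p <> 0) by (apply Csub_neq_0, off; left; reflexivity).
              assert (N2 : y - q <> 0) by (apply Csub_neq_0, off; right; exact Hq).
              assert (N3 : lprod (l1 ++ l2) y <> 0) by (apply lprod_neq_0; auto).
              assert (E : lprod (l1 ++ q :: l2) y = (y - q) * lprod (l1 ++ l2) y)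
                by (rewrite !lprod_app; simpl; ring).
              simpl. rewrite E. field. auto.
        -- intros y Hy. apply Ccont_minus; auto.
      * rewrite I1, I2 by auto. ring.
    + assert (Hall : forall q, In q l -> q = p).
      { intros q Hq. apply NNPP. intros E. apply Hno. exists q. auto. }
      assert (E : forall y, lprod (p :: l) y = (y - p) ^ S (S m)).
      { intros y. change (lprod (p :: l) y) with ((y - p) * lprod l y).
        change ((y - p) ^ S (S m)) with ((y - p) * (y - p) ^ S m). f_equal. rewrite <- Hlen.
        clear -Hall. induction l as [|q l IH]; [reflexivity|].
        simpl. rewrite (Hall q) by (left; reflexivity). f_equal. apply IH. intros; apply Hall; right; assumption. }
      assert (N : forall y, T y -> y - p <> 0).
      { intros y Hy. apply Csub_neq_0, (off y Hy). left. reflexivity. }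
      apply (pf_exact PF (fun y => - / RtoC (INR (S m)) * (/ (y - p)) ^ S m)).
      * intros y Hy. apply Ccont_inv_lprod. apply off, Hy.
      * intros y Hy. specialize (N y Hy). eapply Cder_eq.
        -- apply Cder_scal, Cder_inv_pow. exact N.
        -- rewrite E. rewrite Cpow_inv by exact N.
           assert (Hm : RtoC (INR (S m)) <> 0).
           { intros H. apply RtoC_inj in H. pose proof (lt_0_INR (S m) ltac:(lia)). lra. }
           field. split; [apply Cpow_nz; exact N|exact Hm].
Qed.

Lemma divided_difference_integral T L len (U : C -> Prop) : closed_functional T L len ->
  open (T := C_UniformSpace) U -> (forall y, T y -> U y) -> (forall w, ~ U w -> index L w = 0) ->
  forall l f x, (forall y, U y -> Cdiffable f y) ->
  (forall p, In p (x :: l) -> U p /\ ~ T p /\ index L p = two_pi_i) ->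
  L (fun y => f y / (lprod l y * (y - x))) = two_pi_i * dd f l x.
Proof.
  intros PF HU HTU Hind. induction l as [|p l IH]; intros f x Hf Hl.
  - destruct (Hl x (or_introl eq_refl)) as [H1 [H2 H3]]. simpl. rewrite <- H3.
    rewrite <- (cauchy_formula_homology T L len U f PF HU HTU Hf Hind x H1 H2).
    f_equal. apply functional_extensionality. intros y. rewrite Cmult_1_l. reflexivity.
  - assert (off : forall y, T y -> forall q, In q (x :: p :: l) -> y <> q).
    { intros y Hy q Hq E. subst. destruct (Hl q Hq) as [_ [H _]]. tauto. }
    assert (Hdq : forall y, U y -> Cdiffable (dq f p) y).
    { intros y Hy. apply Cdiffable_dq. destruct (open_ball_Cmod U y HU Hy) as [r [Hr H]].
      exists r. auto. }
    assert (Hf' : forall y, T y -> Ccont f y) by (intros; apply Cdiffable_Ccont; auto).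
    assert (Hdq' : forall y, T y -> Ccont (dq f p) y) by (intros; apply Cdiffable_Ccont; auto).
    assert (Nx : forall y, T y -> y - x <> 0).
    { intros y Hy. apply Csub_neq_0, (off y Hy). left. reflexivity. }
    assert (Np : forall y, T y -> y - p <> 0).
    { intros y Hy. apply Csub_neq_0, (off y Hy). right. left. reflexivity. }
    assert (Nl : forall y, T y -> lprod l y <> 0).
    { intros y Hy. apply lprod_neq_0. intros q Hq. apply (off y Hy). right. right. exact Hq. }
    assert (Cl : forall y, Ccont (lprod l) y) by (intros; apply Cdiffable_Ccont, Cdiffable_lprod).
    transitivity (f p * L (fun y => / lprod (x :: p :: l) y) + 1 * L (fun y => dq f p y / (lprod l y * (y - x)))).
    + rewrite <- (pf_lin PF).
      * apply (pf_ext PF).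
        -- intros y Hy. simpl. specialize (Nx y Hy). specialize (Np y Hy). specialize (Nl y Hy).
           specialize (Hf' y Hy). specialize (Cl y). ccont. repeat apply Cmult_neq_0; assumption.
        -- intros y Hy. simpl. specialize (Nx y Hy). specialize (Np y Hy). specialize (Nl y Hy).
           specialize (Hdq' y Hy). specialize (Cl y). ccont; repeat apply Cmult_neq_0; assumption.
        -- intros y Hy. simpl. specialize (Nx y Hy). specialize (Np y Hy). specialize (Nl y Hy).
           rewrite (dq_spec f p y) at 1. field. auto.
      * intros y Hy. apply Ccont_inv_lprod, off, Hy.
      * intros y Hy. specialize (Nx y Hy). specialize (Nl y Hy).
        specialize (Hdq' y Hy). specialize (Cl y). ccont; repeat apply Cmult_neq_0; assumption.
    + rewrite (integral_inv_lprod T L len PF (S (length l))); [|reflexivity|].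
      * rewrite IH; [simpl; ring|exact Hdq|]. intros q Hq. apply Hl. simpl in *. tauto.
      * intros q Hq. apply Hl, Hq.
Qed.

Lemma dd_app f l p y : dd f (l ++ p :: nil) y = dq (dd f l) p y.
Proof. revert f. induction l as [|q l IH]; intros f; simpl; [reflexivity|apply IH]. Qed.

Lemma newton_formula f (p : nat -> C) (x : C) (n : nat) :
  f x = sum_n (G := C_AbelianGroup) (fun k => dd f (map p (seq 0 k)) (p k) * Cprod (fun j => x - p j) k) n
        + dd f (map p (seq 0 (S n))) x * Cprod (fun j => x - p j) (S n).
Proof.
  assert (step : forall k, dd f (map p (seq 0 k)) x =
    dd f (map p (seq 0 k)) (p k) + (x - p k) * dd f (map p (seq 0 (S k))) x).
  { intros k. rewrite seq_S, map_app. simpl (map p (_ :: _)). rewrite dd_app. apply dq_spec. }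
  induction n as [|n IH].
  - rewrite sum_O. rewrite <- (Cmult_1_r (f x)). change (f x) with (dd f (map p (seq 0 0)) x).
    rewrite step. simpl. ring.
  - rewrite sum_Sn. rewrite IH at 1. rewrite (step (S n)).
    change (plus ?a ?b) with (a + b). simpl Cprod. ring.
Qed.

Lemma lprod_Cprod (p : nat -> C) (n : nat) (y : C) :
  lprod (map p (seq 0 n)) y = Cprod (fun j => y - p j) n.
Proof.
  induction n as [|n IH]; [reflexivity|].
  rewrite seq_S, map_app, lprod_app, IH. simpl. ring.
Qed.

(** * Cycles and P-sequences *)

Lemma path_derive_ext_interval (g h : R -> C) (u v t : R) :
  (forall t, u <= t <= v -> g t = h t) -> u < t < v -> path_derive g t = path_derive h t.
Proof.
  intros H Ht. unfold path_derive.
  assert (L : locally t (fun s : R => g s = h s)).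
  { assert (Hd : 0 < Rmin (t - u) (v - t)) by (apply Rmin_glb_lt; lra).
    exists (mkposreal _ Hd). intros s Hs. apply H.
    assert (Hs' : Rabs (s - t) < Rmin (t - u) (v - t)) by exact Hs.
    apply Rabs_def2 in Hs'. pose proof (Rmin_l (t - u) (v - t)). pose proof (Rmin_r (t - u) (v - t)). lra. }
  f_equal; apply Derive_ext_loc; revert L; apply filter_imp; intros s E; rewrite E; reflexivity.
Qed.

Lemma path_functional_piecewise (g : R -> C) : piecewise_C1 g ->
  exists len, path_functional (fun y => exists t, 0 <= t <= 1 /\ g t = y) (path_integral g) len
    (fun P => P (g 1%R) - P (g 0%R)).
Proof.
  intros [n [s [H0 [H1 Hs]]]].
  assert (W : forall i, (i <= n)%nat -> 0 <= s i /\ exists len,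
    path_functional (fun y => exists t, 0 <= t <= s i /\ g t = y)
      (fun F => CRInt (fun t => F (g t) * path_derive g t) 0 (s i)) len (fun P => P (g (s i)) - P (g 0%R)) /\
    forall F, (forall y, (exists t, 0 <= t <= s i /\ g t = y) -> Ccont F y) ->
      ex_CRInt (fun t => F (g t) * path_derive g t) 0 (s i)).
  { induction i as [|i IH]; intros Hi.
    - rewrite H0. split; [lra|]. exists 0%R. split.
      + eapply path_functional_ext.
        * apply (path_functional_arc (fun _ => g 0%R) (fun _ => RtoC 0) 0 0 0); [lra|..].
          -- intros t _. apply (is_derive_const (K := R_AbsRing) (V := C_R_NormedModule)).
          -- intros; apply RCcont_const.
          -- intros. rewrite Cmod_0. lra.
        * intros y. split; intros [t [Ht E]]; exists t; (split; [exact Ht|]);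
            replace t with 0%R in * by lra; exact E.
        * intros F _. rewrite !(RInt_point (V := C_R_CompleteNormedModule)). reflexivity.
        * ring.
        * reflexivity.
      + intros F _. apply (ex_RInt_point (V := C_R_NormedModule)).
    - destruct (IH ltac:(lia)) as [Hsi [len [PF Hex]]].
      destruct (Hs i ltac:(lia)) as [Hlt [h [Hgh Hh]]].
      split; [lra|].
      assert (Hd : forall t, RCderive h t (path_derive h t)).
      { intros t. destruct (Hh t) as [[l Hl] _]. rewrite (RCderive_path_derive h t l Hl). exact Hl. }
      destruct (RCcont_bounded (path_derive h) (s i) (s (S i))) as [m [Hm0 Hm]]; [lra|intros; apply Hh|].
      assert (PFh := path_functional_arc h (path_derive h) (s i) (s (S i)) m
        ltac:(lra) (fun t _ => Hd t) (fun t _ => proj2 (Hh t)) Hm).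
      assert (Hin : forall F t, Rmin (s i) (s (S i)) < t < Rmax (s i) (s (S i)) ->
        F (h t) * path_derive h t = F (g t) * path_derive g t).
      { intros F t. rewrite Rmin_left, Rmax_right by lra. intros Ht.
        rewrite (path_derive_ext_interval g h (s i) (s (S i)) t Hgh Ht), Hgh by lra. reflexivity. }
      assert (Hexh : forall F, (forall y, (exists t, s i <= t <= s (S i) /\ h t = y) -> Ccont F y) ->
        ex_CRInt (fun t => F (g t) * path_derive g t) (s i) (s (S i))).
      { intros F HF. apply (ex_RInt_ext (V := C_R_NormedModule)) with (fun t => F (h t) * path_derive h t).
        - apply Hin.
        - apply ex_CRInt_cont; [lra|]. intros t Ht. apply RCcont_mult; [|apply Hh].
          apply RCcont_comp; [eapply RCderive_RCcont, Hd|]. apply HF. exists t. auto. }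
      assert (Tr : forall y, (exists t, 0 <= t <= s i /\ g t = y) \/ (exists t, s i <= t <= s (S i) /\ h t = y)
         <-> exists t, 0 <= t <= s (S i) /\ g t = y).
      { intros y. split.
        - intros [[t [Ht E]]|[t [Ht E]]]; exists t; (split; [lra|]); [exact E|]. rewrite Hgh by lra. exact E.
        - intros [t [Ht E]]. destruct (Rle_or_lt t (s i)) as [H|H].
          + left. exists t. split; [lra|exact E].
          + right. exists t. split; [lra|]. rewrite <- Hgh by lra. exact E. }
      eexists. split.
      + eapply path_functional_ext.
        * exact (path_functional_lincomb 1 1 _ _ _ _ _ _ _ _ PF PFh).
        * exact Tr.
        * intros F HF. cbv beta. rewrite (CRInt_Chasles _ 0 (s i) (s (S i))).
          -- rewrite (RInt_ext (V := C_R_CompleteNormedModule) (fun t => F (h t) * path_derive h t)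
               (fun t => F (g t) * path_derive g t) (s i) (s (S i)) (Hin F)). cring.
          -- apply Hex. auto.
          -- apply Hexh. auto.
        * reflexivity.
        * intros P. cbv beta. rewrite <- !Hgh by lra. ring.
      + intros F HF. apply (ex_RInt_Chasles (V := C_R_NormedModule)) with (s i).
        * apply Hex. intros y Hy. apply HF, Tr. left. exact Hy.
        * apply Hexh. intros y Hy. apply HF, Tr. right. exact Hy. }
  destruct (W n (le_n n)) as [_ [len [PF _]]]. rewrite H1 in PF. exists len. exact PF.
Qed.

Lemma closed_functional_chain (U : C -> Prop) (G : chain) : cycle_in U G ->
  exists len, closed_functional (on_chain G) (chain_integral G) len.
Proof.
  induction G as [|[k g] G IH]; intros H.
  - exists 0%R. eapply path_functional_ext; [apply path_functional_zero|..]; try reflexivity.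
    intros y. split; [tauto|]. unfold on_chain. intros Hy. inversion Hy.
  - apply Forall_cons_iff in H. destruct H as [[Hg [Hc _]] HG]. simpl in Hg, Hc.
    destruct (IH HG) as [l1 PF1]. destruct (path_functional_piecewise g Hg) as [l2 PF2].
    eexists. eapply path_functional_ext.
    + exact (path_functional_lincomb (RtoC (IZR k)) 1 _ _ _ _ _ _ _ _ PF2 PF1).
    + intros y. unfold on_chain. rewrite Exists_cons. simpl. reflexivity.
    + intros F _. simpl. ring.
    + reflexivity.
    + intros P. cbv beta. rewrite Hc. ring.
Qed.

Lemma on_chain_in (U : C -> Prop) (G : chain) (y : C) : cycle_in U G -> on_chain G y -> U y.
Proof.
  intros H Hy. unfold on_chain in Hy. rewrite Exists_exists in Hy.
  destruct Hy as [p [Hp [t [Ht E]]]]. unfold cycle_in in H. rewrite Forall_forall in H.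
  destruct (H p Hp) as [_ [_ H1]]. rewrite <- E. auto.
Qed.

Lemma winding_index (G : chain) (w : C) : winding G w = / two_pi_i * index (chain_integral G) w.
Proof. reflexivity. Qed.

Lemma index_of_winding (G : chain) (w v : C) : winding G w = v -> index (chain_integral G) w = two_pi_i * v.
Proof. intros <-. rewrite winding_index. field. apply two_pi_i_neq_0. Qed.

Definition circle_chain (c : C) (r : R) : chain := (1%Z, circle_point c r) :: nil.

Lemma chain_integral_circle (c : C) (r : R) (F : C -> C) :
  chain_integral (circle_chain c r) F = circle_integral c r F.
Proof.
  unfold chain_integral, circle_chain. simpl. unfold path_integral, circle_arc_integral.
  rewrite Rplus_0_l.
  replace (path_derive (circle_point c r)) with (circle_speed r).
  - cring.
  - apply functional_extensionality. intros t. symmetry. apply RCderive_path_derive, RCderive_circle_point.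
Qed.

Lemma on_chain_circle (c : C) (r : R) (y : C) : 0 <= r -> on_chain (circle_chain c r) y -> Cmod (y - c) = r.
Proof.
  intros Hr H. apply Exists_cons in H. destruct H as [[t [_ E]]|H]; [|inversion H].
  apply (circle_arc_trace_dist c r t t); [exact Hr|]. exists t. split; [lra|exact E].
Qed.

Lemma piecewise_C1_circle (c : C) (r : R) : piecewise_C1 (circle_point c r).
Proof.
  exists 1%nat, (fun i => INR i). simpl. repeat split.
  - replace i with 0%nat by lia. simpl. lra.
  - exists (circle_point c r). split; [reflexivity|]. intros t. split.
    + exists (circle_speed r t). apply RCderive_circle_point.
    + apply (continuous_ext (circle_speed r)); [|apply RCcont_circle_speed].
      intros s. symmetry. apply RCderive_path_derive, RCderive_circle_point.
Qed.

Lemma circle_chain_cycle (U : C -> Prop) (c : C) (r : R) : 0 <= r ->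
  (forall y, Cmod (y - c) = r -> U y) -> cycle_in U (circle_chain c r).
Proof.
  intros Hr HU. repeat constructor; simpl.
  - apply piecewise_C1_circle.
  - rewrite <- (circle_point_period c r 0). f_equal. ring.
  - intros t _. apply HU. apply (circle_arc_trace_dist c r t t); [exact Hr|]. exists t. split; [lra|reflexivity].
Qed.

Lemma winding_circle (c : C) (r : R) (w : C) : 0 < r -> Cmod (w - c) < r -> winding (circle_chain c r) w = 1.
Proof.
  intros Hr Hw. rewrite winding_index. unfold index.
  rewrite chain_integral_circle. fold (index (circle_integral c r) w).
  rewrite index_circle by assumption. field. apply two_pi_i_neq_0.
Qed.

Lemma P_sequence_recurrence a b c x : P_sequence (polyP a b c) x ->
  forall k, x (k + 1)%Z + x (k - 1)%Z = 2 * a * x k + 2 * b.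
Proof.
  intros H k. pose proof (H k 0) as H0. pose proof (H k 1) as H1. unfold polyP in H0, H1.
  assert (E : (1 - x (k + 1)%Z) * (1 - x (k - 1)%Z) - (0 - x (k + 1)%Z) * (0 - x (k - 1)%Z) =
     1 - (x (k + 1)%Z + x (k - 1)%Z)) by ring.
  rewrite <- H0, <- H1 in E.
  apply Ceq_minus. transitivity (1 - (2 * a * x k + 2 * b) - (1 - (x (k + 1)%Z + x (k - 1)%Z))); [ring|].
  rewrite <- E. ring.
Qed.

Lemma second_order_recurrence_unique (a b : C) (u v : Z -> C) :
  (forall k, u (k + 1)%Z + u (k - 1)%Z = a * u k + b) ->
  (forall k, v (k + 1)%Z + v (k - 1)%Z = a * v k + b) ->
  u 0%Z = v 0%Z -> u 1%Z = v 1%Z -> forall k, u k = v k.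
Proof.
  intros Hu Hv H0 H1.
  assert (up : forall k, u k = v k -> u (k - 1)%Z = v (k - 1)%Z -> u (k + 1)%Z = v (k + 1)%Z).
  { intros k E1 E2. replace (u (k + 1)%Z) with (u (k + 1)%Z + u (k - 1)%Z - u (k - 1)%Z) by ring.
    rewrite Hu, E1, E2, <- Hv. ring. }
  assert (down : forall k, u k = v k -> u (k + 1)%Z = v (k + 1)%Z -> u (k - 1)%Z = v (k - 1)%Z).
  { intros k E1 E2. replace (u (k - 1)%Z) with (u (k + 1)%Z + u (k - 1)%Z - u (k + 1)%Z) by ring.
    rewrite Hu, E1, E2, <- Hv. ring. }
  assert (W : forall n : nat, u (Z.of_nat n) = v (Z.of_nat n) /\ u (Z.of_nat n + 1)%Z = v (Z.of_nat n + 1)%Z /\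
    u (- Z.of_nat n)%Z = v (- Z.of_nat n)%Z /\ u (- Z.of_nat n + 1)%Z = v (- Z.of_nat n + 1)%Z).
  { induction n as [|n [I1 [I2 [I3 I4]]]]; [simpl; auto|].
    rewrite Nat2Z.inj_succ. unfold Z.succ.
    replace (- (Z.of_nat n + 1))%Z with (- Z.of_nat n - 1)%Z by lia.
    replace (- Z.of_nat n - 1 + 1)%Z with (- Z.of_nat n)%Z by lia.
    repeat split; auto.
    apply up; [exact I2|]. replace (Z.of_nat n + 1 - 1)%Z with (Z.of_nat n) by lia. exact I1. }
  intros k. destruct (Z.le_ge_cases 0 k) as [H|H].
  - destruct (W (Z.to_nat k)) as [E _]. rewrite Z2Nat.id in E by exact H. exact E.
  - destruct (W (Z.to_nat (- k))) as [_ [_ [E _]]]. rewrite Z2Nat.id in E by lia.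
    rewrite Z.opp_involutive in E. exact E.
Qed.

Lemma P_sequence_unique a b c z x k : P_sequence (polyP a b c) z -> P_sequence (polyP a b c) x ->
  x 0%Z = z k -> (forall j, x j = z (k + j)%Z) \/ (forall j, x j = z (k - j)%Z).
Proof.
  intros Hz Hx E0.
  assert (Hroot : (x 1%Z - z (k + 1)%Z) * (x 1%Z - z (k - 1)%Z) = 0).
  { rewrite <- Hz, <- E0, (Hx 0%Z). simpl. ring. }
  pose proof (P_sequence_recurrence _ _ _ _ Hz) as Rz. pose proof (P_sequence_recurrence _ _ _ _ Hx) as Rx.
  destruct (Ceq_dec (x 1%Z) (z (k + 1)%Z)) as [E|N].
  - left. apply (second_order_recurrence_unique (2 * a) (2 * b)); [exact Rx| | |exact E].
    + intros j. rewrite <- Rz. f_equal; f_equal; lia.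
    + rewrite Z.add_0_r. exact E0.
  - right. apply (second_order_recurrence_unique (2 * a) (2 * b)); [exact Rx| | |].
    + intros j. rewrite <- Rz, Cplus_comm. f_equal; f_equal; lia.
    + rewrite Z.sub_0_r. exact E0.
    + apply Ceq_minus. apply NNPP. intros N'. apply (Cmult_neq_0 _ _ (Csub_neq_0 _ _ N) N'). exact Hroot.
Qed.

Lemma P_sequence_shift P z k : P_sequence P z -> P_sequence P (fun j => z (k + j)%Z).
Proof.
  intros H j y. rewrite (H (k + j)%Z).
  replace (k + j + 1)%Z with (k + (j + 1))%Z by lia.
  replace (k + j - 1)%Z with (k + (j - 1))%Z by lia. reflexivity.
Qed.

Lemma Cprod_ext u v n : (forall j, (j < n)%nat -> u j = v j) -> Cprod u n = Cprod v n.
Proof. induction n as [|n IH]; intros H; simpl; [reflexivity|]. rewrite IH, H by auto. reflexivity. Qed.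

Lemma Cprod_shift u n : Cprod u (S n) = u 0%nat * Cprod (fun j => u (S j)) n.
Proof.
  induction n as [|n IH]; [simpl; ring|].
  change (Cprod u (S (S n))) with (Cprod u (S n) * u (S n)). rewrite IH. simpl. ring.
Qed.

Lemma Cprod_rev u n : Cprod (fun j => u (n - j)%nat) (S n) = Cprod u (S n).
Proof.
  induction n as [|n IH]; [reflexivity|].
  rewrite Cprod_shift. rewrite <- (Cprod_ext (fun j => u (n - j)%nat)) by (intros; f_equal; lia).
  rewrite IH. replace (S n - 0)%nat with (S n) by lia. simpl. ring.
Qed.

Lemma negative_bounds (p : nat -> C) : (forall j, exists r, r < 0 /\ p j = RtoC r) ->
  forall k, exists d A, 0 < d /\ d <= A /\
    forall j, (j <= k)%nat -> exists r, p j = RtoC r /\ - A <= r <= - d.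
Proof.
  intros Hp. induction k as [|k [d [A [Hd [HA H]]]]].
  - destruct (Hp 0%nat) as [r [Hr E]]. exists (- r)%R, (- r)%R. repeat split; try lra.
    intros j Hj. replace j with 0%nat by lia. exists r. split; [exact E|lra].
  - destruct (Hp (S k)) as [r [Hr E]].
    exists (Rmin d (- r)), (Rmax A (- r)).
    pose proof (Rmin_l d (- r)). pose proof (Rmin_r d (- r)).
    pose proof (Rmax_l A (- r)). pose proof (Rmax_r A (- r)).
    split; [apply Rmin_glb_lt; lra|]. split; [lra|].
    intros j Hj. destruct (Nat.eq_dec j (S k)) as [->|Hne].
    + exists r. split; [exact E|lra].
    + destruct (H j ltac:(lia)) as [r' [E' Hr']]. exists r'. split; [exact E'|lra].
Qed.

Lemma partial_divided_difference (a b c : C) (z : Z -> C) (U : C -> Prop) (f : C -> C) (k : nat)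
    (hz : P_sequence (polyP a b c) z)
    (hneg : forall k : nat, exists r : R, r < 0 /\ z (2 * Z.of_nat k)%Z = RtoC r)
    (hU : open (T := C_UniformSpace) U)
    (hOmega : forall w : C, Re w <= 0 -> U w)
    (hf : forall w, U w -> Cdiffable f w) :
  let p := fun j : nat => z (2 * Z.of_nat j)%Z in
  partial (polyP a b c) U k f (z (Z.of_nat k)) = dd f (map p (seq 0 k)) (p k).
Proof.
  intros p. pose proof two_pi_i_neq_0 as H2.
  assert (node : forall q, In q (p k :: map p (seq 0 k)) -> exists j, (j <= k)%nat /\ q = p j).
  { intros q [E|Hq]; [exists k; auto|]. apply in_map_iff in Hq. destruct Hq as [j [E Hj]].
    apply in_seq in Hj. exists j. split; [lia|auto]. }
  assert (EP : forall y, lprod (map p (seq 0 k)) y * (y - p k) = Cprod (fun j => y - p j) (S k)).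
  { intros y. rewrite lprod_Cprod. reflexivity. }
  assert (Points : forall x, P_sequence (polyP a b c) x -> x 0%Z = z (Z.of_nat k) ->
    (forall y, Phi x (S k) y = Cprod (fun j => y - p j) (S k)) /\
    (forall j, (j <= k)%nat -> exists i, (i <= k)%nat /\ p j = x (2 * Z.of_nat i - Z.of_nat k)%Z) /\
    (forall j, (j <= k)%nat -> exists i, (i <= k)%nat /\ x (2 * Z.of_nat j - Z.of_nat k)%Z = p i)).
  { intros x Hx E0. destruct (P_sequence_unique a b c z x (Z.of_nat k) hz Hx E0) as [E|E].
    - split; [|split].
      + intros y. apply Cprod_ext. intros j Hj. rewrite E. unfold p. apply (f_equal (fun i => y - z i)). lia.
      + intros j Hj. exists j. split; [exact Hj|]. rewrite E. unfold p. apply (f_equal z). lia.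
      + intros j Hj. exists j. split; [exact Hj|]. rewrite E. unfold p. apply (f_equal z). lia.
    - split; [|split].
      + intros y. rewrite <- (Cprod_rev (fun j => y - p j) k).
        apply Cprod_ext. intros j Hj. rewrite E. unfold p. apply (f_equal (fun i => y - z i)). lia.
      + intros j Hj. exists (k - j)%nat. split; [lia|]. rewrite E. unfold p. apply (f_equal z). lia.
      + intros j Hj. exists (k - j)%nat. split; [lia|]. rewrite E. unfold p. apply (f_equal z). lia. }
  assert (Value : forall x G, P_sequence (polyP a b c) x -> x 0%Z = z (Z.of_nat k) ->
     cycle_in U G -> homologous_to_zero U G ->
     (forall j : nat, (j <= k)%nat -> let w := x (2 * Z.of_nat j - Z.of_nat k)%Z in
       U w /\ ~ on_chain G w /\ winding G w = 1) ->
     / two_pi_i * chain_integral G (fun y => f y / Phi x (S k) y) = dd f (map p (seq 0 k)) (p k)).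
  { intros x G Hx E0 HG HG0 Hw.
    destruct (Points x Hx E0) as [EPhi [Hpts _]].
    destruct (closed_functional_chain U G HG) as [len PF].
    assert (D := divided_difference_integral _ _ _ U PF hU (fun y => on_chain_in U G y HG)).
    replace (fun y => f y / Phi x (S k) y) with (fun y => f y / (lprod (map p (seq 0 k)) y * (y - p k)))
      by (apply functional_extensionality; intros y; rewrite EP, EPhi; reflexivity).
    rewrite D; [field; exact H2| |exact hf|].
    - intros w Hw0. rewrite (index_of_winding G w 0 (HG0 w Hw0)). ring.
    - intros q Hq. destruct (node q Hq) as [j [Hj ->]]. destruct (Hpts j Hj) as [i [Hi ->]].
      destruct (Hw i Hi) as [W1 [W2 W3]]. split; [exact W1|]. split; [exact W2|].
      rewrite (index_of_winding G _ 1 W3). ring. }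
  unfold partial. apply (iota_unique (V := C_CompleteNormedModule)).
  - intros v [x [G [Hx [E0 [HG [HG0 [Hw Ev]]]]]]]. rewrite Ev. apply Value; assumption.
  - destruct (negative_bounds p hneg k) as [d [A [Hd [HA Hp]]]].
    pose (r := (A - d / 2)%R). assert (Hr : 0 < r) by (unfold r; lra).
    assert (left_half : forall y, Cmod (y - RtoC (- A)) = r -> Re y < 0).
    { intros y Hy. pose proof (re_le_Cmod (y - RtoC (- A))) as H. rewrite Re_minus in H.
      simpl (Re (RtoC (- A))) in H. apply Rabs_le_between in H. unfold r in *. lra. }
    assert (inside : forall j, (j <= k)%nat -> Cmod (p j - RtoC (- A)) < r /\ Re (p j) < 0).
    { intros j Hj. destruct (Hp j Hj) as [s [-> Hs]]. rewrite <- RtoC_minus, Cmod_R.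
      split; [apply Rabs_def1; unfold r; lra|simpl; lra]. }
    pose (x := fun j => z (Z.of_nat k + j)%Z).
    assert (Hx : P_sequence (polyP a b c) x) by (apply P_sequence_shift; exact hz).
    assert (E0 : x 0%Z = z (Z.of_nat k)) by (unfold x; f_equal; lia).
    assert (HG : cycle_in U (circle_chain (RtoC (- A)) r)).
    { apply circle_chain_cycle; [lra|]. intros y Hy. apply hOmega. left. auto. }
    assert (HG0 : homologous_to_zero U (circle_chain (RtoC (- A)) r)).
    { intros w Hw. destruct (closed_functional_chain U _ HG) as [len PF].
      rewrite winding_index, (index_ray _ _ _ w 1 PF); [ring|apply C1_nz|].
      intros t Ht HT. apply on_chain_circle in HT; [|lra]. apply left_half in HT.
      apply Hw, hOmega. rewrite Cmult_1_r in HT. change (Re (w + RtoC t)) with (Re w + t)%R in HT. lra. }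
    assert (HW : forall j : nat, (j <= k)%nat -> let w := x (2 * Z.of_nat j - Z.of_nat k)%Z in
       U w /\ ~ on_chain (circle_chain (RtoC (- A)) r) w /\ winding (circle_chain (RtoC (- A)) r) w = 1).
    { intros j Hj w. destruct (Points x Hx E0) as [_ [_ Hpts]]. destruct (Hpts j Hj) as [i [Hi E]].
      fold w in E. rewrite E. destruct (inside i Hi) as [I1 I2]. split; [apply hOmega; lra|]. split.
      - intros HT. apply on_chain_circle in HT; lra.
      - apply winding_circle; assumption. }
    exists x, (circle_chain (RtoC (- A)) r). repeat (split; [assumption|]).
    symmetry. apply Value; assumption.
Qed.

(** * Half discs *)

Definition axis_integral (R : R) (F : C -> C) : C :=
  CRInt (fun s => F (Ci * RtoC s) * Ci) (- R) R.

Definition axis_trace (R : R) (y : C) : Prop := exists s, - R <= s <= R /\ Ci * RtoC s = y.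

Lemma RCderive_axis (t : R) : RCderive (fun s => Ci * RtoC s) t Ci.
Proof.
  apply RCderive_eps. intros e He. exists 1%R. split; [lra|]. intros s _.
  replace (Ci * RtoC s - Ci * RtoC t - RtoC (s - t) * Ci) with (RtoC 0) by (rewrite RtoC_minus; ring).
  rewrite Cmod_0. apply Rmult_le_pos; [lra|apply Rabs_pos].
Qed.

Lemma path_functional_axis (R : R) : 0 <= R ->
  path_functional (axis_trace R) (axis_integral R) (2 * R) (fun P => P (Ci * RtoC R) - P (Ci * RtoC (- R))).
Proof.
  intros HR. eapply path_functional_ext.
  - apply (path_functional_arc (fun s => Ci * RtoC s) (fun _ => Ci) (- R) R 1); [lra|..].
    + intros; apply RCderive_axis.
    + intros; apply RCcont_const.
    + intros. rewrite Cmod_Ci. lra.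
  - reflexivity.
  - reflexivity.
  - ring.
  - reflexivity.
Qed.

Lemma Cmod_Ci_RtoC (s : R) : Cmod (Ci * RtoC s) = Rabs s.
Proof. rewrite Cmod_mult, Cmod_Ci, Cmod_R. ring. Qed.

Lemma Re_Ci_RtoC (s : R) : Re (Ci * RtoC s) = 0%R.
Proof. simpl. ring. Qed.

Lemma circle_point_quarter (r : R) : circle_point 0 r (1 / 4) = Ci * RtoC r.
Proof.
  unfold circle_point. replace (2 * PI * (1 / 4))%R with (PI / 2)%R by field.
  rewrite cos_PI2, sin_PI2. apply injective_projections; simpl; ring.
Qed.

Lemma circle_point_three_quarters (r : R) : circle_point 0 r (3 / 4) = Ci * RtoC (- r).
Proof.
  unfold circle_point. replace (2 * PI * (3 / 4))%R with (3 * (PI / 2))%R by field.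
  rewrite cos_3PI2, sin_3PI2. apply injective_projections; simpl; ring.
Qed.

Lemma circle_point_minus_quarter (r : R) : circle_point 0 r (- (1 / 4)) = Ci * RtoC (- r).
Proof.
  rewrite <- circle_point_period. replace (- (1 / 4) + 1)%R with (3 / 4)%R by field.
  apply circle_point_three_quarters.
Qed.

Lemma left_arc_Re (r : R) (y : C) : 0 <= r -> circle_arc_trace 0 r (1 / 4) (3 / 4) y -> Re y <= 0.
Proof.
  intros Hr [t [Ht E]]. subst y. pose proof PI_RGT_0 as HP.
  assert (H : cos (2 * PI * t) <= 0) by (apply cos_le_0; nra).
  simpl. nra.
Qed.

Lemma right_arc_Re (r : R) (y : C) : 0 <= r -> circle_arc_trace 0 r (- (1 / 4)) (1 / 4) y -> 0 <= Re y.
Proof.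
  intros Hr [t [Ht E]]. subst y. pose proof PI_RGT_0 as HP.
  assert (H : 0 <= cos (2 * PI * t)) by (apply cos_ge_0; nra).
  simpl. nra.
Qed.

(** Boundary of the half disc [Re y <= 0, |y| <= r], counterclockwise. *)
Definition half_disc_integral (r : R) (F : C -> C) : C :=
  axis_integral r F + circle_arc_integral 0 r (1 / 4) (3 / 4) F.

Definition half_disc_trace (r : R) (y : C) : Prop :=
  axis_trace r y \/ circle_arc_trace 0 r (1 / 4) (3 / 4) y.

Lemma closed_functional_half_disc (r : R) : 0 <= r ->
  exists len, closed_functional (half_disc_trace r) (half_disc_integral r) len.
Proof.
  intros Hr. eexists. eapply path_functional_ext.
  - apply (path_functional_lincomb 1 1 _ _ _ _ _ _ _ _ (path_functional_axis r Hr)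
      (path_functional_circle_arc 0 r (1 / 4) (3 / 4) Hr ltac:(lra))).
  - reflexivity.
  - intros F _. unfold half_disc_integral. ring.
  - reflexivity.
  - intros P. cbv beta. rewrite circle_point_quarter, circle_point_three_quarters. ring.
Qed.

Lemma half_disc_trace_Re (r : R) (y : C) : 0 <= r -> half_disc_trace r y -> Re y <= 0.
Proof.
  intros Hr [[s [_ E]]|H]; [subst; rewrite Re_Ci_RtoC; lra|]. apply (left_arc_Re r); assumption.
Qed.

Lemma half_disc_trace_off (r : R) (y : C) : 0 <= r -> Re y < 0 -> Cmod y < r -> ~ half_disc_trace r y.
Proof.
  intros Hr Hy Hyr [[s [_ E]]|H].
  - subst. rewrite Re_Ci_RtoC in Hy. lra.
  - apply circle_arc_trace_dist in H; [|exact Hr]. replace (y - 0) with y in H by ring. lra.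
Qed.

(** The right half disc has index [0] at [w], and the two half discs add up to the circle. *)
Lemma index_half_disc (r : R) (w : C) : 0 <= r -> Re w < 0 -> Cmod w < r ->
  index (half_disc_integral r) w = two_pi_i.
Proof.
  intros Hr Hw Hwr. pose proof (Cmod_ge_0 w).
  assert (PFr : exists len, closed_functional
    (fun y => circle_arc_trace 0 r (- (1 / 4)) (1 / 4) y \/ axis_trace r y)
    (fun F => circle_arc_integral 0 r (- (1 / 4)) (1 / 4) F - axis_integral r F) len).
  { eexists. eapply path_functional_ext.
    - apply (path_functional_lincomb 1 (- (1)) _ _ _ _ _ _ _ _
        (path_functional_circle_arc 0 r (- (1 / 4)) (1 / 4) Hr ltac:(lra)) (path_functional_axis r Hr)).
    - reflexivity.
    - intros F _. cbv beta. ring.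
    - reflexivity.
    - intros P. cbv beta. rewrite circle_point_quarter, circle_point_minus_quarter. ring. }
  destruct PFr as [len PFr].
  assert (E0 : index (fun F => circle_arc_integral 0 r (- (1 / 4)) (1 / 4) F - axis_integral r F) w = 0).
  { apply (index_ray _ _ _ w (- (1)) PFr).
    - intros E. injection E. lra.
    - intros t Ht HT.
      assert (Re (w + RtoC t * - (1)) < 0).
      { change (Re w + (t * - (1) - 0 * - 0) < 0)%R. lra. }
      destruct HT as [HT|[s [_ E]]].
      + apply right_arc_Re in HT; lra.
      + rewrite <- E, Re_Ci_RtoC in H0. lra. }
  assert (E1 : index (circle_arc_integral 0 r (- (1 / 4)) (3 / 4)) w = two_pi_i).
  { replace (3 / 4)%R with (- (1 / 4) + 1)%R by field. apply index_circle; [lra|].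
    replace (w - 0) with w by ring. exact Hwr. }
  assert (E2 : index (circle_arc_integral 0 r (- (1 / 4)) (3 / 4)) w =
    index (circle_arc_integral 0 r (- (1 / 4)) (1 / 4)) w + index (circle_arc_integral 0 r (1 / 4) (3 / 4)) w).
  { assert (Ex : forall u v, u <= v -> ex_CRInt (fun t => / (circle_point 0 r t - w) * circle_speed r t) u v).
    { intros u v Huv. apply ex_CRInt_cont; [exact Huv|]. intros t _.
      apply RCcont_mult; [|apply RCcont_circle_speed].
      apply (RCcont_comp (fun y => / (y - w)) (circle_point 0 r)); [eapply RCderive_RCcont, RCderive_circle_point|].
      apply Ccont_inv; [ccont|]. apply Csub_neq_0. intros E.
      assert (D : Cmod (w - 0) = r).
      { apply (circle_arc_trace_dist 0 r t t); [exact Hr|]. exists t. split; [lra|exact E]. }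
      replace (w - 0) with w in D by ring. lra. }
    apply CRInt_Chasles; apply Ex; lra. }
  unfold index in *. unfold half_disc_integral. rewrite <- E1, E2.
  apply Ceq_minus. transitivity (- (circle_arc_integral 0 r (- (1 / 4)) (1 / 4) (fun y => / (y - w)) -
    axis_integral r (fun y => / (y - w)))); [ring|]. rewrite E0. ring.
Qed.

Lemma half_disc_divided_difference (U : C -> Prop) (f : C -> C) (p : nat -> C) (n : nat) (x : C) (r : R) :
  open (T := C_UniformSpace) U -> (forall w, Re w <= 0 -> U w) -> (forall w, U w -> Cdiffable f w) ->
  (forall j, (j < n)%nat -> Re (p j) < 0 /\ Cmod (p j) < r) -> Re x < 0 -> Cmod x < r ->
  half_disc_integral r (fun y => f y / (Cprod (fun j => y - p j) n * (y - x))) =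
    two_pi_i * dd f (map p (seq 0 n)) x.
Proof.
  intros HU HO Hf Hp Hx Hxr. pose proof (Cmod_ge_0 x).
  destruct (closed_functional_half_disc r ltac:(lra)) as [len PF].
  rewrite <- (divided_difference_integral _ _ _ U PF HU).
  - f_equal. apply functional_extensionality. intros y. rewrite lprod_Cprod. reflexivity.
  - intros y Hy. apply HO. apply (half_disc_trace_Re r); [lra|exact Hy].
  - intros w Hw. apply (index_ray _ _ _ w 1 PF); [apply C1_nz|].
    intros t Ht HT. apply half_disc_trace_Re in HT; [|lra]. apply Hw, HO.
    change (Re (w + RtoC t * 1)) with (Re w + (t * 1 - 0 * 0))%R in HT. lra.
  - exact Hf.
  - assert (good : forall q, Re q < 0 -> Cmod q < r ->
      U q /\ ~ half_disc_trace r q /\ index (half_disc_integral r) q = two_pi_i).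
    { intros q Hq Hqr. split; [apply HO; lra|]. split; [apply half_disc_trace_off|apply index_half_disc]; lra. }
    intros q [<-|Hq]; [auto|]. apply in_map_iff in Hq. destruct Hq as [j [<- Hj]].
    apply in_seq in Hj. destruct (Hp j ltac:(lia)). auto.
Qed.

(** * Limits and improper integrals *)

Definition Clim (u : nat -> C) (l : C) : Prop :=
  forall e : R, 0 < e -> exists N, forall n, (N <= n)%nat -> Cmod (u n - l) < e.

Lemma Clim_filterlim (u : nat -> C) (l : C) :
  Clim u l <-> filterlim u eventually (locally (T := C_UniformSpace) l).
Proof.
  split.
  - intros H P HP. apply C_UniformSpace_locally_Cmod in HP. destruct HP as [e [He HP]].
    destruct (H e He) as [N HN]. exists N. intros n Hn. apply HP. auto.
  - intros H e He. apply (H (fun y => Cmod (y - l) < e)).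
    apply C_UniformSpace_locally_Cmod. exists e. auto.
Qed.

Lemma Clim_unique (u : nat -> C) (l m : C) : Clim u l -> Clim u m -> l = m.
Proof.
  rewrite !Clim_filterlim. apply (filterlim_locally_unique (V := C_NormedModule)).
Qed.

Lemma Cprod_inf_Clim (u : nat -> C) (l : C) : Clim (Cprod u) l -> Cprod_inf u = l.
Proof.
  intros H. apply (iota_filterlim_locally (V := C_CompleteNormedModule)). apply Clim_filterlim. exact H.
Qed.

Lemma Clim_const (c : C) : Clim (fun _ => c) c.
Proof.
  intros e He. exists 0%nat. intros n _. rewrite Cmod_sub_diag. exact He.
Qed.

Lemma Clim_mult (u v : nat -> C) (l m : C) : Clim u l -> Clim v m -> Clim (fun n => u n * v n) (l * m).
Proof.
  intros Hu Hv e He.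
  pose (A := (Cmod l + Cmod m + 1)%R).
  pose proof (Cmod_ge_0 l). pose proof (Cmod_ge_0 m).
  assert (HA : 1 <= A) by (unfold A; lra).
  assert (He' : 0 < Rmin 1 (e / (2 * A))) by (apply Rmin_glb_lt; [lra|apply Rdiv_lt_0_compat; lra]).
  destruct (Hu _ He') as [N1 H1]. destruct (Hv _ He') as [N2 H2].
  exists (Nat.max N1 N2). intros n Hn. specialize (H1 n ltac:(lia)). specialize (H2 n ltac:(lia)).
  replace (u n * v n - l * m) with ((u n - l) * (v n - m) + ((u n - l) * m + l * (v n - m))) by ring.
  set (d := Rmin 1 (e / (2 * A))) in *.
  assert (Hd1 : d <= 1) by apply Rmin_l.
  assert (HdA : d * A <= e / 2).
  { apply Rle_trans with (e / (2 * A) * A)%R; [apply Rmult_le_compat_r; [lra|apply Rmin_r]|].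
    right. field. lra. }
  eapply Rle_lt_trans; [apply Cmod_triangle|].
  eapply Rle_lt_trans; [apply Rplus_le_compat_l, Cmod_triangle|]. rewrite !Cmod_mult.
  pose proof (Cmod_ge_0 (u n - l)). pose proof (Cmod_ge_0 (v n - m)).
  assert (Cmod (u n - l) * Cmod (v n - m) <= d * 1) by (apply Rmult_le_compat; lra).
  assert (Cmod (u n - l) * Cmod m <= d * Cmod m) by (apply Rmult_le_compat_r; lra).
  assert (Cmod l * Cmod (v n - m) <= Cmod l * d) by (apply Rmult_le_compat_l; lra).
  unfold A in HdA. lra.
Qed.

Lemma Clim_le (u : nat -> C) (l c : C) (M : R) (N : nat) : Clim u l ->
  (forall n, (N <= n)%nat -> Cmod (u n - c) <= M) -> Cmod (l - c) <= M.
Proof.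
  intros Hu H. apply le_epsilon. intros e He. destruct (Hu e He) as [N1 H1].
  specialize (H1 _ (Nat.le_max_r N N1)). specialize (H _ (Nat.le_max_l N N1)).
  pose proof (Cmod_sub_triangle l (u (Nat.max N N1)) c) as T. rewrite (Cmod_sub_sym l (u _)) in T. lra.
Qed.

Lemma Clim_of_dominated_increments (g : nat -> C) (A : nat -> R) (S K : R) (N : nat) :
  0 <= K -> (forall n, A n <= S) -> (forall e, 0 < e -> exists n, forall m, (n <= m)%nat -> S - A m < e) ->
  (forall n, (N <= n)%nat -> Cmod (g (n + 1)%nat - g n) <= K * (A (n + 1)%nat - A n)) ->
  exists l, Clim g l /\ forall n, (N <= n)%nat -> Cmod (l - g n) <= K * (S - A n).
Proof.
  intros HK HS HA Hg.
  assert (Hk : forall n k, (N <= n)%nat -> Cmod (g (n + k)%nat - g n) <= K * (A (n + k)%nat - A n)).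
  { intros n k Hn. induction k as [|k IH].
    - rewrite Nat.add_0_r. rewrite Cmod_sub_diag. right. ring.
    - pose proof (Cmod_sub_triangle (g (n + k + 1)%nat) (g (n + k)%nat) (g n)).
      specialize (Hg (n + k)%nat ltac:(lia)).
      replace (n + Datatypes.S k)%nat with (n + k + 1)%nat by lia. lra. }
  assert (Hnm : forall n m, (N <= n)%nat -> (n <= m)%nat -> Cmod (g m - g n) <= K * (S - A n)).
  { intros n m Hn Hm. replace m with (n + (m - n))%nat by lia.
    eapply Rle_trans; [apply Hk, Hn|]. apply Rmult_le_compat_l; [exact HK|].
    specialize (HS (n + (m - n))%nat). lra. }
  destruct (proj1 (filterlim_locally_cauchy (U := C_CompleteNormedModule) (F := eventually) g)) as [l Hl].
  - intros eps. destruct (HA (eps / (2 * (K + 1)))%R) as [n0 Hn0].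
    { apply Rdiv_lt_0_compat; [apply cond_pos|lra]. }
    pose (n1 := Nat.max N n0). exists (fun n => (n1 <= n)%nat). split; [exists n1; auto|].
    intros n m Hn Hm. apply C_NormedModule_mixin_compat1. change (minus (g m) (g n)) with (g m - g n).
    pose proof (Cmod_sub_triangle (g m) (g n1) (g n)) as T. rewrite (Cmod_sub_sym (g n1)) in T.
    pose proof (Hnm n1 n (Nat.le_max_l _ _) Hn). pose proof (Hnm n1 m (Nat.le_max_l _ _) Hm).
    specialize (Hn0 n1 (Nat.le_max_r _ _)). pose proof (cond_pos eps).
    assert (B : K * (S - A n1) <= K * (eps / (2 * (K + 1)))) by (apply Rmult_le_compat_l; lra).
    replace (K * (eps / (2 * (K + 1))))%R with (eps / 2 * (K / (K + 1)))%R in B by (field; lra).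
    assert (K / (K + 1) < 1).
    { apply Rmult_lt_reg_r with (K + 1)%R; [lra|]. unfold Rdiv. rewrite Rmult_assoc, Rinv_l; lra. }
    assert (eps / 2 * (K / (K + 1)) < eps / 2 * 1) by (apply Rmult_lt_compat_l; lra).
    lra.
  - exists l. assert (L : Clim g l) by (apply Clim_filterlim; exact Hl).
    split; [exact L|]. intros n Hn. apply (Clim_le g l (g n) _ n L). auto.
Qed.

Fixpoint psum (a : nat -> R) (n : nat) : R :=
  match n with O => 0 | S m => psum a m + a m end.

Lemma psum_sum_n (a : nat -> R) (n : nat) : psum a (S n) = sum_n a n.
Proof.
  induction n as [|n IH].
  - rewrite sum_O. simpl. ring.
  - rewrite sum_Sn, <- IH. reflexivity.
Qed.

Lemma psum_summable (a : nat -> R) : (forall n, 0 <= a n) -> ex_series a ->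
  exists S, 0 <= S /\ (forall n, psum a n <= S) /\
    forall e, 0 < e -> exists n, forall m, (n <= m)%nat -> S - psum a m < e.
Proof.
  intros Ha [S HS].
  assert (Mon : forall n k, psum a n <= psum a (n + k)).
  { intros n k. induction k as [|k IH]; [rewrite Nat.add_0_r; lra|].
    rewrite Nat.add_succ_r. simpl. specialize (Ha (n + k)%nat). lra. }
  assert (Lim : forall e, 0 < e -> exists n, forall m, (n <= m)%nat -> Rabs (psum a m - S) < e).
  { intros e He. destruct (HS (fun y => Rabs (y - S) < e)) as [n Hn].
    { exists (mkposreal e He). intros y Hy. exact Hy. }
    exists (n + 1)%nat. intros m Hm. replace m with (Datatypes.S (m - 1)) by lia.
    rewrite psum_sum_n. apply Hn. lia. }
  assert (Up : forall n, psum a n <= S).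
  { intros n. apply le_epsilon. intros e He. destruct (Lim e He) as [n0 H].
    specialize (H (n + n0)%nat ltac:(lia)). specialize (Mon n n0). apply Rabs_def2 in H. lra. }
  exists S. split; [exact (Up 0%nat)|]. split; [exact Up|].
  intros e He. destruct (Lim e He) as [n H]. exists n. intros m Hm. specialize (H m Hm).
  apply Rabs_def2 in H. lra.
Qed.

Lemma Cmod_Cprod_le (u : nat -> C) (a : nat -> R) (B : R) (n : nat) :
  (forall j, Cmod (u j) <= 1 + B * a j) -> Cmod (Cprod u n) <= exp (B * psum a n).
Proof.
  intros H. induction n as [|n IH]; simpl.
  - rewrite Cmod_1, Rmult_0_r, exp_0. lra.
  - rewrite Cmod_mult, Rmult_plus_distr_l, exp_plus. apply Rmult_le_compat; [apply Cmod_ge_0..|exact IH|].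
    eapply Rle_trans; [apply H|]. apply exp_ineq1_le.
Qed.

Lemma Ccont_Cprod (u : nat -> C -> C) (y : C) (n : nat) :
  (forall j, Ccont (u j) y) -> Ccont (fun y => Cprod (fun j => u j y) n) y.
Proof.
  intros H. induction n as [|n IH]; simpl; [apply Ccont_const|apply Ccont_mult; auto].
Qed.

Lemma Cprod_div (u v : nat -> C) (n : nat) : (forall j, v j <> 0) ->
  Cprod v n <> 0 /\ Cprod (fun j => u j / v j) n = Cprod u n / Cprod v n.
Proof.
  intros H. induction n as [|n [IH1 IH2]]; simpl.
  - split; [apply C1_nz|]. field.
  - split; [apply Cmult_neq_0; auto|]. rewrite IH2. field. auto.
Qed.

Lemma RCcont_uniform_limit (g : nat -> R -> C) (h : R -> C) (t : nat -> R) :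
  (forall n s, RCcont (g n) s) -> (forall e, 0 < e -> exists n, t n < e) ->
  (forall n s, Cmod (h s - g n s) <= t n) -> forall s, RCcont h s.
Proof.
  intros Hg Ht H s P HP. apply C_UniformSpace_locally_Cmod in HP. destruct HP as [e [He HP]].
  destruct (Ht (e / 3)%R ltac:(lra)) as [n Hn].
  destruct (RCcont_eps _ _ (Hg n s) (e / 3)%R ltac:(lra)) as [d [Hd H1]].
  exists (mkposreal d Hd). intros v Hv. apply HP. specialize (H1 v Hv).
  pose proof (H n v) as B1. pose proof (H n s) as B2.
  pose proof (Cmod_sub_triangle (h v) (g n v) (h s)).
  pose proof (Cmod_sub_triangle (g n v) (g n s) (h s)). rewrite (Cmod_sub_sym (g n s)) in H2. lra.
Qed.

Lemma is_RInt_atan (A u v : R) :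
  is_RInt (fun t => A / (1 + t * t))%R u v (A * (atan v - atan u))%R.
Proof.
  replace (A * (atan v - atan u))%R with (minus (A * atan v) (A * atan u))%R
    by (unfold minus, plus, opp; simpl; ring).
  assert (P : forall t : R, 0 < 1 + t * t) by (intros t; pose proof (Rle_0_sqr t); unfold Rsqr in *; lra).
  apply (is_RInt_derive (V := R_CompleteNormedModule) (fun t => A * atan t)%R).
  - intros t _. auto_derive; [exact I|]. specialize (P t). field. 
    intros E; lra.
  - intros t _. apply (ex_derive_continuous (K := R_AbsRing) (V := R_NormedModule)).
    auto_derive. specialize (P t). lra.
Qed.

Lemma CRInt_atan_bound (F : R -> C) (A u v : R) : (forall t, RCcont F t) ->
  (forall t, Cmod (F t) <= A / (1 + t * t)) -> u <= v ->
  Cmod (CRInt F u v) <= A * (atan v - atan u).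
Proof.
  intros HF HA Huv. rewrite Cmod_norm.
  apply (norm_RInt_le (V := C_R_NormedModule) F (fun t => A / (1 + t * t))%R u v); [exact Huv| | |].
  - intros t _. rewrite <- Cmod_norm. apply HA.
  - apply CRInt_correct, ex_CRInt_cont; auto.
  - apply is_RInt_atan.
Qed.

Lemma ex_CRInt_all (F : R -> C) (u v : R) : (forall t, RCcont F t) -> ex_CRInt F u v.
Proof. intros HF. apply (ex_RInt_continuous (V := C_R_CompleteNormedModule)). intros; apply HF. Qed.

Lemma CRInt_atan_bound_abs (F : R -> C) (A u v : R) : (forall t, RCcont F t) ->
  (forall t, Cmod (F t) <= A / (1 + t * t)) -> Cmod (CRInt F u v) <= A * Rabs (atan v - atan u).
Proof.
  intros HF HA. destruct (Rle_or_lt u v) as [H|H].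
  - rewrite Rabs_right; [apply CRInt_atan_bound; assumption|].
    destruct H as [H| ->]; [pose proof (atan_increasing _ _ H)|]; lra.
  - pose proof (atan_increasing _ _ H). rewrite Rabs_left by lra.
    assert (E : CRInt F u v = - CRInt F v u).
    { symmetry. apply (opp_RInt_swap (V := C_R_CompleteNormedModule)). apply ex_CRInt_all. exact HF. }
    rewrite E, Cmod_opp. replace (- (atan v - atan u))%R with (atan u - atan v)%R by ring.
    apply CRInt_atan_bound; auto; lra.
Qed.

Lemma atan_limit (e : R) : 0 < e -> exists T, 0 < T /\ forall t, T < t -> PI / 2 - atan t < e.
Proof.
  intros He. pose proof PI_RGT_0.
  pose (d := Rmin e (PI / 4)). assert (Hd : 0 < d) by (apply Rmin_glb_lt; lra).
  assert (Hd1 : d <= e) by apply Rmin_l. assert (Hd2 : d <= PI / 4) by apply Rmin_r.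
  exists (tan (PI / 2 - d)). split; [apply tan_gt_0; lra|].
  intros t Ht. apply atan_increasing in Ht. rewrite atan_tan in Ht by lra. lra.
Qed.

Lemma improper_integral (F : R -> C) (A : R) : 0 <= A -> (forall t, RCcont F t) ->
  (forall t, Cmod (F t) <= A / (1 + t * t)) ->
  exists I : C, is_RInt_gen (V := C_R_NormedModule) F (Rbar_locally m_infty) (Rbar_locally p_infty) I /\
    forall e, 0 < e -> exists T, forall t, T < t -> Cmod (CRInt F (- t) t - I) < e.
Proof.
  intros HA HF HB.
  destruct (proj1 (filterlim_locally_cauchy (U := C_CompleteNormedModule)
    (F := filter_prod (Rbar_locally m_infty) (Rbar_locally p_infty))
    (fun ab : R * R => CRInt F (fst ab) (snd ab)))) as [I HI].
  - intros eps. pose proof (cond_pos eps) as Heps.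
    destruct (atan_limit (eps / (2 * (A + 1)))%R) as [T [HT Hat]]; [apply Rdiv_lt_0_compat; lra|].
    exists (fun ab => fst ab < - T /\ T < snd ab). split.
    { apply Filter_prod with (fun u => u < - T) (fun v => T < v); [exists (- T)%R; auto|exists T; auto|auto]. }
    intros [u v] [u' v'] [Hu Hv] [Hu' Hv']. simpl in *.
    apply C_NormedModule_mixin_compat1. change (minus (CRInt F u' v') (CRInt F u v)) with (CRInt F u' v' - CRInt F u v).
    assert (E : CRInt F u' v' - CRInt F u v = CRInt F u' u + CRInt F v v').
    { rewrite (CRInt_Chasles F u' u v'), (CRInt_Chasles F u v v') by (apply ex_CRInt_all; exact HF). cring. }
    rewrite E. eapply Rle_lt_trans; [apply Cmod_triangle|].
    pose proof (CRInt_atan_bound_abs F A u' u HF HB) as B1.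
    pose proof (CRInt_atan_bound_abs F A v v' HF HB) as B2.
    pose proof (Hat v Hv). pose proof (Hat v' Hv').
    pose proof (Hat (- u)%R ltac:(lra)) as A1. pose proof (Hat (- u')%R ltac:(lra)) as A2.
    rewrite atan_opp in A1, A2.
    pose proof (atan_bound u). pose proof (atan_bound u'). pose proof (atan_bound v). pose proof (atan_bound v').
    set (d := (eps / (2 * (A + 1)))%R) in *.
    assert (C1 : Rabs (atan u - atan u') <= d) by (apply Rabs_le; lra).
    assert (C2 : Rabs (atan v' - atan v) <= d) by (apply Rabs_le; lra).
    assert (A * Rabs (atan u - atan u') <= A * d) by (apply Rmult_le_compat_l; lra).
    assert (A * Rabs (atan v' - atan v) <= A * d) by (apply Rmult_le_compat_l; lra).
    assert (E2 : ((A + 1) * d = eps / 2)%R) by (unfold d; field; lra).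
    assert (0 < d) by (unfold d; apply Rdiv_lt_0_compat; lra).
    lra.
  - exists I. split.
    + intros P HP. specialize (HI P HP). unfold filtermap in HI. unfold filtermapi.
      revert HI. apply filter_imp. intros [u v] H. simpl in *.
      exists (CRInt F u v). split; [apply CRInt_correct, ex_CRInt_all, HF|exact H].
    + intros e He.
      assert (HP : locally (T := C_UniformSpace) I (fun y => Cmod (y - I) < e)).
      { apply C_UniformSpace_locally_Cmod. exists e. auto. }
      specialize (HI _ HP). destruct HI as [Q1 Q2 [M1 H1] [M2 H2] H].
      exists (Rmax (- M1) M2). intros t Ht.
      apply (H (- t)%R t).
      * apply H1. pose proof (Rmax_l (- M1) M2). lra.
      * apply H2. pose proof (Rmax_r (- M1) M2). lra.
Qed.

(** * The remainder *)

Definition negative_real (w : C) : Prop := exists r, r < 0 /\ w = RtoC r.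

Lemma negative_real_neq_0 (w : C) : negative_real w -> w <> 0.
Proof. intros [r [Hr ->]] E. apply RtoC_inj in E. lra. Qed.

Lemma axis_factor (w : C) (s : R) : negative_real w ->
  1 <= Cmod (1 - Ci * RtoC s / w) /\ 1 + Rabs s <= (1 + Cmod w) * Cmod (1 - Ci * RtoC s / w).
Proof.
  intros [r [Hr ->]].
  assert (E : Ci * RtoC s / RtoC r = Ci * RtoC (s / r)) by (rewrite RtoC_div by lra; unfold Cdiv; ring).
  rewrite E. set (k := (s / r)%R).
  pose proof (re_le_Cmod (1 - Ci * RtoC k)) as H1. pose proof (Rabs_Im_le_Cmod (1 - Ci * RtoC k)) as H2.
  rewrite Re_minus, Re_Ci_RtoC in H1. rewrite Im_minus in H2.
  replace (Re 1 - 0)%R with 1%R in H1 by (simpl; ring). rewrite Rabs_R1 in H1.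
  replace (Im 1 - Im (Ci * RtoC k))%R with (- k)%R in H2 by (simpl; ring). rewrite Rabs_Ropp in H2.
  split; [exact H1|].
  rewrite Cmod_R.
  assert (Es : Rabs s = (Rabs r * Rabs k)%R).
  { rewrite <- Rabs_mult. f_equal. unfold k. field. lra. }
  rewrite Es. pose proof (Rabs_pos r). nra.
Qed.

Lemma axis_product_lower (p : nat -> C) (N : nat) : (forall j, negative_real (p j)) ->
  exists c, 0 < c /\ forall n s, (N <= n)%nat ->
    c * (1 + Rabs s) ^ N <= Cmod (Cprod (fun j => 1 - Ci * RtoC s / p j) n).
Proof.
  intros Hp.
  assert (Base : exists c, 0 < c /\ forall s, c * (1 + Rabs s) ^ N <= Cmod (Cprod (fun j => 1 - Ci * RtoC s / p j) N)).
  { induction N as [|N [c [Hc IH]]].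
    - exists 1%R. split; [lra|]. intros s. simpl. rewrite Cmod_1. lra.
    - pose proof (Cmod_ge_0 (p N)).
      exists (c / (1 + Cmod (p N)))%R. split; [apply Rdiv_lt_0_compat; lra|].
      intros s. simpl. rewrite Cmod_mult. destruct (axis_factor (p N) s (Hp N)) as [_ F].
      replace (c / (1 + Cmod (p N)) * ((1 + Rabs s) * (1 + Rabs s) ^ N))%R with
        (c * (1 + Rabs s) ^ N * ((1 + Rabs s) / (1 + Cmod (p N))))%R by (field; lra).
      pose proof (Rabs_pos s).
      apply Rmult_le_compat; [| |apply IH|].
      + apply Rmult_le_pos; [lra|apply pow_le; lra].
      + left. apply Rdiv_lt_0_compat; lra.
      + apply Rmult_le_reg_r with (1 + Cmod (p N))%R; [lra|].
        unfold Rdiv. rewrite Rmult_assoc, Rinv_l by lra. lra. }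
  destruct Base as [c [Hc Base]]. exists c. split; [exact Hc|]. intros n s Hn.
  replace n with (N + (n - N))%nat by lia. induction (n - N)%nat as [|k IH].
  - rewrite Nat.add_0_r. apply Base.
  - rewrite Nat.add_succ_r. simpl. rewrite Cmod_mult.
    destruct (axis_factor (p (N + k)%nat) s (Hp _)) as [F _].
    pose proof (Cmod_ge_0 (Cprod (fun j => 1 - Ci * RtoC s / p j) (N + k))). nra.
Qed.

Lemma Cprod_lower (u : nat -> C) (d : R) (n : nat) : 0 <= d ->
  (forall j, (j < n)%nat -> d <= Cmod (u j)) -> d ^ n <= Cmod (Cprod u n).
Proof.
  intros Hd H. induction n as [|n IH]; simpl.
  - rewrite Cmod_1. lra.
  - rewrite Cmod_mult, (Rmult_comm d). apply Rmult_le_compat; auto. apply pow_le. exact Hd.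
Qed.

Lemma power_growth (f : C -> C) (K M : R) :
  (forall w : C, Re w <= 0 -> Cmod (f w) <= K * Rpower (1 + Cmod w) M) ->
  exists m, 0 <= K /\ forall w : C, Re w <= 0 -> Cmod (f w) <= K * (1 + Cmod w) ^ m.
Proof.
  intros H.
  assert (HK : 0 <= K).
  { specialize (H 0). rewrite Cmod_0 in H. replace (1 + 0)%R with 1%R in H by ring.
    assert (E : Rpower 1 M = 1%R) by (unfold Rpower; rewrite ln_1, Rmult_0_r, exp_0; reflexivity).
    rewrite E in H. pose proof (Cmod_ge_0 (f 0)). specialize (H ltac:(simpl; lra)). lra. }
  destruct (nfloor_ex (Rmax 0 M)) as [m [_ Hm]]; [apply Rmax_l|].
  pose proof (Rmax_r 0 M).
  exists (m + 1)%nat. split; [exact HK|]. intros w Hw. eapply Rle_trans; [apply H, Hw|].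
  apply Rmult_le_compat_l; [exact HK|]. pose proof (Cmod_ge_0 w).
  rewrite <- Rpower_pow by lra. apply Rle_Rpower; [lra|]. rewrite plus_INR. simpl (INR 1). lra.
Qed.

Section Remainder.

Context (U : C -> Prop) (f : C -> C) (p : nat -> C) (x : C) (K : R) (m : nat).
Hypothesis HU : open (T := C_UniformSpace) U.
Hypothesis HO : forall w, Re w <= 0 -> U w.
Hypothesis Hf : forall w, U w -> Cdiffable f w.
Hypothesis Hp : forall j, negative_real (p j).
Hypothesis HK : 0 <= K.
Hypothesis Hg : forall w : C, Re w <= 0 -> Cmod (f w) <= K * (1 + Cmod w) ^ m.
Hypothesis Hx : Re x < 0.

Definition remainder_kernel (n : nat) (y : C) : C :=
  Cprod (fun j => x - p j) n * (f y / (Cprod (fun j => y - p j) n * (y - x))).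

Lemma Ccont_remainder_quotient (n : nat) (y : C) : Re y <= 0 ->
  (forall j, (j < n)%nat -> y <> p j) -> y <> x ->
  Ccont (fun y => f y / (Cprod (fun j => y - p j) n * (y - x))) y.
Proof.
  intros Hy Hyp Hyx.
  assert (y - x <> 0) by (apply Csub_neq_0; exact Hyx).
  apply Ccont_div; [apply Cdiffable_Ccont, Hf, HO, Hy| |].
  - apply Ccont_mult; [|ccont]. apply (Ccont_Cprod (fun j y => y - p j)). intros j. ccont.
  - apply Cmult_neq_0; [|assumption]. clear -Hyp. induction n as [|n IH]; simpl; [apply C1_nz|].
    apply Cmult_neq_0; [apply IH; auto|]. apply Csub_neq_0. auto.
Qed.

Lemma remainder_half_disc (n : nat) : exists T, 0 < T /\ forall r, T < r ->
  half_disc_integral r (remainder_kernel n) =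
    two_pi_i * (dd f (map p (seq 0 n)) x * Cprod (fun j => x - p j) n).
Proof.
  destruct (negative_bounds p Hp n) as [d [A [Hd [HA Hb]]]].
  exists (A + Cmod x)%R. pose proof (Cmod_ge_0 x). split; [lra|]. intros r Hr.
  assert (Hin : forall j, (j < n)%nat -> Re (p j) < 0 /\ Cmod (p j) < r).
  { intros j Hj. destruct (Hb j ltac:(lia)) as [s [-> Hs]]. rewrite Cmod_R.
    split; [simpl; lra|]. apply Rabs_def1; lra. }
  destruct (closed_functional_half_disc r ltac:(lra)) as [len PF].
  unfold remainder_kernel. rewrite (pf_scal PF).
  - rewrite (half_disc_divided_difference U f p n x r); auto; [ring|lra].
  - intros y Hy. apply Ccont_remainder_quotient.
    + apply (half_disc_trace_Re r); [lra|exact Hy].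
    + intros j Hj E. subst. destruct (Hin j Hj). apply (half_disc_trace_off r (p j)); auto; lra.
    + intros E. subst. apply (half_disc_trace_off r x); auto; lra.
Qed.

Lemma remainder_arc (n : nat) : (m + 1 <= n)%nat -> forall e, 0 < e -> exists T, forall r, T < r ->
  Cmod (circle_arc_integral 0 r (1 / 4) (3 / 4) (remainder_kernel n)) < e.
Proof.
  intros Hn e He.
  destruct (negative_bounds p Hp n) as [d [A [Hd [HA Hb]]]].
  pose proof PI_RGT_0. pose proof (Cmod_ge_0 x).
  pose (W := Cmod (Cprod (fun j => x - p j) n)). assert (HW : 0 <= W) by apply Cmod_ge_0.
  pose (Q := (PI * (W * (K * 4 ^ m * 4)))%R).
  assert (H4 : 0 <= 4 ^ m) by (apply pow_le; lra).
  assert (HQ : 0 <= Q) by (unfold Q; apply Rmult_le_pos; [lra|]; repeat apply Rmult_le_pos; lra).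
  exists (Rmax (Rmax (2 * A) (2 * Cmod x)) (Rmax 2 (Q / e))). intros r Hr.
  assert (R1 : 2 * A < r).
  { eapply Rle_lt_trans; [|exact Hr]. eapply Rle_trans; [|apply Rmax_l]. apply Rmax_l. }
  assert (R2 : 2 * Cmod x < r).
  { eapply Rle_lt_trans; [|exact Hr]. eapply Rle_trans; [|apply Rmax_l]. apply Rmax_r. }
  assert (R3 : 2 < r).
  { eapply Rle_lt_trans; [|exact Hr]. eapply Rle_trans; [|apply Rmax_r]. apply Rmax_l. }
  assert (R4 : Q / e < r).
  { eapply Rle_lt_trans; [|exact Hr]. eapply Rle_trans; [|apply Rmax_r]. apply Rmax_r. }
  assert (Far : forall y, Cmod y = r -> (forall j, (j < n)%nat -> r / 2 <= Cmod (y - p j)) /\ r / 2 <= Cmod (y - x)).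
  { intros y Hy. split.
    - intros j Hj. destruct (Hb j ltac:(lia)) as [s [-> Hs]].
      pose proof (Cmod_le_add y (RtoC s)) as T. rewrite Cmod_R in T. rewrite Rabs_left1 in T by lra. lra.
    - pose proof (Cmod_le_add y x). lra. }
  assert (Tr : forall y, circle_arc_trace 0 r (1 / 4) (3 / 4) y -> Re y <= 0 /\ Cmod y = r).
  { intros y Hy. split; [apply (left_arc_Re r); [lra|exact Hy]|].
    apply circle_arc_trace_dist in Hy; [|lra]. replace (y - 0) with y in Hy by ring. exact Hy. }
  eapply Rle_lt_trans.
  - apply (pf_bound (path_functional_circle_arc 0 r (1 / 4) (3 / 4) ltac:(lra) ltac:(lra)) _
      (W * (K * 4 ^ m * 4) / (r * r))%R).
    + apply Rmult_le_pos; [repeat apply Rmult_le_pos; lra|].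
      left. apply Rinv_0_lt_compat. apply Rmult_lt_0_compat; lra.
    + intros y Hy. apply Tr in Hy. destruct Hy as [Hy1 Hy2]. destruct (Far y Hy2) as [F1 F2].
      apply Ccont_mult; [apply Ccont_const|]. apply Ccont_remainder_quotient; [exact Hy1| |].
      * intros j Hj E. specialize (F1 j Hj). rewrite E in F1. rewrite Cmod_sub_diag in F1. lra.
      * intros E. rewrite E in F2. rewrite Cmod_sub_diag in F2. lra.
    + intros y Hy. apply Tr in Hy. destruct Hy as [Hy1 Hy2]. destruct (Far y Hy2) as [F1 F2].
      unfold remainder_kernel. rewrite Cmod_mult. fold W.
      unfold Rdiv at 1. rewrite Rmult_assoc. apply Rmult_le_compat_l; [exact HW|].
      change (K * 4 ^ m * 4 * / (r * r))%R with (K * 4 ^ m * 4 / (r * r))%R.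
      assert (Hpow : 0 < (r / 2) ^ m) by (apply pow_lt; lra).
      eapply Rle_trans.
      * apply (Cmod_div_le _ _ (K * (2 * r) ^ m) ((r / 2) ^ m * (r / 2 * (r / 2)))).
        -- eapply Rle_trans; [apply Hg, Hy1|]. apply Rmult_le_compat_l; [exact HK|].
           apply pow_incr. rewrite Hy2. lra.
        -- repeat apply Rmult_lt_0_compat; lra.
        -- rewrite Cmod_mult, <- Rmult_assoc. apply Rmult_le_compat; [apply Rmult_le_pos; lra|lra| |exact F2].
           eapply Rle_trans; [|apply (Cprod_lower _ (r / 2)); [lra|exact F1]].
           replace ((r / 2) ^ m * (r / 2))%R with ((r / 2) ^ (m + 1))%R by (rewrite pow_add; simpl; ring).
           apply Rle_pow; [lra|exact Hn].
      * right. replace (2 * r)%R with (4 * (r / 2))%R by field. rewrite Rpow_mult_distr. field. lra.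
  - replace ((3 / 4 - 1 / 4) * (2 * PI * r) * (W * (K * 4 ^ m * 4) / (r * r)))%R with (Q / r)%R
      by (unfold Q; field; lra).
    apply Rmult_lt_reg_r with r; [lra|]. unfold Rdiv. rewrite Rmult_assoc, Rinv_l, Rmult_1_r by lra.
    apply (Rmult_lt_compat_r e) in R4; [|exact He]. unfold Rdiv in R4.
    rewrite Rmult_assoc, Rinv_l, Rmult_1_r in R4 by lra. lra.
Qed.

End Remainder.

Definition H_partial (p : nat -> C) (y : C) (n : nat) : C := Cprod (fun j => 1 - y / p j) n.

Definition Q_partial (p : nat -> C) (x y : C) (n : nat) : C := Cprod (fun j => (x - p j) / (y - p j)) n.

Lemma H_partial_bound (p : nat -> C) (S : R) (y : C) (n : nat) :
  (forall j, negative_real (p j)) -> (forall n, psum (fun j => / Cmod (p j))%R n <= S) ->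
  Cmod (H_partial p y n) <= exp (Cmod y * S).
Proof.
  intros Hp HS. eapply Rle_trans.
  - apply (Cmod_Cprod_le _ (fun j => / Cmod (p j))%R (Cmod y)). intros j.
    eapply Rle_trans; [apply Cmod_sub_le|]. rewrite Cmod_1, Cmod_div by (apply negative_real_neq_0, Hp).
    right. reflexivity.
  - assert (L : Cmod y * psum (fun j => / Cmod (p j))%R n <= Cmod y * S)
      by (apply Rmult_le_compat_l; [apply Cmod_ge_0|apply HS]).
    destruct L as [L|L]; [left; apply exp_increasing; exact L|rewrite L; lra].
Qed.

Lemma H_partial_converges (p : nat -> C) (S : R) (y : C) :
  (forall j, negative_real (p j)) -> (forall n, psum (fun j => / Cmod (p j))%R n <= S) ->
  (forall e, 0 < e -> exists n, forall m, (n <= m)%nat -> S - psum (fun j => / Cmod (p j))%R m < e) ->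
  exists l, Clim (H_partial p y) l.
Proof.
  intros Hp HS HS'.
  destruct (Clim_of_dominated_increments (H_partial p y) (psum (fun j => / Cmod (p j))%R) S
    (exp (Cmod y * S) * Cmod y) 0) as [l [Hl _]].
  - apply Rmult_le_pos; [left; apply exp_pos|apply Cmod_ge_0].
  - exact HS.
  - exact HS'.
  - intros n _. rewrite Nat.add_1_r. simpl psum. unfold H_partial. simpl Cprod.
    fold (H_partial p y n).
    replace (H_partial p y n * (1 - y / p n) - H_partial p y n) with (- (H_partial p y n * (y / p n))) by ring.
    rewrite Cmod_opp, Cmod_mult, Cmod_div by (apply negative_real_neq_0, Hp).
    replace (exp (Cmod y * S) * Cmod y * (psum (fun j => / Cmod (p j)) n + / Cmod (p n) - psum (fun j => / Cmod (p j)) n))%R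
      with (exp (Cmod y * S) * (Cmod y / Cmod (p n)))%R by (unfold Rdiv; ring).
    apply Rmult_le_compat_r.
    + apply Rmult_le_pos; [apply Cmod_ge_0|]. left. apply Rinv_0_lt_compat, Cmod_gt_0, negative_real_neq_0, Hp.
    + apply H_partial_bound; assumption.
  - exists l. exact Hl.
Qed.

Lemma axis_off_negative (w : C) (s : R) : Re w < 0 -> Ci * RtoC s - w <> 0.
Proof.
  intros Hw E. apply Csub_neq_0 in E; [exact E|]. intros E'. rewrite <- E', Re_Ci_RtoC in Hw. lra.
Qed.

Lemma negative_real_Re (w : C) : negative_real w -> Re w < 0.
Proof. intros [r [Hr ->]]. exact Hr. Qed.

Lemma Q_partial_H (p : nat -> C) (x : C) (s : R) (n : nat) : (forall j, negative_real (p j)) ->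
  H_partial p (Ci * RtoC s) n <> 0 /\
  Q_partial p x (Ci * RtoC s) n = H_partial p x n / H_partial p (Ci * RtoC s) n.
Proof.
  intros Hp.
  assert (N : forall j, 1 - Ci * RtoC s / p j <> 0).
  { intros j. apply Cmod_gt_0. destruct (axis_factor (p j) s (Hp j)). lra. }
  destruct (Cprod_div (fun j => 1 - x / p j) (fun j => 1 - Ci * RtoC s / p j) n N) as [N1 E1].
  split; [exact N1|]. unfold H_partial. rewrite <- E1. apply Cprod_ext. intros j _.
  pose proof (negative_real_neq_0 _ (Hp j)). pose proof (axis_off_negative (p j) s (negative_real_Re _ (Hp j))).
  specialize (N j). field. repeat split; try assumption.
  intros E. apply H0. transitivity (- (p j - Ci * RtoC s)); [ring|rewrite E; ring].
Qed.

Lemma remainder_kernel_axis (f : C -> C) (p : nat -> C) (x : C) (n : nat) (s : R) :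
  (forall j, negative_real (p j)) -> Re x < 0 ->
  remainder_kernel f p x n (Ci * RtoC s) = f (Ci * RtoC s) / (Ci * RtoC s - x) * Q_partial p x (Ci * RtoC s) n.
Proof.
  intros Hp Hx. unfold remainder_kernel, Q_partial.
  destruct (Cprod_div (fun j => x - p j) (fun j => Ci * RtoC s - p j) n) as [N E].
  - intros j. apply axis_off_negative, negative_real_Re, Hp.
  - rewrite E. pose proof (axis_off_negative x s Hx). field. auto.
Qed.

Lemma Cmod_axis_minus (w : C) (s : R) : Rabs (Re w) <= Cmod (Ci * RtoC s - w).
Proof.
  pose proof (re_le_Cmod (Ci * RtoC s - w)) as H. rewrite Re_minus, Re_Ci_RtoC in H.
  replace (0 - Re w)%R with (- Re w)%R in H by ring. rewrite Rabs_Ropp in H. exact H.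
Qed.

(** The factor [(1+|s|)^3] in the denominator leaves room for the increments in [n], which cost
    a factor [1+|s|], while keeping integrability. *)
Lemma remainder_kernel_axis_bound (f : C -> C) (p : nat -> C) (x : C) (K S : R) (m : nat) :
  (forall j, negative_real (p j)) -> Re x < 0 -> 0 <= K ->
  (forall w : C, Re w <= 0 -> Cmod (f w) <= K * (1 + Cmod w) ^ m) ->
  (forall n, psum (fun j => / Cmod (p j))%R n <= S) ->
  exists B, 0 <= B /\ forall n s, (m + 3 <= n)%nat ->
    Cmod (remainder_kernel f p x n (Ci * RtoC s)) <= B / (1 + Rabs s) ^ 3.
Proof.
  intros Hp Hx HK Hg HS.
  destruct (axis_product_lower p (m + 3) Hp) as [c [Hc Hlow]].
  pose (E := exp (Cmod x * S)). assert (HE : 0 < E) by apply exp_pos.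
  exists (K / - Re x * (E / c))%R. split.
  { apply Rmult_le_pos; [apply Rdiv_le_0_compat; [exact HK|lra]|].
    left. apply Rdiv_lt_0_compat; assumption. }
  intros n s Hn. rewrite remainder_kernel_axis by assumption.
  destruct (Q_partial_H p x s n Hp) as [N ->].
  pose proof (Rabs_pos s) as Hs.
  assert (P : 0 < (1 + Rabs s) ^ m) by (apply pow_lt; lra).
  assert (P3 : 0 < (1 + Rabs s) ^ 3) by (apply pow_lt; lra).
  assert (B1 : Cmod (f (Ci * RtoC s) / (Ci * RtoC s - x)) <= K * (1 + Rabs s) ^ m / - Re x).
  { apply Cmod_div_le; [|lra|].
    - eapply Rle_trans; [apply Hg; rewrite Re_Ci_RtoC; lra|]. rewrite Cmod_Ci_RtoC. lra.
    - rewrite <- Rabs_left by exact Hx. apply Cmod_axis_minus. }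
  assert (B2 : Cmod (H_partial p x n / H_partial p (Ci * RtoC s) n) <= E / (c * (1 + Rabs s) ^ (m + 3))).
  { apply Cmod_div_le.
    - apply H_partial_bound; assumption.
    - apply Rmult_lt_0_compat; [exact Hc|apply pow_lt; lra].
    - apply Hlow. exact Hn. }
  rewrite Cmod_mult. eapply Rle_trans; [apply Rmult_le_compat; [apply Cmod_ge_0|apply Cmod_ge_0|exact B1|exact B2]|].
  right. rewrite pow_add. field. repeat split; lra.
Qed.

Lemma remainder_kernel_axis_step (f : C -> C) (p : nat -> C) (x : C) (B : R) (n : nat) (s : R) :
  (forall j, negative_real (p j)) -> Re x < 0 -> 0 <= B ->
  Cmod (remainder_kernel f p x n (Ci * RtoC s)) <= B / (1 + Rabs s) ^ 3 ->
  Cmod (remainder_kernel f p x (n + 1) (Ci * RtoC s) - remainder_kernel f p x n (Ci * RtoC s))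
    <= B * (1 + Cmod x) / (1 + s * s) * / Cmod (p n).
Proof.
  intros Hp Hx HB Hn.
  pose proof (Rabs_pos s) as Hs. pose proof (Cmod_ge_0 x) as Hx0.
  assert (Hpn : 0 < Cmod (p n)) by (apply Cmod_gt_0, negative_real_neq_0, Hp).
  assert (Np := axis_off_negative (p n) s (negative_real_Re _ (Hp n))).
  assert (E : remainder_kernel f p x (n + 1) (Ci * RtoC s) - remainder_kernel f p x n (Ci * RtoC s) =
    remainder_kernel f p x n (Ci * RtoC s) * ((x - Ci * RtoC s) / (Ci * RtoC s - p n))).
  { rewrite !remainder_kernel_axis by assumption. rewrite Nat.add_1_r. unfold Q_partial. simpl Cprod.
    field. split; [exact Np|apply axis_off_negative, Hx]. }
  rewrite E, Cmod_mult.
  assert (F : Cmod ((x - Ci * RtoC s) / (Ci * RtoC s - p n)) <= (1 + Cmod x) * (1 + Rabs s) / Cmod (p n)).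
  { apply Cmod_div_le; [|exact Hpn|].
    - eapply Rle_trans; [apply Cmod_sub_le|]. rewrite Cmod_Ci_RtoC. nra.
    - eapply Rle_trans; [|apply Cmod_axis_minus]. destruct (Hp n) as [r [Hr ->]]. rewrite Cmod_R. simpl. lra. }
  eapply Rle_trans; [apply Rmult_le_compat; [apply Cmod_ge_0|apply Cmod_ge_0|exact Hn|exact F]|].
  replace (B / (1 + Rabs s) ^ 3 * ((1 + Cmod x) * (1 + Rabs s) / Cmod (p n)))%R with
    (B * (1 + Cmod x) * / Cmod (p n) * / ((1 + Rabs s) * (1 + Rabs s)))%R by (field; lra).
  replace (B * (1 + Cmod x) / (1 + s * s) * / Cmod (p n))%R with
    (B * (1 + Cmod x) * / Cmod (p n) * / (1 + s * s))%R by (unfold Rdiv; ring).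
  apply Rmult_le_compat_l.
  - apply Rmult_le_pos; [apply Rmult_le_pos; lra|]. left. apply Rinv_0_lt_compat. exact Hpn.
  - assert (Rabs s * Rabs s = s * s)%R by (rewrite <- Rabs_mult, Rabs_right; [reflexivity|nra]).
    apply Rinv_le_contravar; nra.
Qed.

Lemma Clim_inv (u : nat -> C) (l : C) : (forall n, 1 <= Cmod (u n)) -> Clim u l ->
  Clim (fun n => / u n) (/ l).
Proof.
  intros H1 Hu.
  assert (Hl : 1 <= Cmod l).
  { apply le_epsilon. intros e He. destruct (Hu e He) as [n Hn]. specialize (Hn n (le_n n)).
    specialize (H1 n). pose proof (Cmod_le_add (u n) l). lra. }
  intros e He. destruct (Hu e He) as [n0 Hn0]. exists n0. intros n Hn. specialize (Hn0 n Hn). specialize (H1 n).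
  assert (u n <> 0) by (apply Cmod_gt_0; lra). assert (l <> 0) by (apply Cmod_gt_0; lra).
  replace (/ u n - / l) with ((l - u n) / (u n * l)) by (field; auto).
  eapply Rle_lt_trans; [apply (Cmod_div_le _ _ (Cmod (u n - l)) 1)|lra].
  - rewrite Cmod_sub_sym. lra.
  - lra.
  - rewrite Cmod_mult. nra.
Qed.

Lemma cube_le_square (B s : R) : 0 <= B -> B / (1 + Rabs s) ^ 3 <= B / (1 + s * s).
Proof.
  intros HB. pose proof (Rabs_pos s).
  assert (Rabs s * Rabs s = s * s)%R by (rewrite <- Rabs_mult, Rabs_right; [reflexivity|nra]).
  apply Rmult_le_compat_l; [exact HB|]. apply Rinv_le_contravar; [nra|].
  replace ((1 + Rabs s) ^ 3)%R with (1 + s * s + (3 * Rabs s + 2 * (s * s) + Rabs s * (s * s)))%R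
    by (rewrite <- H0; ring).
  assert (0 <= s * s) by nra. assert (0 <= Rabs s * (s * s)) by (apply Rmult_le_pos; lra). lra.
Qed.

Theorem theorem2p7 (a b c : C) (z : Z -> C) (U : C -> Prop) (f : C -> C)
    (K M : R)
    (hz : P_sequence (polyP a b c) z)
    (hneg : forall k : nat, exists r : R,
        (r < 0)%R /\ z (2 * Z.of_nat k)%Z = RtoC r)
    (hsum : ex_series (fun k : nat => (/ Cmod (z (2 * Z.of_nat k)%Z))%R))
    (hU : open (T := C_UniformSpace) U)
    (hOmega : forall w : C, (Re w <= 0)%R -> U w)
    (hf : analytic_in U f)
    (hbound : forall w : C, (Re w <= 0)%R ->
        (Cmod (f w) <= K * Rpower (1 + Cmod w) M)%R)
    (x : C) (hx : (Re x < 0)%R) :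
  exists S_inf I : C,
    filterlim (fun n : nat => taylor (polyP a b c) U z f n x)
      eventually (locally (T := C_UniformSpace) S_inf) /\
    is_imaginary_axis_integral
      (fun y => f y / (y - x) * (Hfun z x / Hfun z y)) I /\
    is_imaginary_axis_integral
      (fun y => f y / (y - x) *
         Cprod_inf (fun j => (x - z (2 * Z.of_nat j)%Z) /
                             (y - z (2 * Z.of_nat j)%Z))) I /\
    f x = S_inf + / two_pi_i * I.
Proof.
  pose (p := fun j : nat => z (2 * Z.of_nat j)%Z).
  assert (Hp : forall j, negative_real (p j)) by exact hneg.
  assert (Hf : forall w, U w -> Cdiffable f w).
  { intros w Hw. destruct (hf w Hw) as [l Hl]. exists l. apply Cder_iff_is_derive. exact Hl. }
  destruct (power_growth f K M hbound) as [m [HK Hg]].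
  pose (d := fun j => (/ Cmod (p j))%R).
  assert (Hd : forall j, 0 <= d j).
  { intros j. left. apply Rinv_0_lt_compat, Cmod_gt_0, negative_real_neq_0, Hp. }
  destruct (psum_summable d Hd hsum) as [S [HS0 [HS HS']]].
  destruct (remainder_kernel_axis_bound f p x K S m Hp hx HK Hg HS) as [B [HB HBn]].
  pose (g := fun n s => remainder_kernel f p x n (Ci * RtoC s) * Ci).
  pose (N := (m + 3)%nat).
  pose (A := (B * (1 + Cmod x))%R).
  assert (HA : 0 <= A) by (apply Rmult_le_pos; [exact HB|pose proof (Cmod_ge_0 x); lra]).
  assert (Hsq : forall s : R, 0 < 1 + s * s) by (intros s; nra).
  assert (Hg1 : forall n s, (N <= n)%nat -> Cmod (g n s) <= B / (1 + s * s)).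
  { intros n s Hn. unfold g. rewrite Cmod_mult, Cmod_Ci, Rmult_1_r.
    eapply Rle_trans; [apply HBn, Hn|apply cube_le_square, HB]. }
  assert (Hlim : forall s, exists l, Clim (fun n => g n s) l /\
    forall n, (N <= n)%nat -> Cmod (l - g n s) <= A / (1 + s * s) * (S - psum d n)).
  { intros s. apply Clim_of_dominated_increments; [|exact HS|exact HS'|].
    - apply Rmult_le_pos; [exact HA|]. left. apply Rinv_0_lt_compat, Hsq.
    - intros n Hn. unfold g.
      replace (remainder_kernel f p x (n + 1) (Ci * RtoC s) * Ci - remainder_kernel f p x n (Ci * RtoC s) * Ci) with
        ((remainder_kernel f p x (n + 1) (Ci * RtoC s) - remainder_kernel f p x n (Ci * RtoC s)) * Ci) by ring.
      rewrite Cmod_mult, Cmod_Ci, Rmult_1_r, Nat.add_1_r. simpl psum.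
      replace (psum d n + d n - psum d n)%R with (d n) by ring.
      rewrite <- Nat.add_1_r. apply remainder_kernel_axis_step; auto. }
  pose (G := fun s => f (Ci * RtoC s) / (Ci * RtoC s - x) * (Hfun z x / Hfun z (Ci * RtoC s)) * Ci).
  assert (HH : forall y, Clim (H_partial p y) (Hfun z y)).
  { intros y. destruct (H_partial_converges p S y Hp HS HS') as [l Hl].
    assert (El : Hfun z y = l) by (apply Cprod_inf_Clim; exact Hl). rewrite El. exact Hl. }
  assert (HQ : forall s, Clim (Q_partial p x (Ci * RtoC s)) (Hfun z x / Hfun z (Ci * RtoC s))).
  { intros s.
    replace (Q_partial p x (Ci * RtoC s)) with (fun n => H_partial p x n * / H_partial p (Ci * RtoC s) n)
      by (apply functional_extensionality; intros n; symmetry; apply Q_partial_H, Hp).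
    apply Clim_mult; [apply HH|]. apply Clim_inv; [|apply HH].
    intros n. rewrite <- (pow1 n). apply Cprod_lower; [lra|]. intros j _. apply axis_factor, Hp. }
  assert (HG : forall n s, (N <= n)%nat -> Cmod (G s - g n s) <= A / (1 + s * s) * (S - psum d n)).
  { intros n s Hn. destruct (Hlim s) as [l [Hl HlB]].
    assert (El : G s = l).
    { apply (Clim_unique (fun n => g n s)); [|exact Hl].
      replace (fun n => g n s) with (fun n => f (Ci * RtoC s) / (Ci * RtoC s - x) * Q_partial p x (Ci * RtoC s) n * Ci)
        by (apply functional_extensionality; intros k; unfold g; rewrite remainder_kernel_axis by assumption; reflexivity).
      apply Clim_mult; [|apply Clim_const]. apply Clim_mult; [apply Clim_const|apply HQ]. }
    rewrite El. apply HlB, Hn. }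
  assert (Hpsum : forall n, 0 <= psum d n).
  { induction n as [|n IH]; simpl; [lra|]. specialize (Hd n). lra. }
  assert (Hgc : forall n s, RCcont (g n) s).
  { intros n s. apply RCcont_mult; [|apply RCcont_const].
    apply (RCcont_comp (remainder_kernel f p x n) (fun s => Ci * RtoC s)); [eapply RCderive_RCcont, RCderive_axis|].
    apply Ccont_mult; [apply Ccont_const|]. apply (Ccont_remainder_quotient U); try assumption.
    - rewrite Re_Ci_RtoC. lra.
    - intros j _ E. pose proof (negative_real_Re _ (Hp j)) as H. rewrite <- E, Re_Ci_RtoC in H. lra.
    - intros E. rewrite <- E, Re_Ci_RtoC in hx. lra. }
  assert (HAle : forall s, A / (1 + s * s) <= A).
  { intros s. specialize (Hsq s). rewrite <- (Rmult_1_r A) at 2. apply Rmult_le_compat_l; [exact HA|].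
    rewrite <- Rinv_1. apply Rinv_le_contravar; nra. }
  assert (HGc : forall s, RCcont G s).
  { apply (RCcont_uniform_limit (fun n => g (n + N)%nat) G (fun n => A * (S - psum d (n + N)))%R).
    - intros n s. apply Hgc.
    - intros e He. destruct (HS' (e / (A + 1))%R) as [n0 Hn0]; [apply Rdiv_lt_0_compat; lra|].
      exists n0. specialize (Hn0 (n0 + N)%nat ltac:(lia)). specialize (HS (n0 + N)%nat).
      apply Rle_lt_trans with (A * (e / (A + 1)))%R; [apply Rmult_le_compat_l; lra|].
      apply Rmult_lt_reg_r with (A + 1)%R; [lra|].
      replace (A * (e / (A + 1)) * (A + 1))%R with (A * e)%R by (field; lra). nra.
    - intros n s. eapply Rle_trans; [apply HG; lia|]. apply Rmult_le_compat_r; [|apply HAle].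
      specialize (HS (n + N)%nat). lra. }
  assert (HGb : forall s, Cmod (G s) <= (B + A * S) / (1 + s * s)).
  { intros s. specialize (HG N s (le_n N)). specialize (Hg1 N s (le_n N)). specialize (Hpsum N).
    pose proof (Cmod_le_add (G s) (g N s)).
    assert (0 <= A / (1 + s * s)) by (apply Rmult_le_pos; [exact HA|left; apply Rinv_0_lt_compat, Hsq]).
    assert (A / (1 + s * s) * (S - psum d N) <= A / (1 + s * s) * S) by (apply Rmult_le_compat_l; lra).
    replace ((B + A * S) / (1 + s * s))%R with (B / (1 + s * s) + A / (1 + s * s) * S)%R by (unfold Rdiv; ring).
    lra. }
  assert (HBAS : 0 <= B + A * S) by (assert (0 <= A * S) by (apply Rmult_le_pos; assumption); lra).
  destruct (improper_integral G (B + A * S) HBAS HGc HGb) as [I [HI HIsym]].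
  pose (J := fun n => two_pi_i * (dd f (map p (seq 0 n)) x * Cprod (fun j => x - p j) n)).
  assert (HJ : forall n, (N <= n)%nat -> Cmod (J n - I) <= A * (S - psum d n) * PI).
  { intros n Hn. apply le_epsilon. intros e He.
    destruct (HIsym (e / 2)%R ltac:(lra)) as [T1 HT1].
    destruct (remainder_half_disc U f p x hU hOmega Hf Hp hx n) as [T2 [_ HT2]].
    destruct (remainder_arc U f p x K m hOmega Hf Hp HK Hg n ltac:(unfold N in Hn; lia) (e / 2)%R ltac:(lra)) as [T3 HT3].
    pose (r := (Rmax (Rmax T1 T2) (Rmax T3 0) + 1)%R).
    assert (r1 : T1 < r) by (pose proof (Rmax_l T1 T2); pose proof (Rmax_l (Rmax T1 T2) (Rmax T3 0)); unfold r; lra).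
    assert (r2 : T2 < r) by (pose proof (Rmax_r T1 T2); pose proof (Rmax_l (Rmax T1 T2) (Rmax T3 0)); unfold r; lra).
    assert (r3 : T3 < r) by (pose proof (Rmax_l T3 0); pose proof (Rmax_r (Rmax T1 T2) (Rmax T3 0)); unfold r; lra).
    assert (r4 : 0 < r) by (pose proof (Rmax_r T3 0); pose proof (Rmax_r (Rmax T1 T2) (Rmax T3 0)); unfold r; lra).
    specialize (HT1 r r1). specialize (HT2 r r2). specialize (HT3 r r3).
    assert (EJ : J n = CRInt (g n) (- r) r + circle_arc_integral 0 r (1 / 4) (3 / 4) (remainder_kernel f p x n))
      by (unfold J; rewrite <- HT2; reflexivity).
    assert (ED : CRInt (fun s => 1 * g n s + - (1) * G s) (- r) r = CRInt (g n) (- r) r - CRInt G (- r) r).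
    { rewrite CRInt_lin by (apply ex_CRInt_all; auto). cring. }
    assert (BD : Cmod (CRInt (g n) (- r) r - CRInt G (- r) r) <= A * (S - psum d n) * (atan r - atan (- r))).
    { rewrite <- ED. apply CRInt_atan_bound; [| |lra].
      - intros s. apply (continuous_plus (U := R_UniformSpace) (V := C_R_NormedModule)); apply RCcont_mult;
          auto using RCcont_const.
      - intros s. replace (1 * g n s + - (1) * G s) with (- (G s - g n s)) by ring. rewrite Cmod_opp.
        eapply Rle_trans; [apply HG, Hn|]. right. unfold Rdiv. ring. }
    pose proof (atan_bound r) as Ar. rewrite atan_opp in BD.
    assert (HSn : 0 <= A * (S - psum d n)) by (apply Rmult_le_pos; [exact HA|specialize (HS n); lra]).
    assert (BP : A * (S - psum d n) * (atan r - - atan r) <= A * (S - psum d n) * PI)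
      by (apply Rmult_le_compat_l; lra).
    rewrite EJ.
    set (arc := circle_arc_integral 0 r (1 / 4) (3 / 4) (remainder_kernel f p x n)) in *.
    replace (CRInt (g n) (- r) r + arc - I) with
      ((CRInt (g n) (- r) r - CRInt G (- r) r) + ((CRInt G (- r) r - I) + arc)) by cring.
    eapply Rle_trans; [apply Cmod_triangle|].
    pose proof (Cmod_triangle (CRInt G (- r) r - I) arc). lra. }
  assert (LJ : Clim J I).
  { intros e He. pose proof PI_RGT_0.
    assert (HAP : 0 <= A * PI) by (apply Rmult_le_pos; lra).
    destruct (HS' (e / (A * PI + 1))%R) as [n0 Hn0]; [apply Rdiv_lt_0_compat; lra|].
    exists (Nat.max n0 N). intros n Hn. specialize (HJ n ltac:(lia)). specialize (Hn0 n ltac:(lia)).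
    eapply Rle_lt_trans; [exact HJ|].
    replace (A * (S - psum d n) * PI)%R with (A * PI * (S - psum d n))%R by ring.
    specialize (HS n).
    apply Rle_lt_trans with (A * PI * (e / (A * PI + 1)))%R; [apply Rmult_le_compat_l; lra|].
    apply Rmult_lt_reg_r with (A * PI + 1)%R; [lra|].
    replace (A * PI * (e / (A * PI + 1)) * (A * PI + 1))%R with (A * PI * e)%R by (field; lra). nra. }
  pose proof two_pi_i_neq_0 as H2.
  assert (HT : forall n, taylor (polyP a b c) U z f n x = f x + - / two_pi_i * J (n + 1)%nat).
  { intros n. rewrite Nat.add_1_r. unfold J.
    rewrite (newton_formula f p x n) at 1.
    assert (E : taylor (polyP a b c) U z f n x = sum_n (G := C_AbelianGroup)
      (fun k => dd f (map p (seq 0 k)) (p k) * Cprod (fun j => x - p j) k) n).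
    { apply sum_n_ext. intros k.
      rewrite (partial_divided_difference a b c z U f k hz hneg hU hOmega Hf). reflexivity. }
    rewrite E.
    assert (cancel : forall q r : C, q = q + r + - / two_pi_i * (two_pi_i * r)) by (intros; field; exact H2).
    apply cancel. }
  exists (f x + - / two_pi_i * I), I.
  assert (axis : forall F : C -> C, (forall s, F (Ci * RtoC s) * Ci = G s) -> is_imaginary_axis_integral F I).
  { intros F HF. unfold is_imaginary_axis_integral.
    replace (fun s => F (Ci * RtoC s) * Ci) with G by (apply functional_extensionality; intros s; symmetry; apply HF).
    exact HI. }
  split; [|split; [|split]].
  - apply Clim_filterlim. intros e He.
    assert (Hm2 : 0 < Cmod (/ two_pi_i)) by (apply Cmod_gt_0, Cinv_neq_0, H2).
    destruct (LJ (e / Cmod (/ two_pi_i))%R (Rdiv_lt_0_compat _ _ He Hm2)) as [n0 Hn0].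
    exists n0. intros n Hn. rewrite HT. specialize (Hn0 (n + 1)%nat ltac:(lia)).
    replace (f x + - / two_pi_i * J (n + 1)%nat - (f x + - / two_pi_i * I)) with
      (- (/ two_pi_i * (J (n + 1)%nat - I))) by ring.
    rewrite Cmod_opp, Cmod_mult.
    apply (Rmult_lt_compat_l (Cmod (/ two_pi_i))) in Hn0; [|exact Hm2].
    replace (Cmod (/ two_pi_i) * (e / Cmod (/ two_pi_i)))%R with e in Hn0 by (field; lra). exact Hn0.
  - apply axis. reflexivity.
  - apply axis. intros s. unfold G. rewrite <- (Cprod_inf_Clim _ _ (HQ s)). reflexivity.
  - ring.
Qed.
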